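(* Let $B=2^{k_1}C_1\perp\cdots\perp2^{k_r}C_r\in\mathcal H_n(\mathfrak o)$ be a pre-optimal form, and write $\mathrm{GK}(B)=(\underbrace{m_1,\ldots,m_1}_{n_1},\ldots,\underbrace{m_s,\ldots,m_s}_{n_s})$ with $m_1<\cdots<m_s$ and $n=n_1+\cdots+n_s$; put $n_j^*=n_1+\cdots+n_j$. Then: (1) for every $1\le j\le s$ there is an integer $1\le l_j\le r$ such that $B^{(n_j^* )}=B^{[l_j]}$ (i.e. $n_j^*=\deg C_1+\cdots+\deg C_{l_j}$); (2) defining $\zeta_j=\eta_{B^{[l_j]}}$ if $n_j^*$ is odd and $\zeta_j=\xi_{B^{[l_j]}}$ if $n_j^*$ is even, we have $\mathrm{EGK}(B)=(n_1,\ldots,n_s;m_1,\ldots,m_s;\zeta_1,\ldots,\zeta_s)$.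
   Context: Let $F$ be a finite unramified extension of $\mathbb Q_2$ with ring of integers $\mathfrak o$, $\mathrm{ord}$ the valuation with $\mathrm{ord}(2)=1$, $\mathrm{ord}(0)=+\infty$. $\mathcal H_n(\mathfrak o)$ is the set of symmetric $B=(b_{ij})\in M_n(F)$ with $b_{ii}\in\mathfrak o$, $2b_{ij}\in\mathfrak o$; nondegenerate means $\det B\ne0$. $B^{(m)}$ is the upper-left $m\times m$ submatrix; $\perp$ is block-diagonal sum; $B\sim B'$ means $B'={}^tUBU$ with $U\in GL_n(\mathfrak o)$. For nondegenerate $B$ of degree $n$: $D_B=(-4)^{[n/2]}\det B$; $\xi_B=1,-1,0$ according as $D_B\in F^{\times2}$, $F(\sqrt{D_B})/F$ is unramified quadratic, or ramified; if $B$ is $GL_n(F)$-equivalent to $\mathrm{diag}(b_1',\dots,b_n')$, $\eta_B=\langle-1,-1\rangle^{[(n+1)/4]}\langle-1,\det B\rangle^{[(n-1)/2]}\prod_{i<j}\langle b_i',b_j'\rangle$ (Hilbert symbols; this is the Clifford invariant). $S_2(\mathfrak o)_e$: symmetric $2\times2$ matrices over $\mathfrak o$ with diagonal in $2\mathfrak o$; unimodular diagonal: diagonal with unit entries. GK invariant: $S(B)$ is the set of non-decreasing $(a_i)\in\mathbb Z_{\ge0}^n$ with $\mathrm{ord}(b_{ii})\ge a_i$ and $\mathrm{ord}(2b_{ij})\ge(a_i+a_j)/2$ ($i\le j$); $\mathbf S(\{B\})=\bigcup_{U\in GL_n(\mathfrak o)}S({}^tUBU)$; $\mathrm{GK}(B)$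 is its lexicographically greatest element; $B$ is optimal if $\mathrm{GK}(B)\in S(B)$. Extended GK datum: for nondegenerate $B$, choose optimal $B'\sim B$, write $\mathrm{GK}(B')=(m_1^{(n_1)},\dots,m_t^{(n_t)})$ ($m_1<\dots<m_t$, multiplicities $n_i$), $n_u^*=n_1+\dots+n_u$, $\zeta_u=\xi_{B'^{(n_u^* )}}$ if $n_u^*$ even and $\eta_{B'^{(n_u^* )}}$ if odd; $\mathrm{EGK}(B)=(n_1,\dots,n_t;m_1,\dots,m_t;\zeta_1,\dots,\zeta_t)$ (independent of the choice of $B'$). Pre-optimal forms: $B=2^{k_1}C_1\perp\cdots\perp2^{k_r}C_r$ with $k_i\ge0$, each $C_i$ unimodular diagonal or in $\frac12(S_2(\mathfrak o)_e\cap GL_2(\mathfrak o))$; $B^{[j]}=2^{k_1}C_1\perp\cdots\perp2^{k_j}C_j$; $\mathcal D_m=\{j:k_j=m, C_j\text{ diagonal}\}$, $\mathcal E_m=\{j:k_j=m, C_j\text{ not diagonal}\}$. Pre-optimal means: (PO1) $\sum_{j\in\mathcal D_m}\deg C_j\le2$ and $\mathcal E_m$ is a (possibly empty) set of consecutive integers, for each $m$; (PO2) for $i<j$: $\mathcal D_{m_1}\ni i$, $\mathcal D_{m_2}\ni j\Rightarrow m_1\le m_2$; $\mathcal E_{m_1}\ni i,\mathcal E_{m_2}\ni j\Rightarrow m_1\le m_2$; $\mathcal D_{m_1}\ni i,\mathcal E_{m_2}\ni j\Rightarrow m_1\le m_2-1$; $\mathcal E_{m_1}\ni i,\mathcal D_{m_2}\ni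 j\Rightarrow m_1\le m_2+1$; (PO3) if $C_i$ is unimodular diagonal of degree 2 then $i\ge2$ and either ($\deg B^{[i]}$ even and $\xi_{B^{[i-1]}}=\xi_{B^{[i]}}=0$) or ($\deg B^{[i-1]}$ odd and $\mathrm{ord}\det B^{[i-1]}+k_i$ even); (PO4) if $k_i=k_{i-1}-1$, $C_i$ diagonal, $C_{i-1}$ not diagonal, then $\deg C_i=2$, or $\deg C_i=1$ and either ($\deg B^{[i]}$ and $\mathrm{ord}\det B^{[i]}$ even) or ($\deg B^{[i]}$ odd and $\xi_{B^{[i-1]}}=0$); (PO5) if $C_i$ diagonal, $C_{i+1}$ not diagonal, $k_i=k_{i+1}-1$, then $\deg C_i=1$ and either ($\deg B^{[i]}$ even and $\mathrm{ord}\det B^{[i]}$ odd) or ($\deg B^{[i]}$ odd and $\xi_{B^{[i-1]}}\ne0$ if $i\ge2$); (PO6) if $\deg B^{[i]}$ even, $C_i,C_{i+1}$ unimodular diagonal and $k_{i+1}=k_i+1$, then $\xi_{B^{[i]}}=0$. *)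

(* Defs.v *)
From HB Require Import structures.
From mathcomp Require Import all_boot all_order all_algebra.
From mathcomp Require Import boolp.
From mathcomp Require classical_sets.

Set Implicit Arguments.
Unset Strict Implicit.
Unset Printing Implicit Defensive.

Import Order.TTheory GRing.Theory Num.Theory.
Local Open Scope ring_scope.

(* The base field.  A valuation v : F -> int (its value at 0 is       *)
(* irrelevant; ord(0) = +oo is encoded by vge below).                 *)

Definition vge (F : fieldType) (v : F -> int) (x : F) (k : int) : bool :=
  (x == 0) || (k <= v x).

Definition integral (F : fieldType) (v : F -> int) (x : F) : bool := vge v x 0.

Definition unit_o (F : fieldType) (v : F -> int) (x : F) : bool :=
  (x != 0) && (v x == 0).

(* (F, v) is a finite unramified extension of Q_2 with its normalized
   valuation: a complete discretely valued field with v(2) = 1 (so 2 is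
   a uniformizer), 2 != 0, and finite residue field o/2o. *)
Record unram2 (F : fieldType) (v : F -> int) : Prop := {
  v_mul : forall x y : F, x != 0 -> y != 0 -> v (x * y) = v x + v y;
  v_add : forall x y : F, x != 0 -> y != 0 -> x + y != 0 ->
            v x <= v (x + y) \/ v y <= v (x + y);
  two_nz : (2 : F) != 0;
  v_two : v 2 = 1;
  res_fin : exists s : seq F, all (integral v) s /\
            forall x, integral v x -> exists2 y, y \in s & vge v (x - y) 1;
  v_complete : forall u : nat -> F,
     (forall N : int, exists M : nat, forall p, (M <= p)%N -> vge v (u p.+1 - u p) N) ->
     exists l : F, forall N : int, exists M : nat, forall p, (M <= p)%N -> vge v (u p - l) N
}.

Definition hilb (F : fieldType) (a b : F) : int :=
  if `[< exists x y z : F, [|| x != 0, y != 0 | z != 0] /\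
                          z ^+ 2 = a * x ^+ 2 + b * y ^+ 2 >] then 1 else -1.

(* entry (i,j) of M addressed by natural numbers (0 outside the range) *)
Definition mxe (F : fieldType) (n : nat) (M : 'M[F]_n) (i j : nat) : F :=
  match (insub i : option 'I_n), (insub j : option 'I_n) with
  | Some i', Some j' => M i' j'
  | _, _ => 0
  end.

Definition ulsub (F : fieldType) (n : nat) (m : nat) (M : 'M[F]_n) : 'M[F]_m :=
  \matrix_(i < m, j < m) mxe M i j.

Definition in_Hn (F : fieldType) (v : F -> int) (n : nat) (M : 'M[F]_n) : bool :=
  [&& M^T == M, [forall i, integral v (M i i)] &
      [forall i, forall j, integral v (2 * M i j)]].

Definition GLo (F : fieldType) (v : F -> int) (n : nat) (U : 'M[F]_n) : bool :=
  [forall i, forall j, integral v (U i j)] && unit_o v (\det U).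

Definition sim (F : fieldType) (v : F -> int) (n : nat) (B B' : 'M[F]_n) : Prop :=
  exists U : 'M[F]_n, GLo v U /\ B' = U^T *m B *m U.

(* lexicographic order on sequences of naturals (of equal length) *)
Fixpoint lexle (s t : seq nat) : bool :=
  match s, t with
  | x :: s', y :: t' => (x < y)%N || ((x == y) && lexle s' t')
  | _, _ => true
  end.

Definition inS (F : fieldType) (v : F -> int) (n : nat) (M : 'M[F]_n) (a : seq nat) : Prop :=
  [/\ size a = n, sorted leq a,
      (forall i : 'I_n, vge v (M i i) (nth 0%N a i)%:Z) &
      (forall i j : 'I_n, (i <= j)%N ->
          (2 * M i j == 0) || ((nth 0%N a i + nth 0%N a j)%:Z <= 2 * v (2 * M i j)))].

Definition inSU (F : fieldType) (v : F -> int) (n : nat) (M : 'M[F]_n) (a : seq nat) : Prop :=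
  exists U : 'M[F]_n, GLo v U /\ inS v (U^T *m M *m U) a.

Definition GK (F : fieldType) (v : F -> int) (n : nat) (M : 'M[F]_n) : seq nat :=
  classical_sets.xget [::] (fun a => inSU v M a /\ forall a', inSU v M a' -> lexle a' a).

Definition optimal (F : fieldType) (v : F -> int) (n : nat) (M : 'M[F]_n) : Prop :=
  inS v M (GK v M).

(* xi of a discriminant D: 1 if square, -1 if F(sqrt D)/F unramified
   quadratic, 0 if ramified.  Unramifiedness of F(sqrt D) (D not a square)
   means ramification index 1, i.e. the extended valuation
   w = v o N / 2 takes only integer values: v(a^2 - D b^2) is always even. *)
Definition disc_xi (F : fieldType) (v : F -> int) (D : F) : int :=
  if `[< exists y : F, D = y ^+ 2 >] then 1
  else if `[< forall a b : F, (a != 0) || (b != 0) ->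
                 ~~ odd (absz (v (a ^+ 2 - D * b ^+ 2))) >] then -1
  else 0.

Definition xi (F : fieldType) (v : F -> int) (m : nat) (M : 'M[F]_m) : int :=
  disc_xi v ((-4) ^+ (m./2) * \det M).

Definition eta_diag (F : fieldType) (m : nat) (detM : F) (d : 'rV[F]_m) : int :=
  hilb (-1 : F) (-1) ^+ (m.+1 %/ 4) * hilb (-1 : F) detM ^+ (m.-1 %/ 2) *
  \prod_(i < m) \prod_(j < m | (i < j)%N) hilb (d 0 i) (d 0 j).

Definition eta (F : fieldType) (m : nat) (M : 'M[F]_m) : int :=
  eta_diag (\det M)
    (classical_sets.xget 0 (fun d : 'rV[F]_m => exists U : 'M[F]_m,
                U \in unitmx /\ U^T *m M *m U = diag_mx d)).

Definition zeta (F : fieldType) (v : F -> int) (m : nat) (M : 'M[F]_m) : int :=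
  if odd m then eta M else xi v M.

Fixpoint runs (s : seq nat) : seq (nat * nat) :=
  match s with
  | [::] => [::]
  | x :: t =>
      match runs t with
      | (k, y) :: r => if x == y then (k.+1, y) :: r else (1%N, x) :: (k, y) :: r
      | [::] => [:: (1%N, x)]
      end
  end.

Definition EGK (F : fieldType) (v : F -> int) (n : nat) (M : 'M[F]_n)
  : seq nat * seq nat * seq int :=
  let M' := classical_sets.xget M (fun M' => sim v M M' /\ optimal v M') in
  let rs := runs (GK v M') in
  let ns := map fst rs in
  (ns, map snd rs,
   [seq zeta v (ulsub (sumn (take j ns)) M') | j <- iota 1 (size ns)]).

(* BD s : diagonal matrix diag(s);  BE x y z : the 2x2 matrix [[x,y],[y,z]] *)
Inductive blk (F : Type) := BD of seq F | BE of F & F & F.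

Definition isD (F : Type) (b : blk F) : bool :=
  if b is BD _ then true else false.

Definition deg (F : Type) (b : blk F) : nat :=
  match b with BD s => size s | BE _ _ _ => 2 end.

Definition blk_entry (F : fieldType) (b : blk F) (i j : nat) : F :=
  match b with
  | BD s => if i == j then nth 0 s i else 0
  | BE x y z =>
      if (i == 0%N) && (j == 0%N) then x
      else if (i == 1%N) && (j == 1%N) then z
      else if ((i == 0%N) && (j == 1%N)) || ((i == 1%N) && (j == 0%N)) then y
      else 0
  end.

(* C unimodular diagonal (of positive degree), or
   C in (1/2)(S_2(o)_e \cap GL_2(o)) *)
Definition blk_ok (F : fieldType) (v : F -> int) (b : blk F) : bool :=
  match b with
  | BD s => (0 < size s)%N && all (unit_o v) s
  | BE x y z => [&& vge v (2 * x) 1, vge v (2 * z) 1, integral v (2 * y) &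
                    unit_o v ((2 * x) * (2 * z) - (2 * y) ^+ 2)]
  end.

Definition degs (F : Type) (bl : seq (nat * blk F)) : nat :=
  sumn (map (fun p => deg p.2) bl).

Fixpoint ent (F : fieldType) (bl : seq (nat * blk F)) (i j : nat) : F :=
  match bl with
  | [::] => 0
  | (k, b) :: t =>
      let d := deg b in
      if (i < d)%N && (j < d)%N then 2 ^+ k * blk_entry b i j
      else if (d <= i)%N && (d <= j)%N then ent t (i - d) (j - d)
      else 0
  end.

Definition assemble (F : fieldType) (bl : seq (nat * blk F)) : 'M[F]_(degs bl) :=
  \matrix_(i, j) ent bl i j.

(* 1-based accessors k_i, C_i, and B^{[j]} *)
Definition kb (F : Type) (bl : seq (nat * blk F)) (i : nat) : nat :=
  (nth (0%N, BD [::]) bl i.-1).1.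
Definition Cb (F : Type) (bl : seq (nat * blk F)) (i : nat) : blk F :=
  (nth (0%N, BD [::]) bl i.-1).2.
Definition Bpre (F : fieldType) (bl : seq (nat * blk F)) (j : nat) :=
  assemble (take j bl).

Definition ord_det_odd (F : fieldType) (v : F -> int) (m : nat) (M : 'M[F]_m) : bool :=
  odd (absz (v (\det M))).

Definition pre_optimal (F : fieldType) (v : F -> int) (bl : seq (nat * blk F)) : Prop :=
  let r := size bl in
  (forall m : nat,
     (\sum_(1 <= j < r.+1 | (kb bl j == m) && isD (Cb bl j)) deg (Cb bl j) <= 2)%N) /\
  (forall m i l j : nat, (1 <= i)%N -> (i < l)%N -> (l < j)%N -> (j <= r)%N ->
     kb bl i = m -> kb bl j = m -> ~~ isD (Cb bl i) -> ~~ isD (Cb bl j) ->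
     kb bl l = m /\ ~~ isD (Cb bl l)) /\
  (forall i j : nat, (1 <= i)%N -> (i < j)%N -> (j <= r)%N ->
     [/\ isD (Cb bl i) -> isD (Cb bl j) -> (kb bl i <= kb bl j)%N,
         ~~ isD (Cb bl i) -> ~~ isD (Cb bl j) -> (kb bl i <= kb bl j)%N,
         isD (Cb bl i) -> ~~ isD (Cb bl j) -> (kb bl i + 1 <= kb bl j)%N &
         ~~ isD (Cb bl i) -> isD (Cb bl j) -> (kb bl i <= kb bl j + 1)%N]) /\
  (forall i : nat, (1 <= i <= r)%N -> isD (Cb bl i) -> deg (Cb bl i) = 2%N ->
     (2 <= i)%N /\
     ((~~ odd (degs (take i bl)) /\ xi v (Bpre bl i.-1) = 0 /\ xi v (Bpre bl i) = 0) \/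
      (odd (degs (take i.-1 bl)) /\ ~~ odd (absz (v (\det (Bpre bl i.-1))) + kb bl i)%N))) /\
  (forall i : nat, (2 <= i <= r)%N -> (kb bl i + 1 = kb bl i.-1)%N ->
     isD (Cb bl i) -> ~~ isD (Cb bl i.-1) ->
     deg (Cb bl i) = 2%N \/
     (deg (Cb bl i) = 1%N /\
      ((~~ odd (degs (take i bl)) /\ ~~ ord_det_odd v (Bpre bl i)) \/
       (odd (degs (take i bl)) /\ xi v (Bpre bl i.-1) = 0)))) /\
  (forall i : nat, (1 <= i)%N -> (i < r)%N ->
     isD (Cb bl i) -> ~~ isD (Cb bl i.+1) -> (kb bl i + 1 = kb bl i.+1)%N ->
     deg (Cb bl i) = 1%N /\
     ((~~ odd (degs (take i bl)) /\ ord_det_odd v (Bpre bl i)) \/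
      (odd (degs (take i bl)) /\ ((2 <= i)%N -> xi v (Bpre bl i.-1) != 0)))) /\
  (forall i : nat, (1 <= i)%N -> (i < r)%N -> ~~ odd (degs (take i bl)) ->
     isD (Cb bl i) -> isD (Cb bl i.+1) -> (kb bl i.+1 = kb bl i + 1)%N ->
     xi v (Bpre bl i) = 0).

(* Main.v *)
Require Import Defs.
From HB Require Import structures.
From mathcomp Require Import all_boot all_order all_algebra.
From mathcomp Require Import boolp.
From mathcomp Require Import zify ring.
From mathcomp Require classical_sets.

(* For integral A and exponents a with A in S(a), filter the lattice by the vectors whose i-th
   coordinate has valuation at least (m - a_i)/2.  If the quadratic form induced on every graded
   piece has trivial radical, the filtration is intrinsic: a is then lexicographically greatest, and
   any two bases in which a is attained differ by a matrix respecting the filtration.  At a jump of a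
   the corresponding upper-left blocks have the same graded form, and the graded form determines the
   value zeta: its hyperbolic or anisotropic planes have unramified discriminant, and Hilbert symbols
   of such a discriminant with units are trivial.

   For a pre-optimal form such exponents are built block by block.  A new vector of scale K is
   corrected by an integral combination of the earlier ones, so that it either stays single or forms
   a plane with an earlier single vector or with its neighbour; (PO1)-(PO6) ensure that the exponents
   stay non-decreasing.  The base change is unitriangular, hence does not affect zeta of the leading
   blocks, and jumps of a only occur at block boundaries. *)

(** A basis vector of exponent [a i] matters in the graded piece of level m only when m and [a i]
    have the same parity. Over the perfect residue field of characteristic 2 a sum of planes and at
    most one further vector of nonzero value has trivial radical; hence two singles are allowed, one
    for each parity. Their number can be read off from the form: none means even degree and nonzero
    xi, one means odd degree, two means even degree and xi zero. This translates the conditions on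
    xi, degrees and determinants in (PO3)-(PO6) into conditions on singles, and so drives the
    construction. A plane may join vectors on both sides of a jump of the exponents, so the final
    matching need not restrict to a leading block; each stage therefore remembers a matching valid
    at every earlier jump. The invariance of eta, and the bimultiplicativity of the Hilbert symbol
    behind it, are derived from the axioms of the field: the index of the norm group by counting in
    the residue field, the Hasse invariant by Witt's chains of changes of two vectors. *)

Set Implicit Arguments.
Unset Strict Implicit.
Unset Printing Implicit Defensive.

Import Order.TTheory GRing.Theory Num.Theory.
Local Open Scope ring_scope.

(** * Valuations and square roots *)

Section Valuation.

Variables (F : fieldType) (v : F -> int).
Hypothesis HF : unram2 v.

(* Half-integral bounds (a_i + a_j) / 2 are doubled, so that all bounds are integers. *)
Definition wge (x : F) (k : int) : bool := (x == 0) || (k <= 2 * v x).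
Definition wex (x : F) (k : int) : bool := (x != 0) && (2 * v x == k).

Lemma vM x y : x != 0 -> y != 0 -> v (x * y) = v x + v y.
Proof. by move=> x0 y0; apply: (v_mul HF). Qed.

Lemma v1 : v 1 = 0.
Proof.
have n1 : (1 : F) != 0 by exact: oner_neq0.
have : v (1 * 1) = v 1 + v 1 by apply: vM.
rewrite mulr1; lia.
Qed.

Lemma two_neq0 : (2 : F) != 0. Proof. exact: (two_nz HF). Qed.

Lemma vN x : v (- x) = v x.
Proof.
have [->|x0] := eqVneq x 0; first by rewrite oppr0.
have n1 : (-1 : F) != 0 by rewrite oppr_eq0 oner_eq0.
have := vM n1 n1; rewrite mulN1r opprK v1 => h.
rewrite -mulN1r vM //; lia.
Qed.

Lemma vV x : x != 0 -> v x^-1 = - v x.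
Proof.
move=> x0; have := @vM x x^-1 x0; rewrite invr_eq0 => /(_ x0).
by rewrite divff // v1; lia.
Qed.

Lemma vX x n : x != 0 -> v (x ^+ n) = n%:Z * v x.
Proof.
move=> x0; elim: n => [|n IH]; first by rewrite expr0 v1 mul0r.
rewrite exprS vM ?expf_neq0 // IH; lia.
Qed.

Lemma v2X n : v (2 ^+ n) = n%:Z.
Proof. by rewrite vX ?two_neq0 // (v_two HF) mulr1. Qed.

Lemma wgeP x k : reflect (x != 0 -> k <= 2 * v x) (wge x k).
Proof.
rewrite /wge; apply: (iffP idP) => [/orP[/eqP->|//]|]; first by rewrite eqxx.
by case: (eqVneq x 0) => //= x0 /(_ isT).
Qed.

Lemma wge0 k : wge 0 k. Proof. by rewrite /wge eqxx. Qed.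

Lemma wge_le x k l : wge x k -> l <= k -> wge x l.
Proof. move=> /wgeP h lk; apply/wgeP => /h; lia. Qed.

(* Sharpens a bound by the evenness of [2 * v x]. *)
Lemma wge_par x k l : wge x k -> (forall z : int, k <= 2 * z -> l <= 2 * z) -> wge x l.
Proof. by move=> /wgeP h kl; apply/wgeP => /h /kl. Qed.

Lemma wgeN x k : wge (- x) k = wge x k.
Proof. by rewrite /wge oppr_eq0 vN. Qed.

Lemma wgeD x y k : wge x k -> wge y k -> wge (x + y) k.
Proof.
move=> /wgeP hx /wgeP hy; apply/wgeP => xy.
have [x0|x0] := eqVneq x 0; first by move: xy; rewrite x0 add0r.
have [y0|y0] := eqVneq y 0; first by move: xy; rewrite y0 addr0.
have := hx x0; have := hy y0; case: (v_add HF x0 y0 xy); lia.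
Qed.

Lemma wgeB x y k : wge x k -> wge y k -> wge (x - y) k.
Proof. by move=> hx hy; apply: wgeD => //; rewrite wgeN. Qed.

Lemma wgeM x y k l : wge x k -> wge y l -> wge (x * y) (k + l).
Proof.
move=> /wgeP hx /wgeP hy; apply/wgeP; rewrite mulf_eq0 negb_or => /andP[x0 y0].
rewrite vM //; have := hx x0; have := hy y0; lia.
Qed.

Lemma wgeM_le x y k l m : wge x k -> wge y l -> m <= k + l -> wge (x * y) m.
Proof. by move=> hx hy; apply: wge_le; apply: wgeM. Qed.

Lemma wge_sum (I : Type) (r : seq I) (P : pred I) (f : I -> F) k :
  (forall i, P i -> wge (f i) k) -> wge (\sum_(i <- r | P i) f i) k.
Proof. by move=> h; apply: (big_ind (fun x => wge x k)) => //; [exact: wge0 | by move=> x y; apply: wgeD]. Qed.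

Lemma wge1 k : k <= 0 -> wge 1 k.
Proof. by move=> h; apply/wgeP; rewrite v1; lia. Qed.

Lemma vge_wge x k : vge v x k = wge x (2 * k).
Proof. by rewrite /vge /wge; case: (x == 0) => //=; apply/idP/idP; lia. Qed.

Lemma integral_wge x : integral v x = wge x 0.
Proof. by rewrite /integral vge_wge mulr0. Qed.

Lemma wexP x k : reflect (x != 0 /\ 2 * v x = k) (wex x k).
Proof. by apply: (iffP andP) => -[? /eqP]. Qed.

Lemma unit_wex x : unit_o v x = wex x 0.
Proof. by rewrite /unit_o /wex; congr andb; apply/eqP/eqP; lia. Qed.

Lemma wex_neq0 x k : wex x k -> x != 0. Proof. by case/andP. Qed.
Lemma wex_wge x k l : wex x k -> l <= k -> wge x l.
Proof. move=> /wexP[_ h] lk; apply/wgeP; lia. Qed.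

Lemma wexM x y k l : wex x k -> wex y l -> wex (x * y) (k + l).
Proof.
move=> /wexP[x0 hx] /wexP[y0 hy]; apply/wexP; split; first by rewrite mulf_neq0.
rewrite vM //; lia.
Qed.

Lemma wexV x k : wex x k -> wex x^-1 (- k).
Proof.
move=> /wexP[x0 hx]; apply/wexP; rewrite invr_eq0 vV //; split=> //; lia.
Qed.

Lemma wexN x k : wex (- x) k = wex x k.
Proof. by rewrite /wex oppr_eq0 vN. Qed.

Lemma wexX x k n : wex x k -> wex (x ^+ n) (n%:Z * k).
Proof.
move=> /wexP[x0 hx]; apply/wexP; rewrite expf_neq0 // vX //; split=> //; lia.
Qed.

Lemma wex1 : wex 1 0. Proof. by rewrite /wex oner_eq0 v1. Qed.
Lemma wex2X n : wex (2 ^+ n) (2 * n%:Z).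
Proof. by rewrite /wex expf_neq0 ?two_neq0 //= v2X. Qed.
Lemma wex2 : wex 2 2. Proof. by have := wex2X 1; rewrite expr1. Qed.
Lemma wex4 : wex 4 4. Proof. have -> : 4 = 2 ^+ 2 :> F by ring. exact: (wex2X 2). Qed.
Lemma wex8 : wex 8 6. Proof. have -> : 8 = 2 ^+ 3 :> F by ring. exact: (wex2X 3). Qed.

Lemma wexD x y k : wex x k -> wge y (k + 1) -> wex (x + y) k.
Proof.
move=> /wexP[x0 hx] hy.
have xy : x + y != 0.
  apply/eqP => xy; have yE : y = - x by rewrite -[y](addKr x) xy addr0.
  by move: hy; rewrite yE wgeN => /wgeP/(_ x0); lia.
apply/wexP; split => //; apply/eqP; rewrite eq_le; apply/andP; split; last first.
  have/wgeP/(_ xy) : wge (x + y) k; last by [].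
  by apply: wgeD; [apply/wgeP; lia | apply: wge_le hy _; lia].
case: (lerP (2 * v (x + y)) k) => // h.
have : wge x (k + 1).
  have -> : x = (x + y) - y by ring.
  apply: wgeB => //; apply/wgeP; lia.
move/wgeP/(_ x0); lia.
Qed.

Lemma wexE x k y l : wex x k -> y = x -> l = k -> wex y l.
Proof. by move=> h -> ->. Qed.

Lemma wgeE x k y : wge x k -> y = x -> wge y k.
Proof. by move=> h ->. Qed.

Lemma wge_Vexl x y k l m : wge x k -> wex y l -> m <= k - l -> wge (x / y) m.
Proof.
move=> hx /wexV hy hm; apply: (wgeM_le hx (wex_wge hy (lexx _))); lia.
Qed.

Lemma wex_par x k : wex x k -> exists z : int, k = 2 * z.
Proof. by move=> /wexP[_ <-]; exists (v x). Qed.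

Lemma wge_wex x k : wge x (2 * k) -> ~~ wge x (2 * k + 2) -> wex x (2 * k).
Proof.
move=> /wgeP h1; rewrite /wge negb_or -ltNge => /andP[x0 h2].
apply/wexP; split=> //; have := h1 x0; lia.
Qed.

Lemma wge_div2 x k : wge x k -> wge (x / 2) (k - 2).
Proof. by move=> h; apply: wge_Vexl h wex2 _. Qed.

Lemma wge_half x k : wge (2 * x) k -> wge x (k - 2).
Proof.
move=> h; have := wge_div2 h; rewrite mulrC mulKf //; exact: two_neq0.
Qed.

Lemma wge_dbl x k l : wge x k -> l <= k + 2 -> wge (2 * x) l.
Proof. move=> h hl; apply: (wgeM_le (wex_wge wex2 (lexx _)) h); lia. Qed.

(* [y] is the root in 2o of y^2 + y = 2t, the limit of y |-> 2t - y^2. *)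
Lemma sqrt_1p8 t : wge t 0 -> exists y, 1 + 8 * t = y ^+ 2.
Proof.
move=> ht.
pose u := fix u n := if n is m.+1 then 2 * t - u m ^+ 2 else 0.
have uS n : u n.+1 = 2 * t - u n ^+ 2 by [].
have hu n : wge (u n) 2.
  elim: n => [|n IH] /=; first exact: wge0.
  apply: wgeB; first exact: (wge_dbl ht).
  by rewrite expr2; apply: (wgeM_le IH IH).
have hd n : wge (u n.+1 - u n) (2 * n%:Z + 2).
  elim: n => [|n IH]; first by rewrite subr0; exact: hu.
  have -> : u n.+2 - u n.+1 = - ((u n.+1 - u n) * (u n.+1 + u n)).
    by rewrite (uS n.+1) {2}(uS n); ring.
  rewrite wgeN; apply: (wgeM_le IH (wgeD (hu _) (hu _))); lia.
have [|l hl] := @v_complete _ _ HF u.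
  move=> N; exists `|N|%N => p hp; rewrite vge_wge; apply: wge_le (hd p) _; lia.
have lE : l ^+ 2 + l - 2 * t = 0.
  apply/eqP; apply: contraT => nz.
  move zE : (l ^+ 2 + l - 2 * t) nz => z nz.
  (* At precision [v z + 1] a nonzero defect [z] cannot survive: it is a combination, with integral
     coefficients, of two successive errors of the sequence. *)
  have [M hM] := hl (v z + 1).
  have h1 := hM M (leqnn _); have h2 := hM M.+1 (leqnSn _).
  rewrite vge_wge in h1; rewrite vge_wge in h2.
  have lint : wge l 0.
    have [M0 hM0] := hl 0; have := hM0 M0 (leqnn _); rewrite vge_wge mulr0 => h0.
    have -> : l = u M0 - (u M0 - l) by ring.
    by apply: wgeB => //; apply: wge_le (hu _) _.
  have : wge z (2 * v z + 1).
    have {}zE : z = - (u M.+1 - l) - (u M - l) * (u M + l).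
      by rewrite -zE uS; ring.
    apply: (wgeE _ zE); apply: wgeB; first by rewrite wgeN; apply: wge_le h2 _; lia.
    have hs : wge (u M + l) 0 by apply: wgeD => //; apply: wge_le (hu _) _.
    apply: (wgeM_le h1 hs); lia.
  by move/wgeP/(_ nz); lia.
exists (1 + 2 * l); have -> : 8 * t = 4 * (2 * t) by ring.
have -> : 2 * t = l ^+ 2 + l by apply/esym/eqP; rewrite -subr_eq0 lE.
ring.
Qed.

Lemma sqrt_near1 x : wge (x - 1) 6 -> exists y, x = y ^+ 2.
Proof.
move=> h; have [] := @sqrt_1p8 ((x - 1) / 8).
  by apply: wge_Vexl h wex8 _.
by move=> y; have e8 := wex_neq0 wex8; rewrite mulrC divfK // addrC subrK => ->; exists y.
Qed.

(* Pigeonhole on x, x^2, x^4, ...: two of them agree mod 2, and squaring is injective mod 2. *)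
Lemma sqrt_mod2 x : wge x 0 -> exists2 s, wge s 0 & wge (s ^+ 2 - x) 2.
Proof.
move=> hx; have [r [rint hr]] := res_fin HF.
pose p n := x ^+ (2 ^ n).
have pint n : wge (p n) 0.
  rewrite /p; elim: (2 ^ n)%N => [|m IH]; first by rewrite expr0; apply: wge1.
  by rewrite exprS; apply: (wgeM_le hx IH).
have hi n : (find (fun y => vge v (p n - y) 1) r < (size r).+1)%N by rewrite ltnS find_size.
pose g (n : 'I_(size r).+2) : 'I_(size r).+1 := Ordinal (hi n).
have /injectivePn[i [j ij gij]] : ~~ injectiveb g.
  by apply: contraTN isT => /injectiveP/leq_card; rewrite !card_ord ltnn.
have cong : wge (p i - p j) 2.
  have fr n : vge v (p n - nth 0 r (find (fun y => vge v (p n - y) 1) r)) 1.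
    apply: (nth_find _ (a := fun y => vge v (p n - y) 1)); apply/hasP.
    have := hr (p n); rewrite integral_wge => /(_ (pint n))[y yr hy]; by exists y.
  have := fr i; have := fr j; have -> : find (fun y => vge v (p j - y) 1) r =
     find (fun y => vge v (p i - y) 1) r by have := congr1 val gij.
  rewrite !vge_wge => h1 h2.
  set c := nth _ _ _ in h1 h2.
  have -> : p i - p j = (p i - c) - (p j - c) by ring.
  exact: wgeB.
have {ij gij}[m [n [mn {}cong]]] : exists m n : nat, (m < n)%N /\ wge (p n - p m) 2.
  have : (i != j :> nat) by []; rewrite neq_ltn => /orP[h|h].
    by exists i, j; split=> //; rewrite -wgeN opprB.
  by exists j, i.
have {cong} cong : wge (p (n - m)%N - p 0%N) 2.
  rewrite -(subnK (ltnW mn)) in cong.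
  elim: m (n - m)%N cong {mn} => [|m IH] d; first by rewrite addn0.
  rewrite addnS => h; apply: IH.
  have pS i0 : p i0.+1 = p i0 ^+ 2 by rewrite /p expnS mulnC exprM.
  set y := p _ - p m; apply/negPn/negP => /(wge_wex (k := 0)) hy.
  have : wex (y * y) 0.
    by apply: (wexE (wexM (hy _) (hy _))) => //; apply: wgeB.
  have -> : y * y = (p (d + m).+1 - p m.+1) - 2 * (p m * y).
    by rewrite !pS /y; ring.
  have hw : wge (2 * (p m * y)) 2.
    by apply: (wge_dbl (k := 0)) => //; apply: (wgeM_le (pint _) (wgeB (pint _) (pint _))).
  case/wexP => z0 zv; have := wgeB h hw; by rewrite /wge (negPf z0) zv.
have [d dE] : exists d, (n - m)%N = d.+1 by exists (n - m).-1; rewrite prednK // subn_gt0.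
exists (p d) => //; move: cong; rewrite dE /p expn0 expr1.
by rewrite expnS mulnC exprM.
Qed.

End Valuation.

(** * The Artin-Schreier map on the residue field *)

Section Residue.

Variables (F : fieldType) (v : F -> int).
Hypothesis HF : unram2 v.
Notation wge := (wge v).

(* z |-> z^2 + z is two-to-one on the residue field, so its image has index 2. *)
Lemma artin_schreier_index x1 x2 : wge x1 0 -> wge x2 0 ->
  exists2 z, wge z 0 & [|| wge (z ^+ 2 + z - x1) 2, wge (z ^+ 2 + z - x2) 2 |
                          wge (z ^+ 2 + z - (x1 + x2)) 2].
Proof.
move=> h1 h2; apply: contrapT => noz.
have [r [rint hr]] := res_fin HF.
have hr' x : wge x 0 -> has (fun y => vge v (x - y) 1) r.
  rewrite -(integral_wge v) => /hr[y yr hy]; by apply/hasP; exists y.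
(* A residue class is encoded by the first index in [r] of an element congruent to it; this is well
   defined even if [r] lists a class twice. The set [X] below keeps only the indices that occur, so
   it is a copy of the residue field. *)
pose cls (x : F) : 'I_(size r).+1 := inord (find (fun y => vge v (x - y) 1) r).
pose rep (i : 'I_(size r).+1) := nth 0 r i.
have repK x : wge x 0 -> wge (x - rep (cls x)) 2.
  move=> hx; rewrite /rep /cls inordK; last by rewrite ltnS find_size.
  by have := nth_find 0 (hr' x hx); rewrite vge_wge.
have rep_int i : wge (rep i) 0.
  rewrite /rep; have [hi|hi] := ltnP i (size r); last by rewrite nth_default // wge0.
  by rewrite -(integral_wge v); apply: (allP rint); rewrite mem_nth.
have cls_eq x y : wge x 0 -> wge y 0 -> wge (x - y) 2 <-> cls x = cls y.
  move=> hx hy; split=> [h|h].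
    congr inord; apply: eq_find => z; rewrite !vge_wge.
    apply/idP/idP => h3.
      by have -> : y - z = (x - z) - (x - y) by [ring]; apply: wgeB.
    by have -> : x - z = (y - z) + (x - y) by [ring]; apply: wgeD.
  have := wgeB HF (repK x hx) (repK y hy); rewrite h.
  by congr (wge _ _); ring.
pose X := [set cls (rep i) | i : 'I_(size r).+1].
have clsX x : wge x 0 -> cls x \in X.
  move=> hx; apply/imsetP; exists (cls x) => //; apply/(cls_eq _ _ hx (rep_int _)).
  exact: repK.
have clsK i : i \in X -> cls (rep i) = i.
  case/imsetP => j _ ->; apply/(cls_eq _ _ _ _) => //.
  have := repK (rep j) (rep_int j); by rewrite -(wgeN HF) opprB.
pose w (x : F) := x ^+ 2 + x.
have w_int x : wge x 0 -> wge (w x) 0.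
  by move=> hx; apply: wgeD => //; rewrite expr2; apply: (wgeM_le HF hx hx).
pose P := [set cls (w (rep i)) | i : 'I_(size r).+1].
pose tau c (i : 'I_(size r).+1) := cls (rep i + c).
have Pw x : wge x 0 -> cls (w x) \in P.
  move=> hx; apply/imsetP; exists (cls x) => //.
  apply/(cls_eq _ _ (w_int _ hx) (w_int _ (rep_int _))).
  have -> : w x - w (rep (cls x)) = (x - rep (cls x)) * (x + rep (cls x) + 1).
    by rewrite /w; ring.
  by apply: (wgeM_le HF (repK _ hx) (wgeD HF (wgeD HF hx (rep_int _)) (wge1 HF (lexx 0)))).
have PX : P \subset X by apply/subsetP => _ /imsetP[i _ ->]; apply: clsX; apply: w_int.
have tau_inj c : wge c 0 -> {in X &, injective (tau c)}.
  move=> hc i j iX jX /(cls_eq _ _ (wgeD HF (rep_int _) hc) (wgeD HF (rep_int _) hc)).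
  have -> : rep i + c - (rep j + c) = rep i - rep j by ring.
  by move/(cls_eq _ _ (rep_int _) (rep_int _)); rewrite !clsK.
have tauX c : wge c 0 -> tau c @: P \subset X.
  move=> hc; apply/subsetP => _ /imsetP[i _ ->]; apply: clsX; exact: wgeD.
have card_tau c : wge c 0 -> #|tau c @: P| = #|P|.
  move=> hc; apply: card_in_imset => i j iP jP; apply: (tau_inj c hc); exact: (subsetP PX).
(* [s] is a section of [w]. If [w] takes the same value at i and j, then (i - j)(i - j + 1) = 0 in
   the residue field, so every class is [s] of something or that plus 1. *)
pose s p := odflt ord0 [pick i in X | cls (w (rep i)) == p].
have leX : (#|X| <= 2 * #|P|)%N.
  have sub : X \subset (s @: P) :|: (tau 1 @: (s @: P)).
    apply/subsetP => i iX; rewrite inE.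
    have iP : cls (w (rep i)) \in P by apply: Pw.
    have [sX /eqP sE] : s (cls (w (rep i))) \in X /\
        cls (w (rep (s (cls (w (rep i)))))) == cls (w (rep i)).
      rewrite /s; case: pickP => [j /andP[//]|/(_ i)]; by rewrite iX eqxx.
    set j := s _ in sX sE.
    have : wge ((rep i - rep j) * (rep i - rep j + 1)) 2.
      move/esym/(cls_eq _ _ (w_int _ (rep_int _)) (w_int _ (rep_int _))): sE => h.
      have -> : (rep i - rep j) * (rep i - rep j + 1) =
         w (rep i) - w (rep j) - 2 * (rep j * (rep i - rep j)) by rewrite /w; ring.
      apply: wgeB => //; apply: (wge_dbl HF (k := 0)) => //.
      by apply: (wgeM_le HF (rep_int _) (wgeB HF (rep_int _) (rep_int _))).
    have dint : wge (rep i - rep j) 0 by apply: wgeB.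
    have d1int : wge (rep i - rep j + 1) 0 by apply: wgeD => //; apply: wge1.
    case: (boolP (wge (rep i - rep j) 2)) => [hd _|/(wge_wex (k := 0) dint) hd hm].
      apply/orP; left; apply/imsetP; exists (cls (w (rep i))) => //.
      by move/(cls_eq _ _ (rep_int _) (rep_int _)): hd; rewrite !clsK.
    apply/orP; right; apply/imsetP; exists j; first by apply/imsetP; exists (cls (w (rep i))).
    rewrite -[LHS](clsK i) // /tau; apply/(cls_eq _ _ (rep_int _) (wgeD HF (rep_int _) (wge1 HF (lexx 0)))).
    have hd1 : wge (rep i - rep j + 1) 2.
      have := wge_Vexl HF hm hd (lexx _); rewrite mulrAC divff ?mul1r ?subr0 //.
      exact: wex_neq0 hd.
    have -> : rep i - (rep j + 1) = (rep i - rep j + 1) - 2 by ring.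
    by apply: wgeB => //; apply: wex_wge (wex2 HF) _.
  apply: leq_trans (subset_leq_card sub) _; apply: leq_trans (leq_card_setU _ _) _.
  rewrite mul2n -addnn leq_add ?leq_imset_card //.
  apply: leq_trans (leq_imset_card _ _) _; exact: leq_imset_card.
(* Modulo 2 the map [w] is additive and signs do not matter, so a common element of two translates
   of [P] would put c + d into the image of [w]. *)
have disj c d : wge c 0 -> wge d 0 -> (forall z, wge z 0 -> ~~ wge (z ^+ 2 + z - (c + d)) 2) ->
    [disjoint tau c @: P & tau d @: P].
  move=> hc hd hz; rewrite -setI_eq0; apply/eqP/setP => i; rewrite !inE.
  apply/negP => /andP[/imsetP[_ /imsetP[j _ ->] ->] /imsetP[_ /imsetP[k _ ->]]].
  move/(cls_eq _ _ (wgeD HF (rep_int _) hc) (wgeD HF (rep_int _) hd)).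
  have ej := repK _ (w_int _ (rep_int j)); have ek := repK _ (w_int _ (rep_int k)).
  set rj := rep (cls _) in ej *; set rk := rep (cls (w (rep k))) in ek *.
  move=> h; have := hz (rep j - rep k) (wgeB HF (rep_int _) (rep_int _)).
  suff -> : wge ((rep j - rep k) ^+ 2 + (rep j - rep k) - (c + d)) 2 by [].
  have -> : (rep j - rep k) ^+ 2 + (rep j - rep k) - (c + d) =
     (w (rep j) - rj) - (w (rep k) - rk) + (rj + c - (rk + d)) -
       2 * (c + rep k * (rep j - rep k)) by rewrite /w; ring.
  apply: wgeB => //; first by apply: wgeD => //; apply: wgeB.
  apply: (wge_dbl HF (k := 0)) => //; apply: wgeD => //.
  by apply: (wgeM_le HF (rep_int _) (wgeB HF (rep_int _) (rep_int _))).
have nz c z : (c == x1) || (c == x2) || (c == x1 + x2) -> wge z 0 -> ~~ wge (z ^+ 2 + z - c) 2.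
  move=> hc hz; apply/negP => h; apply: noz; exists z => //.
  by case/orP: hc => [/orP[]|] /eqP <-; rewrite h ?orbT.
have i0 : wge 0 0 := wge0 v 0.
have d01 : [disjoint tau 0 @: P & tau x1 @: P].
  by apply: disj => // z; rewrite add0r; apply: nz; rewrite eqxx.
have d02 : [disjoint tau 0 @: P & tau x2 @: P].
  by apply: disj => // z; rewrite add0r; apply: nz; rewrite eqxx orbT.
have d12 : [disjoint tau x1 @: P & tau x2 @: P].
  by apply: disj => // z; apply: nz; rewrite eqxx !orbT.
(* Three disjoint translates would give 3|P| <= |X| <= 2|P| with [P] nonempty. *)
have : (#|tau 0%R @: P :|: tau x1 @: P :|: tau x2 @: P| <= #|X|)%N.
  by apply: subset_leq_card; rewrite !subUset !tauX.
rewrite cardsU (_ : _ :&: tau x2 @: P = set0); last first.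
  by apply/eqP; rewrite setIUl setU_eq0 !setI_eq0 d02 d12.
rewrite cardsU (_ : tau 0 @: P :&: _ = set0); last by apply/eqP; rewrite setI_eq0.
rewrite cards0 !subn0 !card_tau //.
have : (0 < #|P|)%N by apply/card_gt0P; exists (cls (w 0)); exact: Pw.
lia.
Qed.

End Residue.

(** * Bimultiplicativity of the Hilbert symbol *)

Section Hilbert.

Variables (F : fieldType) (v : F -> int).
Hypothesis HF : unram2 v.
Notation wge := (wge v).
Notation wex := (wex v).
Let two0 := two_neq0 HF.

(** Norms from F[X]/(X^2 - a). In contrast with solvability of the ternary equation in [hilb], this
    is visibly closed under products. *)
Definition normg (a b : F) : Prop := exists s t, b = s ^+ 2 - a * t ^+ 2.

Lemma normgM a b c : normg a b -> normg a c -> normg a (b * c).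
Proof.
move=> [s [t ->]] [s' [t' ->]]; exists (s * s' + a * t * t'), (s * t' + t * s'); ring.
Qed.

Lemma normg_sq a t : normg a (t ^+ 2).
Proof. exists t, 0; ring. Qed.

Lemma normg_sqK a b t : t != 0 -> normg a (b * t ^+ 2) -> normg a b.
Proof.
move=> t0 h; have := normgM h (normg_sq a t^-1); rewrite -mulrA -exprMn divff //.
by rewrite expr1n mulr1.
Qed.

Lemma normg_div a b c : c != 0 -> normg a (b * c) -> normg a c -> normg a b.
Proof. by move=> c0 h1 h2; apply: (normg_sqK c0); rewrite expr2 mulrA; apply: normgM. Qed.

Lemma normg_scale a b t : t != 0 -> normg a b -> normg (a * t ^+ 2) b.
Proof. by move=> t0 [x [y ->]]; exists x, (y / t); field. Qed.

Lemma normg_base_sq a b : a != 0 -> normg (a ^+ 2) b.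
Proof. by move=> a0; exists ((b + 1) / 2), ((b - 1) / (2 * a)); field; rewrite a0. Qed.

Lemma hilbP a b : a != 0 -> b != 0 -> (hilb a b = 1) <-> normg a b.
Proof.
move=> a0 b0; rewrite /hilb; case: asboolP => [[x [y [z [nz e]]]]|h]; split=> //.
- move=> _; have [y0|y0] := eqVneq y 0; last first.
    exists (z / y), (x / y).
    have -> : b = (z ^+ 2 - a * x ^+ 2) / y ^+ 2.
      by rewrite e [_ + b * _]addrC addrK mulfK ?expf_neq0.
    by field.
  (* A solution with y = 0 makes [a] a square; the norm form is then hyperbolic and represents
     everything. *)
  move: e nz; rewrite y0 expr0n mulr0 addr0 eqxx /= => e nz.
  have x0 : x != 0.
    apply: contraTneq nz => x0; move: e; rewrite x0 expr0n mulr0 => /eqP.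
    by rewrite expf_eq0 /= => /eqP->; rewrite !eqxx.
  have aE : a = (z / x) ^+ 2 by rewrite expr_div_n e mulfK // expf_neq0.
  rewrite aE; apply: normg_base_sq; apply: contraNneq a0 => z0; rewrite aE z0.
  by rewrite expr0n.
- by move=> [s [t e]]; case: h; exists t, 1, s; rewrite oner_eq0 orbT; split=> //; rewrite e; ring.
Qed.

Lemma hilb_pm (a b : F) : hilb a b = 1 \/ hilb a b = -1.
Proof. by rewrite /hilb; case: ifP; [left | right]. Qed.

Lemma hilbC (a b : F) : hilb a b = hilb b a.
Proof.
rewrite /hilb; congr (if _ then _ else _); apply/asboolP/asboolP.
  move=> [x [y [z [nz e]]]]; exists y, x, z; split; last by rewrite e addrC.
  by rewrite orbCA.
move=> [x [y [z [nz e]]]]; exists y, x, z; split; last by rewrite e addrC.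
by rewrite orbCA.
Qed.

Lemma hilb_eqP a b c d : a != 0 -> b != 0 -> c != 0 -> d != 0 ->
  (normg a b <-> normg c d) -> hilb a b = hilb c d.
Proof.
move=> a0 b0 c0 d0 h.
case: (hilb_pm a b) => e; case: (hilb_pm c d) => e'; rewrite e e' //.
  by move/(hilbP a0 b0)/h/(hilbP c0 d0): e; rewrite e'.
by move/(hilbP c0 d0)/h/(hilbP a0 b0): e'; rewrite e.
Qed.

Lemma hilb_sqr (a b t : F) : a != 0 -> b != 0 -> t != 0 -> hilb a (b * t ^+ 2) = hilb a b.
Proof.
move=> a0 b0 t0; apply: hilb_eqP => //; first by rewrite mulf_neq0 ?expf_neq0.
by split=> [|h]; [apply: normg_sqK | apply: normgM h (normg_sq _ _)].
Qed.

Lemma hilb_sql (a b t : F) : a != 0 -> b != 0 -> t != 0 -> hilb (a * t ^+ 2) b = hilb a b.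
Proof. by move=> *; rewrite ![hilb _ b]hilbC hilb_sqr. Qed.

(** The doubled bound 6 is a congruence modulo 8, and 1 + 8o consists of squares. *)
Lemma sqrt_ratio x y : wex y 0 -> wge (x - y) 6 -> exists2 t, t != 0 & x = y * t ^+ 2.
Proof.
move=> hy h; have y0 := wex_neq0 hy.
have [|t e] := @sqrt_near1 _ _ HF (x / y).
  have -> : x / y - 1 = (x - y) / y by rewrite mulrBl divff.
  by apply: (wge_Vexl HF h hy).
exists t; last by rewrite -e mulrC divfK.
apply: contraTneq isT => t0; have : wex x 0.
  by have -> : x = y + (x - y) by [ring]; apply: (wexD HF hy); apply: wge_le h _.
by move/wex_neq0; rewrite -[x](divfK y0) e t0 expr0n mul0r eqxx.
Qed.

(** Since (1 + 2z)^2 = 1 + 4(z^2 + z), the hypothesis makes [1 + 4 * x] congruent to a square modulo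
    8. This is how Artin-Schreier equations of the residue field decide square classes. *)
Lemma sq_1p4 x z : wge z 0 -> wge (z ^+ 2 + z - x) 2 -> exists2 t, t != 0 & 1 + 4 * x = t ^+ 2.
Proof.
move=> hz h; have h1 : wex (1 + 2 * z) 0.
  by apply: (wexD HF (wex1 HF)); apply: (wge_dbl HF hz).
have h2 : wex ((1 + 2 * z) ^+ 2) 0 by apply: (wexE (wexX HF 2 h1)).
have [|t t0 e] := @sqrt_ratio (1 + 4 * x) _ h2.
  have -> : 1 + 4 * x - (1 + 2 * z) ^+ 2 = - (4 * (z ^+ 2 + z - x)) by ring.
  rewrite (wgeN HF); exact: (wgeM HF (wex_wge (wex4 HF) (lexx _)) h).
exists ((1 + 2 * z) * t); first by rewrite mulf_neq0 // (wex_neq0 h1).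
by rewrite e exprMn.
Qed.

Lemma ex_val (m : int) : exists2 t, t != 0 & v t = m.
Proof.
case: m => m; first by exists (2 ^+ m); rewrite ?expf_neq0 // v2X.
by exists (2 ^+ m.+1)^-1; rewrite ?invr_eq0 ?(vV HF) ?expf_neq0 // v2X.
Qed.

Lemma even_val x : x != 0 -> ~~ odd `|v x| -> exists u t, [/\ wex u 0, t != 0 & x = u * t ^+ 2].
Proof.
move=> x0 hv; have [m hm] : exists m : int, v x = 2 * m.
  exists ((v x) %/ 2)%Z; lia.
have [t t0 vt] := ex_val m; have t20 := expf_neq0 2 t0.
exists (x / t ^+ 2), t; split=> //; last by rewrite divfK.
apply/wexP; split; first by rewrite mulf_neq0 ?invr_eq0.
rewrite (vM HF) ?invr_eq0 // (vV HF) // (vX HF) // vt; lia.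
Qed.

Lemma odd_val x : x != 0 -> odd `|v x| -> exists u t, [/\ wex u 0, t != 0 & x = 2 * u * t ^+ 2].
Proof.
move=> x0 hv; have := @even_val (x / 2); rewrite mulf_neq0 ?invr_eq0 // => /(_ isT)[].
  rewrite (vM HF) ?invr_eq0 // (vV HF) // (v_two HF); lia.
by move=> u [t [hu t0 e]]; exists u, t; split=> //; rewrite -mulrA -e mulrC divfK.
Qed.

Lemma unit_form u : wex u 0 -> exists s x, [/\ s != 0, wge x 0 & u = (1 + 2 * x) * s ^+ 2].
Proof.
move=> hu; have [s hs h] := sqrt_mod2 HF (wex_wge hu (lexx 0)).
have hs2 : wex (s ^+ 2) 0.
  by have -> : s ^+ 2 = u + (s ^+ 2 - u) by [ring]; apply: (wexD HF hu); apply: wge_le h _.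
have s20 := wex_neq0 hs2; have s0 : s != 0 by apply: contraNneq s20 => ->; rewrite expr0n.
exists s, (- ((s ^+ 2 - u) / s ^+ 2 / 2)); split=> //; last by field; rewrite s0 two0.
rewrite (wgeN HF); apply: (wge_Vexl HF (k := 2) _ (wex2 HF)) => //.
exact: (wge_Vexl HF h hs2).
Qed.

Lemma normg_near a x y : wex y 0 -> wge (x - y) 6 -> normg a y -> normg a x.
Proof. by move=> hy h n; have [t _ ->] := sqrt_ratio hy h; apply: normgM n (normg_sq _ _). Qed.

(* x^2 + xy + w y^2 is the norm form of the unramified algebra of discriminant 1 - 4w. *)
Lemma normg_unram a w p q : a = 1 - 4 * w -> normg a (p ^+ 2 + p * q + w * q ^+ 2).
Proof. by move=> ->; exists (p + q / 2), (q / 2); field. Qed.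

(** Approximation in two rounds by values of p^2 + pq + wq^2 at p = 1: the choice q = 2x reduces a
    unit 1 + 2x to the form 1 + 4z, and q = 4z then hits 1 + 4z modulo 8, which is enough up to a
    square. *)
Lemma normg_unram_unit a w u : wge w 0 -> a = 1 - 4 * w -> wex u 0 -> normg a u.
Proof.
move=> hw aE hu.
have n4 z : wge z 0 -> normg a (1 + 4 * z).
  move=> hz; have := normg_unram 1 (4 * z) aE; apply: normg_near.
    have -> : 1 ^+ 2 + 1 * (4 * z) + w * (4 * z) ^+ 2 = 1 + 4 * (z + w * (4 * z ^+ 2)) by ring.
    apply: (wexD HF (wex1 HF)); apply: (wgeM_le HF (wex_wge (wex4 HF) (lexx _)) (l := 0)) => //.
    apply: wgeD => //; apply: (wgeM_le HF hw (l := 0)) => //.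
    apply: (wgeM_le HF (k := 4) (l := 0)) => //; first exact: (wex_wge (wex4 HF)).
    by rewrite expr2; apply: (wgeM_le HF hz hz).
  have -> : 1 + 4 * z - (1 ^+ 2 + 1 * (4 * z) + w * (4 * z) ^+ 2) = - (w * z * z * 4 * 4) by ring.
  rewrite (wgeN HF); have h4 := wex_wge (wex4 HF) (lexx _).
  by apply: (wgeM_le HF (wgeM HF (wgeM HF (wgeM HF hw hz) hz) h4) h4).
have [s [x [s0 hx ->]]] := unit_form hu.
apply: normgM (normg_sq _ _).
have n0 := normg_unram 1 (2 * x) aE; set y := (_ + _ + _) in n0.
have hy : wex y 0.
  have -> : y = 1 + 2 * (x + 2 * (w * x ^+ 2)) by rewrite /y; ring.
  apply: (wexD HF (wex1 HF)); apply: (wge_dbl HF (k := 0)) => //; apply: wgeD => //.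
  apply: (wge_dbl HF (k := 0)) => //; apply: (wgeM_le HF hw (l := 0)) => //.
  by rewrite expr2; apply: (wgeM_le HF hx hx).
have y0 := wex_neq0 hy.
apply: (normg_div (c := y) y0) => //.
have [z hz ->] : exists2 z, wge z 0 & (1 + 2 * x) * y = 1 + 4 * z; last exact: n4.
exists (x + x ^+ 2 + w * x ^+ 2 * (1 + 2 * x)); last by rewrite /y; ring.
have hxx : wge (x ^+ 2) 0 by rewrite expr2; apply: (wgeM_le HF hx hx).
apply: wgeD => //; first by apply: wgeD.
apply: (wgeM_le HF (wgeM HF hw hxx) (l := 0)) => //.
by apply: wgeD => //; [apply: wge1 | apply: (wge_dbl HF hx)].
Qed.

Lemma hilb_unram_unit (w t u : F) : wge w 0 -> t != 0 -> wex u 0 -> 1 - 4 * w != 0 ->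
  hilb ((1 - 4 * w) * t ^+ 2) u = 1.
Proof.
move=> hw t0 hu n0; rewrite hilb_sql ?(wex_neq0 hu) //.
by apply/hilbP => //; [apply: wex_neq0 hu | apply: normg_unram_unit hw _ hu].
Qed.

Lemma unit_1p2 x : wge x 0 -> wex (1 + 2 * x) 0.
Proof. by move=> hx; apply: (wexD HF (wex1 HF)); apply: (wge_dbl HF hx). Qed.

Lemma unit_1p4 x : wge x 0 -> wex (1 + 4 * x) 0.
Proof.
move=> hx; have -> : 1 + 4 * x = 1 + 2 * (2 * x) by ring.
by apply: unit_1p2; apply: (wge_dbl HF hx).
Qed.

(** Modulo norms every element can be brought to the form 1 + 4x, and it is a norm at least when x
    is in the image of z^2 + z modulo 2. That image has index at most 2, so one of x1, x2, x1 + x2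
    lies in it. *)
Lemma normg_index_ram2 u b c : wex u 0 -> b != 0 -> c != 0 ->
  [\/ normg (2 * u) b, normg (2 * u) c | normg (2 * u) (b * c)].
Proof.
move=> hu b0 c0; set a := 2 * u; have u0 := wex_neq0 hu.
have red y : y != 0 -> exists2 x, wge x 0 & normg a (y * (1 + 4 * x)).
  have redu y' : wex y' 0 -> exists2 x, wge x 0 & normg a (y' * (1 + 4 * x)).
    move=> hy; have [s [x [s0 hx ->]]] := unit_form hy.
    (* [r] is chosen so that the norm 1 - 2ur^2 cancels the term 2x modulo 4. *)
    have [r hr hrx] := sqrt_mod2 HF (wge_Vexl HF hx hu (lexx _)).
    have hd : wge ((x - u * r ^+ 2) / 2) 0.
      apply: (wge_Vexl HF (k := 2) _ (wex2 HF)) => //.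
      have -> : x - u * r ^+ 2 = - (u * (r ^+ 2 - x / u)) by field.
      by rewrite (wgeN HF); apply: (wgeM_le HF (wex_wge hu (lexx _)) hrx).
    have hr2 : wge (r ^+ 2) 0 by rewrite expr2; apply: (wgeM_le HF hr hr).
    exists ((x - u * r ^+ 2) / 2 - x * (u * r ^+ 2)).
      apply: wgeB => //; apply: (wgeM_le HF hx (l := 0)) => //.
      exact: (wgeM_le HF (wex_wge hu (lexx _)) hr2).
    have n1 : normg a (1 - 2 * (u * r ^+ 2)) by exists 1, r; rewrite /a; ring.
    have -> : 1 + 4 * ((x - u * r ^+ 2) / 2 - x * (u * r ^+ 2)) =
       (1 + 2 * x) * (1 - 2 * (u * r ^+ 2)) by field.
    rewrite [_ * s ^+ 2]mulrC -mulrA; apply: normgM (normg_sq _ _) _.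
    by rewrite mulrA -expr2; apply: normgM n1; apply: normg_sq.
  move=> y0; case: (boolP (odd `|v y|)) => hv.
    have [u' [t [hu' t0 ->]]] := odd_val y0 hv.
    have [|x hx hn] := redu (- (u * u')).
      by rewrite (wexN HF); apply: (wexE (wexM HF hu hu')).
    exists x => //.
    (* Odd valuation is reduced to even valuation by the norm -2u of the element sqrt(2u). *)
    have -> : 2 * u' * t ^+ 2 * (1 + 4 * x) =
      (- (2 * u)) * ((- (u * u')) * (1 + 4 * x)) * (t / u) ^+ 2 by field.
    apply: normgM (normg_sq _ _); apply: normgM hn; exists 0, 1; rewrite /a; ring.
  have [u' [t [hu' t0 ->]]] := even_val y0 hv.
  have [x hx hn] := redu _ hu'; exists x => //.
  by rewrite mulrAC; apply: normgM hn (normg_sq _ _).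
have [x1 hx1 n1] := red _ b0; have [x2 hx2 n2] := red _ c0.
have z1 := wex_neq0 (unit_1p4 hx1); have z2 := wex_neq0 (unit_1p4 hx2).
have sq4 x z : wge z 0 -> wge (z ^+ 2 + z - x) 2 -> normg a (1 + 4 * x).
  by move=> hz h; have [t _ ->] := sq_1p4 hz h; apply: normg_sq.
have [z hz /or3P[] h] := artin_schreier_index HF hx1 hx2.
- by apply: Or31; apply: normg_div z1 n1 (sq4 _ _ hz h).
- by apply: Or32; apply: normg_div z2 n2 (sq4 _ _ hz h).
apply: Or33; apply: (normg_div (c := (1 + 4 * x1) * (1 + 4 * x2))).
- by rewrite mulf_neq0.
- by rewrite mulrACA; apply: normgM.
have hn := sq4 _ _ hz h; apply: (normg_div (c := 1 + 4 * (x1 + x2))) => //.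
  by apply: wex_neq0 (unit_1p4 (wgeD HF hx1 hx2)).
have h12 : wge (x1 * x2) 0 by apply: (wgeM_le HF hx1 hx2).
have hs := unit_1p4 (wgeD HF hx1 hx2).
have : normg a ((1 + 4 * (x1 + x2)) * (1 + 4 * (x1 + x2))) by apply: normgM.
apply: normg_near; first by apply: (wexE (wexM HF hs hs)).
have -> : (1 + 4 * x1) * (1 + 4 * x2) * (1 + 4 * (x1 + x2)) -
   (1 + 4 * (x1 + x2)) * (1 + 4 * (x1 + x2)) = 4 * (4 * ((x1 * x2) * (1 + 4 * (x1 + x2)))) by ring.
have h4 := wex_wge (wex4 HF) (lexx _).
by apply: (wgeM_le HF h4 (wgeM HF h4 (wgeM HF h12 (wex_wge hs (lexx _))))).
Qed.

(** Here all of 1 + 4o consists of norms, so the index is decided one step earlier, on elements 1 +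
    2x. The norms met there satisfy the Artin-Schreier condition on -x0 x instead of x. *)
Lemma normg_index_ramu x0 b c : wex x0 0 -> b != 0 -> c != 0 ->
  [\/ normg (1 + 2 * x0) b, normg (1 + 2 * x0) c | normg (1 + 2 * x0) (b * c)].
Proof.
move=> hx0 b0 c0; set a := 1 + 2 * x0; have x00 := wex_neq0 hx0.
have ix0 := wex_wge hx0 (lexx _); have vx0 : wge x0^-1 0.
  by have := wexV HF hx0; rewrite oppr0 => h; apply: wex_wge h _.
have n2 y : normg a (1 + 2 * (y - x0 * y ^+ 2)) by exists (1 + y), y; rewrite /a; ring.
have n4 z : wge z 0 -> normg a (1 + 4 * z).
  (* The polynomial y - x0 y^2 vanishes at [x0^-1]; moving from this root by -2z gives a norm
     congruent to 1 + 4z modulo 8. *)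
  move=> hz; have := n2 (x0^-1 - 2 * z); set y := 1 + _ => ny.
  have yE : y = 1 + 4 * (z * (1 - 2 * (x0 * z))) by rewrite /y; field.
  have hxz : wge (x0 * z) 0 by apply: (wgeM_le HF ix0 hz).
  apply: normg_near ny.
    rewrite yE; apply: unit_1p4; apply: (wgeM_le HF hz (l := 0)) => //.
    by apply: wgeB => //; [apply: wge1 | apply: (wge_dbl HF hxz)].
  rewrite yE; have -> : 1 + 4 * z - (1 + 4 * (z * (1 - 2 * (x0 * z)))) =
     4 * (2 * (z * (x0 * z))) by ring.
  by apply: (wgeM_le HF (wex_wge (wex4 HF) (lexx _)) (wgeM HF (wex_wge (wex2 HF) (lexx _)) (wgeM HF hz hxz))).
have red y : y != 0 -> exists2 x, wge x 0 & normg a (y * (1 + 2 * x)).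
  have redu y' : wex y' 0 -> exists2 x, wge x 0 & normg a (y' * (1 + 2 * x)).
    move=> hy; have [s [x [s0 hx ->]]] := unit_form hy; exists x => //.
    by rewrite mulrAC -expr2; apply: normgM; apply: normg_sq.
  move=> y0; case: (boolP (odd `|v y|)) => hv.
    have [u' [t [hu' t0 ->]]] := odd_val y0 hv.
    have [|x hx hn] := redu (- (x0 * u')).
      by rewrite (wexN HF); apply: (wexE (wexM HF hx0 hu')).
    exists x => //.
    have -> : 2 * u' * t ^+ 2 * (1 + 2 * x) =
      (- (2 * x0)) * ((- (x0 * u')) * (1 + 2 * x)) * (t / x0) ^+ 2 by field.
    apply: normgM (normg_sq _ _); apply: normgM hn; exists 1, 1; rewrite /a; ring.
  have [u' [t [hu' t0 ->]]] := even_val y0 hv.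
  have [x hx hn] := redu _ hu'; exists x => //.
  by rewrite mulrAC; apply: normgM hn (normg_sq _ _).
have [x1 hx1 n1] := red _ b0; have [x2 hx2 n3] := red _ c0.
have hm x : wge x 0 -> wge (- (x0 * x)) 0.
  by move=> hx; rewrite (wgeN HF); apply: (wgeM_le HF ix0 hx).
have AS x z : wge x 0 -> wge z 0 -> wge (z ^+ 2 + z - (- (x0 * x))) 2 -> normg a (1 + 2 * x).
  (* At y = -z / x0 one has y - x0 y^2 = -(z^2 + z) / x0, which is x modulo 2 by the choice of z. *)
  move=> hx hz h; have hy := n2 (- z / x0).
  have hzx : wge (- z / x0) 0 by apply: (wgeM_le HF (k := 0) (l := 0)) => //; rewrite (wgeN HF).
  set w := - z / x0 - _ in hy.
  have hw : wge w 0.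
    apply: wgeB => //; apply: (wgeM_le HF ix0 (l := 0)) => //.
    by rewrite expr2; apply: (wgeM_le HF hzx hzx).
  have h1w := unit_1p2 hw.
  apply: (normg_div (c := 1 + 2 * w)) => //; first exact: wex_neq0 h1w.
  have hxw : wge ((x - w) / 2) 0.
    apply: (wge_Vexl HF (k := 2) _ (wex2 HF)) => //.
    have -> : x - w = x0^-1 * (z ^+ 2 + z - (- (x0 * x))) by rewrite /w; field.
    exact: (wgeM_le HF vx0 h).
  have -> : (1 + 2 * x) * (1 + 2 * w) = 1 + 4 * (w + (x - w) / 2 + x * w) by field.
  apply: n4; apply: wgeD => //; first exact: wgeD.
  exact: (wgeM_le HF hx hw).
have [z hz /or3P[] h] := artin_schreier_index HF (hm _ hx1) (hm _ hx2).
- apply: Or31; apply: normg_div (wex_neq0 (unit_1p2 hx1)) n1 _; exact: AS hx1 hz h.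
- apply: Or32; apply: normg_div (wex_neq0 (unit_1p2 hx2)) n3 _; exact: AS hx2 hz h.
have h12 : wge (x1 + x2 + 2 * (x1 * x2)) 0.
  apply: wgeD => //; first exact: wgeD.
  by apply: (wge_dbl HF (k := 0)) => //; apply: (wgeM_le HF hx1 hx2).
apply: Or33; apply: (normg_div (c := (1 + 2 * x1) * (1 + 2 * x2))).
- by rewrite mulf_neq0 // (wex_neq0 (unit_1p2 _)).
- by rewrite mulrACA; apply: normgM.
have -> : (1 + 2 * x1) * (1 + 2 * x2) = 1 + 2 * (x1 + x2 + 2 * (x1 * x2)) by ring.
apply: AS hz _ => //.
have -> : z ^+ 2 + z - (- (x0 * (x1 + x2 + 2 * (x1 * x2)))) =
   z ^+ 2 + z - (- (x0 * x1) + - (x0 * x2)) + 2 * (x0 * (x1 * x2)) by ring.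
apply: wgeD => //; apply: (wge_dbl HF (k := 0)) => //.
by apply: (wgeM_le HF ix0 (wgeM HF hx1 hx2)).
Qed.

(** The norm group has index at most 2. Up to squares [a] is 2u, or 1 + 2x with x a unit, or 1 + 2x
    with x in 2o; in the last, unramified case every element of even valuation is a norm, and b, c
    or bc has even valuation. *)
Lemma normg_index a b c : a != 0 -> b != 0 -> c != 0 ->
  [\/ normg a b, normg a c | normg a (b * c)].
Proof.
move=> a0 b0 c0; case: (boolP (odd `|v a|)) => hv.
  have [u [t [hu t0 ->]]] := odd_val a0 hv.
  by case: (normg_index_ram2 hu b0 c0) => h; [apply: Or31|apply: Or32|apply: Or33]; apply: normg_scale.
have [u [t [hu t0 ->]]] := even_val a0 hv.
suff : [\/ normg u b, normg u c | normg u (b * c)].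
  by case=> h; [apply: Or31|apply: Or32|apply: Or33]; apply: normg_scale.
have [s [x [s0 hx ->]]] := unit_form hu.
suff : [\/ normg (1 + 2 * x) b, normg (1 + 2 * x) c | normg (1 + 2 * x) (b * c)].
  by case=> h; [apply: Or31|apply: Or32|apply: Or33]; apply: normg_scale.
have [hx2|/(wge_wex (k := 0) hx) hx0] := boolP (wge x 2); last exact: normg_index_ramu.
have hw : wge (- (x / 2)) 0 by rewrite (wgeN HF); apply: (wge_Vexl HF hx2 (wex2 HF)).
have aE : 1 + 2 * x = 1 - 4 * - (x / 2) by field.
have ev y : y != 0 -> ~~ odd `|v y| -> normg (1 + 2 * x) y.
  move=> y0 /(even_val y0)[u' [t' [hu' _ ->]]]; apply: normgM (normg_sq _ _).
  exact: normg_unram_unit hw aE hu'.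
have [hb|hb] := boolP (odd `|v b|); last by apply: Or31; apply: ev.
have [hc|hc] := boolP (odd `|v c|); last by apply: Or32; apply: ev.
by apply: Or33; apply: ev; rewrite ?mulf_neq0 ?(vM HF) //; lia.
Qed.

Lemma hilbMr (a b c : F) : a != 0 -> b != 0 -> c != 0 -> hilb a (b * c) = hilb a b * hilb a c.
Proof.
move=> a0 b0 c0; have bc0 : b * c != 0 by rewrite mulf_neq0.
case: (hilb_pm a b) => eb; case: (hilb_pm a c) => ec; rewrite eb ec.
- by apply/hilbP => //; apply: normgM; apply/hilbP.
- case: (hilb_pm a (b * c)) => // /(hilbP a0 bc0) h.
  have /(hilbP a0 c0) : normg a c; last by rewrite ec.
  by apply: (normg_div b0); [rewrite mulrC | apply/hilbP].
- case: (hilb_pm a (b * c)) => // /(hilbP a0 bc0) h.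
  have /(hilbP a0 b0) : normg a b; last by rewrite eb.
  by apply: (normg_div c0 h); apply/hilbP.
case: (normg_index a0 b0 c0) => /(hilbP _ _) h; first by rewrite h in eb.
  by rewrite h in ec.
by rewrite h.
Qed.

Lemma hilbMl (a b c : F) : a != 0 -> b != 0 -> c != 0 -> hilb (a * b) c = hilb a c * hilb b c.
Proof. by move=> *; rewrite ![hilb _ c]hilbC hilbMr. Qed.

End Hilbert.

(** * The Hasse invariant *)

Definition symbil (F : fieldType) (V : lmodType F) (bt : V -> V -> F) : Prop :=
  [/\ forall x y z, bt (x + y) z = bt x z + bt y z,
      forall c x y, bt (c *: x) y = c * bt x y & forall x y, bt x y = bt y x].

Section Bilinear.

Variables (F : fieldType) (V : lmodType F) (bt : V -> V -> F).
Hypothesis HB : symbil bt.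

Lemma btDl x y z : bt (x + y) z = bt x z + bt y z. Proof. by case: HB. Qed.
Lemma btZl c x y : bt (c *: x) y = c * bt x y. Proof. by case: HB. Qed.
Lemma btC x y : bt x y = bt y x. Proof. by case: HB. Qed.
Lemma btDr x y z : bt x (y + z) = bt x y + bt x z.
Proof. by rewrite !(btC x) btDl. Qed.
Lemma btZr c x y : bt x (c *: y) = c * bt x y.
Proof. by rewrite !(btC x) btZl. Qed.
Lemma bt0l x : bt 0 x = 0. Proof. by rewrite -(scale0r 0) btZl mul0r. Qed.
Lemma bt0r x : bt x 0 = 0. Proof. by rewrite btC bt0l. Qed.
Lemma btNl x y : bt (- x) y = - bt x y. Proof. by rewrite -scaleN1r btZl mulN1r. Qed.
Lemma btNr x y : bt x (- y) = - bt x y. Proof. by rewrite btC btNl btC. Qed.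
Lemma btBl x y z : bt (x - y) z = bt x z - bt y z. Proof. by rewrite btDl btNl. Qed.
Lemma btBr x y z : bt x (y - z) = bt x y - bt x z. Proof. by rewrite btDr btNr. Qed.
Lemma bt_suml (I : Type) (r : seq I) (P : pred I) (f : I -> V) y :
  bt (\sum_(i <- r | P i) f i) y = \sum_(i <- r | P i) bt (f i) y.
Proof.
by apply: (big_morph (fun x => bt x y)) => [x z|]; rewrite ?btDl ?bt0l.
Qed.
Lemma bt_sumr (I : Type) (r : seq I) (P : pred I) (f : I -> V) y :
  bt y (\sum_(i <- r | P i) f i) = \sum_(i <- r | P i) bt y (f i).
Proof. by rewrite btC bt_suml; apply: eq_bigr => i _; rewrite btC. Qed.

End Bilinear.

Section Hasse.

Variables (F : fieldType) (v : F -> int).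
Hypothesis HF : unram2 v.
Variables (V : lmodType F) (bt : V -> V -> F).
Hypothesis HB : symbil bt.
Let two0 := two_neq0 HF.

Fixpoint hasse (s : seq F) : int :=
  if s is x :: r then (\prod_(y <- r) hilb x y) * hasse r else 1.

Lemma hasse_mid x s t : hasse (s ++ x :: t) = hasse (x :: s ++ t).
Proof.
elim: s => //= y s; rewrite /= => ->; rewrite !big_cat /= !big_cons (hilbC y x) !big_cat /=; ring.
Qed.

Lemma hasse_perm s t : perm_eq s t -> hasse s = hasse t.
Proof.
elim: s t => [|x s IH] t; first by rewrite perm_sym => /perm_nilP->.
move=> st; have xt : x \in t by rewrite -(perm_mem st) mem_head.
case/splitPr: xt st => t1 t2; rewrite perm_sym perm_catC cat_cons perm_cons perm_catC perm_sym => st.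
by rewrite hasse_mid /= (IH _ st) (perm_big _ st).
Qed.

Definition orthF (s : seq V) : Prop :=
  [/\ uniq s, {in s &, forall x y, x != y -> bt x y = 0} & {in s, forall x, bt x x != 0}].

(* For orthogonal anisotropic [s] this is membership in the linear span of [s]. *)
Definition Span (s : seq V) (x : V) : Prop := x = \sum_(y <- s) (bt x y / bt y y) *: y.

Definition eqsq (x y : F) : Prop := exists2 c, c != 0 & x = y * c ^+ 2.

Lemma eqsq_trans y x z : eqsq x y -> eqsq y z -> eqsq x z.
Proof.
move=> [c c0 ->] [d d0 ->]; exists (d * c); rewrite ?mulf_neq0 // exprMn; ring.
Qed.

Lemma eqsq_refl x : eqsq x x.
Proof. by exists 1; rewrite ?oner_eq0 // expr1n mulr1. Qed.

Lemma eqsq_mul x y z t : eqsq x y -> eqsq z t -> eqsq (x * z) (y * t).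
Proof.
move=> [c c0 ->] [d d0 ->]; exists (c * d); rewrite ?mulf_neq0 // exprMn; ring.
Qed.

Lemma eqsq_sym x y : eqsq x y -> eqsq y x.
Proof.
move=> [c c0 ->]; exists c^-1; rewrite ?invr_eq0 //.
by rewrite exprVn mulfK // expf_neq0.
Qed.

Definition norms (s : seq V) := [seq bt x x | x <- s].

Lemma orthF_perm s t : perm_eq s t -> orthF s -> orthF t.
Proof.
move=> st [h1 h2 h3]; have m := perm_mem st; split.
- by rewrite -(perm_uniq st).
- by move=> x y; rewrite -!m; apply: h2.
- by move=> x; rewrite -m; apply: h3.
Qed.

Lemma Span_perm s t x : perm_eq s t -> Span s x -> Span t x.
Proof. by move=> st; rewrite /Span => {1}->; apply: perm_big. Qed.

Lemma Span_norm s x : Span s x -> bt x x = \sum_(y <- s) bt x y ^+ 2 / bt y y.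
Proof.
move=> h; rewrite {1}h (bt_suml HB); apply: eq_bigr => y _; rewrite (btZl HB) [bt y x](btC HB).
by rewrite expr2 mulrAC.
Qed.

(** The forms <A, B> and <A + B, AB(A + B)> are equivalent. The symbol of A(A + B) and B(A + B) is
    1, because their sum is a square; expanding it bilinearly leaves a check of signs. *)
Lemma hilb_diag2 (A B : F) : A != 0 -> B != 0 -> A + B != 0 ->
  hilb (A + B) (A * B * (A + B)) = hilb A B.
Proof.
move=> A0 B0 N0; have nAN : A * (A + B) != 0 by rewrite mulf_neq0.
have nBN : B * (A + B) != 0 by rewrite mulf_neq0.
have : hilb (A * (A + B)) (B * (A + B)) = 1.
  by apply/(hilbP HF nAN nBN); exists (A + B), 1; ring.
rewrite (hilbMl HF) // !(hilbMr HF) ?mulf_neq0 // [hilb A (A + B)]hilbC.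
move: (hilb_pm A B) (hilb_pm (A + B) A) (hilb_pm (A + B) B) (hilb_pm (A + B) (A + B)).
by do 4![case=> ->].
Qed.

Lemma hilb_pairE (q1 q2 c1 c2 q : F) : q1 != 0 -> q2 != 0 -> c1 != 0 -> c2 != 0 -> q != 0 ->
  c1 ^+ 2 * q1 + c2 ^+ 2 * q2 != 0 ->
  hilb (c1 ^+ 2 * q1 + c2 ^+ 2 * q2) q * hilb (q1 * q2 * (c1 ^+ 2 * q1 + c2 ^+ 2 * q2)) q =
  hilb q1 q * hilb q2 q.
Proof.
move=> q10 q20 c10 c20 q0; set N := _ + _ => N0.
by rewrite -(hilbMl HF) ?mulf_neq0 // mulrCA -expr2 (hilb_sql HF) ?mulf_neq0 // (hilbMl HF).
Qed.

(** One link of Witt's chain: [z1] is the projection of [t0] to the plane of [y1] and [y2], [z2]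
    spans the orthogonal complement of [z1] there. The last hypothesis says that this projection is
    anisotropic. *)
Lemma chain_pair y1 y2 r t0 : orthF (y1 :: y2 :: r) -> bt t0 y1 != 0 -> bt t0 y2 != 0 ->
  bt t0 y1 ^+ 2 / bt y1 y1 + bt t0 y2 ^+ 2 / bt y2 y2 != 0 ->
  exists z1 z2, [/\ orthF (z1 :: z2 :: r), bt t0 z2 = 0,
    hasse (norms (z1 :: z2 :: r)) = hasse (norms (y1 :: y2 :: r)) /\
    eqsq (\prod_(y <- norms (z1 :: z2 :: r)) y) (\prod_(y <- norms (y1 :: y2 :: r)) y) &
    forall x, Span (y1 :: y2 :: r) x -> Span (z1 :: z2 :: r) x].
Proof.
move=> [un ort nz] b1 b2 N0.
have m1 : y1 \in y1 :: y2 :: r by rewrite !inE eqxx.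
have m2 : y2 \in y1 :: y2 :: r by rewrite !inE eqxx orbT.
have mr z : z \in r -> z \in y1 :: y2 :: r by rewrite !inE => ->; rewrite !orbT.
move: (un); rewrite /= inE negb_or -andbA => /and4P[y12 y1r y2r ur].
have o12 : bt y1 y2 = 0 by apply: ort.
have o1r z : z \in r -> bt y1 z = 0.
  by move=> zr; apply: (ort _ _ m1 (mr _ zr)); apply: contraNneq y1r => ->.
have o2r z : z \in r -> bt y2 z = 0.
  by move=> zr; apply: (ort _ _ m2 (mr _ zr)); apply: contraNneq y2r => ->.
set q1 := bt y1 y1 in N0 *; set q2 := bt y2 y2 in N0 *.
have q10 : q1 != 0 by apply: nz. have q20 : q2 != 0 by apply: nz.
pose c1 := bt t0 y1 / q1; pose c2 := bt t0 y2 / q2.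
have c10 : c1 != 0 by rewrite mulf_neq0 ?invr_eq0.
have c20 : c2 != 0 by rewrite mulf_neq0 ?invr_eq0.
pose N := c1 ^+ 2 * q1 + c2 ^+ 2 * q2.
have NE : N = bt t0 y1 ^+ 2 / q1 + bt t0 y2 ^+ 2 / q2.
  by rewrite /N /c1 /c2; field; repeat (apply/andP; split).
rewrite -NE in N0.
pose z1 := c1 *: y1 + c2 *: y2; pose z2 := (c2 * q2) *: y1 - (c1 * q1) *: y2.
have n1 : bt z1 z1 = N.
  by rewrite /z1 !(btDl HB, btDr HB, btZl HB, btZr HB) [bt y2 y1](btC HB) o12 /N /q1 /q2; ring.
have n2 : bt z2 z2 = q1 * q2 * N.
  rewrite /z2 !(btBl HB, btBr HB, btZl HB, btZr HB) [bt y2 y1](btC HB) o12 /N -/q1 -/q2; ring.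
have n12 : bt z1 z2 = 0.
  rewrite /z1 /z2 !(btDl HB, btBr HB, btZl HB, btZr HB) [bt y2 y1](btC HB) o12 -/q1 -/q2; ring.
have n20 : bt z2 z2 != 0 by rewrite n2 !mulf_neq0.
have z1r z : z \in r -> bt z1 z = 0.
  by move=> zr; rewrite /z1 (btDl HB) !(btZl HB) o1r // o2r // !mulr0 addr0.
have z2r z : z \in r -> bt z2 z = 0.
  by move=> zr; rewrite /z2 (btBl HB) !(btZl HB) o1r // o2r // !mulr0 subrr.
exists z1, z2; split.
- split=> /=.
  + rewrite inE negb_or ur andbT -andbA; apply/and3P; split.
    * by apply/eqP => e; move: n12; rewrite e => /eqP; rewrite (negPf n20).
    * by apply/negP => /z1r /eqP; rewrite n1 (negPf N0).
    * by apply/negP => /z2r /eqP; rewrite (negPf n20).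
  + move=> x y; rewrite !inE => /or3P[/eqP->|/eqP->|xr] /or3P[/eqP->|/eqP->|yr];
      rewrite ?eqxx // => ne; first [exact: z1r | exact: z2r | by rewrite (btC HB) n12 |
        by rewrite (btC HB) z1r | by rewrite (btC HB) z2r | by apply: ort ne; apply: mr].
  + move=> x; rewrite !inE => /or3P[/eqP->|/eqP->|xr]; rewrite ?n1 //.
    by apply: nz; apply: mr.
- by rewrite /z2 (btBr HB) !(btZr HB) /c1 /c2; field; repeat (apply/andP; split).
- split; last first.
    rewrite /= n1 n2 !big_cons -/q1 -/q2; exists N => //; ring.
  rewrite /= n1 n2 !big_cons -/q1 -/q2.
  have -> : hilb N (q1 * q2 * N) = hilb q1 q2.
    have e : q1 * q2 * N = (c1 ^+ 2 * q1) * (c2 ^+ 2 * q2) * N * (c1 * c2)^-1 ^+ 2.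
      by field; repeat (apply/andP; split).
    have A0 : c1 ^+ 2 * q1 != 0 by rewrite mulf_neq0 ?expf_neq0.
    have B0 : c2 ^+ 2 * q2 != 0 by rewrite mulf_neq0 ?expf_neq0.
    have cc0 : (c1 * c2)^-1 != 0 by rewrite invr_eq0; apply: mulf_neq0.
    have h0 : (c1 ^+ 2 * q1) * (c2 ^+ 2 * q2) * N != 0 by apply: mulf_neq0 => //; apply: mulf_neq0.
    rewrite e (hilb_sqr HF N0 h0 cc0) hilb_diag2 //.
    rewrite [c1 ^+ 2 * _]mulrC [c2 ^+ 2 * _]mulrC in A0 B0 *.
    by rewrite (hilb_sql HF q10 B0 c10) (hilb_sqr HF q10 q20 c20).
  rewrite -!mulrA; congr (_ * _); rewrite !mulrA; congr (_ * _).
  rewrite -!big_split /= !big_map big_seq [RHS]big_seq; apply: eq_bigr => z zr.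
  by apply: hilb_pairE => //; apply: nz; apply: mr.
- move=> x hx; rewrite /Span {1}hx !big_cons !addrA; congr (_ + _).
  rewrite n1 n2 -/q1 -/q2 {2}/z1 {2}/z2 scalerDr scalerBr !scalerA.
  rewrite addrACA -scalerDl -scalerBl; congr (_ *: _ + _ *: _).
    rewrite /z1 /z2 (btDr HB) (btBr HB) !(btZr HB); move: (bt x y1) (bt x y2) => X1 X2.
    by rewrite /N in N0 *; field; repeat (apply/andP; split).
  rewrite /z1 /z2 (btDr HB) (btBr HB) !(btZr HB); move: (bt x y1) (bt x y2) => X1 X2.
  by rewrite /N in N0 *; field; repeat (apply/andP; split).
Qed.

(** Each link makes one more basis vector orthogonal to [t0]. When a single one is left that is not,
    it is a multiple of [t0] and can be replaced by it. *)
Lemma chain_reach n s t0 : (count (fun y => bt t0 y != 0%R) s <= n)%N ->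
  orthF s -> Span s t0 -> bt t0 t0 != 0 ->
  exists s', [/\ orthF (t0 :: s'), (size s').+1 = size s,
    hasse (norms (t0 :: s')) = hasse (norms s) /\
    eqsq (\prod_(y <- norms (t0 :: s')) y) (\prod_(y <- norms s) y) & forall x, Span s x -> Span (t0 :: s') x].
Proof.
elim: n s => [|n IH] s.
  rewrite leqn0 => /eqP/eqP; rewrite -leqn0 leqNgt -has_count => /hasPn hz _ sp.
  rewrite (Span_norm sp) big_seq big1 ?eqxx // => y ys.
  by have /negPn/eqP-> := hz y ys; rewrite expr0n mul0r.
move=> hc os sp nt.
have /hasP[y1 y1s b1] : has (fun y => bt t0 y != 0) s.
  apply: contraT => /hasPn hz; move: nt; rewrite (Span_norm sp) big_seq big1 ?eqxx // => y ys.
  by have /negPn/eqP-> := hz y ys; rewrite expr0n mul0r.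
have p1 := perm_to_rem y1s; set r := rem y1 s in p1.
have os1 := orthF_perm p1 os; have sp1 := Span_perm p1 sp.
case: (boolP (has (fun y => bt t0 y != 0) r)) => [hr|/hasPn hz]; last first.
  have t0E : t0 = (bt t0 y1 / bt y1 y1) *: y1.
    rewrite {1}sp1 big_cons big_seq big1 ?addr0 // => y yr.
    by have /negPn/eqP-> := hz y yr; rewrite mul0r scale0r.
  have [un1 ort1 nz1] := os1.
  have q0 : bt y1 y1 != 0 by apply: nz1; rewrite mem_head.
  set c := bt t0 y1 / bt y1 y1 in t0E; have c0 : c != 0 by rewrite mulf_neq0 ?invr_eq0.
  have t0r z : z \in r -> bt t0 z = 0.
    by move=> zr; have /negPn/eqP-> := hz z zr.
  exists r; split.
  - split.
    + move: un1; rewrite !cons_uniq => /andP[_ ->]; rewrite andbT.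
      by apply/negP => /t0r /eqP; rewrite (negPf nt).
    + move=> x y; rewrite !inE => /orP[/eqP->|xr] /orP[/eqP->|yr]; rewrite ?eqxx // => ne.
      * exact: t0r.
      * by rewrite (btC HB) t0r.
      * by apply: ort1 ne; rewrite inE ?xr ?yr orbT.
    + by move=> x; rewrite inE => /orP[/eqP->//|xr]; apply: nz1; rewrite inE xr orbT.
  - by rewrite (perm_size p1).
  - rewrite (perm_big _ (perm_map (fun x => bt x x) p1)) /=.
    rewrite (hasse_perm (perm_map (fun x => bt x x) p1)) /=; split; last first.
      rewrite !big_cons; apply: eqsq_mul (eqsq_refl _); exists c => //.
      by rewrite t0E (btZl HB) (btZr HB) mulrA -expr2 mulrC.
    congr (_ * _).
    rewrite !big_map big_seq [RHS]big_seq; apply: eq_bigr => z zr.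
    rewrite t0E (btZl HB) (btZr HB) mulrA -expr2 mulrC (hilb_sql HF) //.
    by apply: nz1; rewrite inE zr orbT.
  - move=> x /(Span_perm p1) hx; rewrite /Span {1}hx !big_cons; congr (_ + _).
    rewrite t0E !(btZl HB, btZr HB) scalerA; congr (_ *: _).
    by move: q0; move: (bt x y1) (bt y1 y1) => X q q0; field; repeat (apply/andP; split).
(* A link needs two vectors whose contributions to the norm of [t0] do not cancel. If there are only
   two, their sum is the nonzero norm of [t0]; among three, all pairwise sums cannot vanish, since
   twice the first contribution would. *)
have {b1}[z1 [z2 [r2 [p2 b1 b2 N0]]]] : exists z1 z2 r2, [/\ perm_eq s (z1 :: z2 :: r2),
    bt t0 z1 != 0, bt t0 z2 != 0 & bt t0 z1 ^+ 2 / bt z1 z1 + bt t0 z2 ^+ 2 / bt z2 z2 != 0].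
  case/hasP: hr => y2 y2r b2; have p2 := perm_to_rem y2r; set r2 := rem y2 r in p2.
  have ps : perm_eq s (y1 :: y2 :: r2) by apply: (perm_trans p1); rewrite perm_cons.
  have [N12|N12] := eqVneq (bt t0 y1 ^+ 2 / bt y1 y1 + bt t0 y2 ^+ 2 / bt y2 y2) 0; last first.
    by exists y1, y2, r2.
  case: (boolP (has (fun y => bt t0 y != 0) r2)) => [/hasP[y3 y3r b3]|/hasPn hz]; last first.
    move: nt; rewrite (Span_norm (Span_perm ps sp)) !big_cons addrA N12 add0r big_seq big1 ?eqxx //.
    by move=> y yr; have /negPn/eqP-> := hz y yr; rewrite expr0n mul0r.
  have p3 := perm_to_rem y3r; set r3 := rem y3 r2 in p3.
  have ps3 : perm_eq s (y1 :: y2 :: y3 :: r3) by apply: (perm_trans ps); rewrite !perm_cons.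
  have [N13|N13] := eqVneq (bt t0 y1 ^+ 2 / bt y1 y1 + bt t0 y3 ^+ 2 / bt y3 y3) 0; last first.
    exists y1, y3, (y2 :: r3); split=> //; apply: (perm_trans ps3); rewrite perm_cons.
    by apply/permPl; apply: (perm_catCA [:: y2] [:: y3]).
  exists y2, y3, (y1 :: r3); split=> //.
    apply: (perm_trans ps3); apply/permPl.
    exact: (perm_catCA [:: y1] [:: y2; y3]).
  apply: contraTneq isT => N23; have [_ _ nz] := os.
  have q1 : bt y1 y1 != 0 by apply: nz.
  have : 2 * (bt t0 y1 ^+ 2 / bt y1 y1) = 0.
    have -> : 2 * (bt t0 y1 ^+ 2 / bt y1 y1) =
      (bt t0 y1 ^+ 2 / bt y1 y1 + bt t0 y2 ^+ 2 / bt y2 y2) +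
      (bt t0 y1 ^+ 2 / bt y1 y1 + bt t0 y3 ^+ 2 / bt y3 y3) -
      (bt t0 y2 ^+ 2 / bt y2 y2 + bt t0 y3 ^+ 2 / bt y3 y3) by ring.
    by rewrite N12 N13 N23 subr0 addr0.
  by move/eqP; rewrite !mulf_eq0 invr_eq0 (negPf two0) (negPf q1) (negPf b1).
have [x1 [x2 [ox b0 [hE hD] hS]]] := chain_pair (orthF_perm p2 os) b1 b2 N0.
have [|s' [o' sz' [hE' hD'] hS']] := IH (x1 :: x2 :: r2) _ ox (hS _ (Span_perm p2 sp)) nt.
  move: hc; rewrite (permP p2) /= b1 b2 b0 eqxx /=.
  by case: (bt t0 x1 != 0) => /=; lia.
exists s'; split=> //; first by rewrite sz' (perm_size p2).
  rewrite hE' hE (hasse_perm (perm_map (fun x => bt x x) p2)); split=> //.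
  by rewrite (perm_big _ (perm_map (fun x => bt x x) p2)); apply: eqsq_trans hD' hD.
by move=> x /(Span_perm p2)/hS/hS'.
Qed.

(** After a chain that puts [t0] first, the remaining vectors of both bases span the same
    complement, and induction applies there. The discriminant is carried along for the factor that
    involves [t0]. *)
Lemma hasse_basis n s t : size s = n -> size t = n -> orthF s -> orthF t ->
  {in t, forall x, Span s x} ->
  hasse (norms s) = hasse (norms t) /\ eqsq (\prod_(y <- norms s) y) (\prod_(y <- norms t) y).
Proof.
elim: n s t => [|n IH] s [|t0 t] //; first by move=> /size0nil-> *; split=> //; apply: eqsq_refl.
move=> sz /= [szt] os [ut ot nt] sp.
have [s' [[us os' ns'] sz' [hE hD] hS]] :=
  chain_reach (leqnn _) os (sp t0 (mem_head _ _)) (nt t0 (mem_head _ _)).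
have t0t x : x \in t -> bt x t0 = 0.
  move=> xt; apply: ot; rewrite ?mem_head ?inE ?xt ?orbT //.
  by apply: contraTneq (andP ut).1 => <-; rewrite xt.
have [eqH eqD] : hasse (norms s') = hasse (norms t) /\
    eqsq (\prod_(y <- norms s') y) (\prod_(y <- norms t) y).
  apply: IH => //; first by move: sz; rewrite -sz' => -[].
  - split; [by case/andP: us| |].
      by move=> x y xs ys; apply: os'; rewrite inE ?xs ?ys orbT.
    by move=> x xs; apply: ns'; rewrite inE xs orbT.
  - split; [by case/andP: ut| |].
      by move=> x y xs ys; apply: ot; rewrite inE ?xs ?ys orbT.
    by move=> x xs; apply: nt; rewrite inE xs orbT.
  move=> x xt; have := hS x (sp x _); rewrite inE xt orbT => /(_ isT).
  by rewrite /Span big_cons t0t // mul0r scale0r add0r.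
split; last first.
  apply: eqsq_trans (eqsq_sym hD) _.
  by rewrite /= !big_cons; apply: eqsq_mul eqD; apply: eqsq_refl.
(* By bimultiplicativity the symbols of [t0] with the others depend only on the product of the other
   values modulo squares. *)
rewrite -hE /= eqH; congr (_ * _).
have q0 : bt t0 t0 != 0 by rewrite nt ?mem_head.
have pn (l : seq V) : {in l, forall y, bt y y != 0} -> \prod_(y <- norms l) y != 0.
  by move=> nl; rewrite prodf_seq_neq0 /= all_map; apply/allP => z zl; apply: nl.
have prodE (l : seq V) : {in l, forall y, bt y y != 0} ->
   \prod_(y <- norms l) hilb (bt t0 t0) y = hilb (bt t0 t0) (\prod_(y <- norms l) y).
  elim: l => [|y l IHl] nl.
    rewrite !big_nil; apply/esym/(hilbP HF); rewrite ?oner_eq0 //.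
    by have := normg_sq (bt t0 t0) 1; rewrite expr1n.
  have nl' : {in l, forall y, bt y y != 0} by move=> z zl; apply: nl; rewrite inE zl orbT.
  have yn : bt y y != 0 by apply: nl; rewrite mem_head.
  by rewrite [norms _]/= !big_cons IHl // (hilbMr HF q0 yn (pn _ nl')).
have nt' : {in t, forall y, bt y y != 0} by move=> z zl; apply: nt; rewrite inE zl orbT.
rewrite !prodE //; last by move=> z zl; apply: ns'; rewrite inE zl orbT.
by case: eqD => c c0 ->; rewrite (hilb_sqr HF) ?pn.
Qed.

End Hasse.

Section MatrixForm.

Variables (F : fieldType) (m : nat).
Implicit Types (M X : 'M[F]_m).

Definition mbt M (x y : 'cV[F]_m) : F := (x^T *m M *m y) 0 0.

Lemma mbt_symbil M : M^T = M -> symbil (mbt M).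
Proof.
move=> sM; split=> [x y z|c x y|x y]; rewrite /mbt.
- by rewrite linearD /= !mulmxDl mxE.
- by rewrite linearZ /= -!scalemxAl mxE.
rewrite -[in LHS](trmxK (x^T *m M *m y)) [LHS]mxE; congr ((_ : 'M__) _ _).
by rewrite !trmx_mul sM trmxK mulmxA.
Qed.

Lemma mbt_col M X i j : mbt M (col i X) (col j X) = (X^T *m M *m X) i j.
Proof.
rewrite /mbt !colE trmx_mul trmx_delta !mulmxA -[_ *m X *m _]mulmxA -!mulmxA -rowE !mulmxA -colE.
by rewrite !mxE.
Qed.

Lemma diag_sym M X d : X \in unitmx -> X^T *m M *m X = diag_mx d -> M^T = M.
Proof.
move=> uX e; have uXt : X^T \in unitmx by rewrite unitmx_tr.
have -> : M = invmx X^T *m diag_mx d *m invmx X.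
  by rewrite -e !mulmxA mulVmx // mul1mx mulmxK.
by rewrite !trmx_mul tr_diag_mx !trmx_inv trmxK mulmxA.
Qed.

Lemma diag_det M X d : X^T *m M *m X = diag_mx d -> \det X ^+ 2 * \det M = \prod_i d 0 i.
Proof.
move=> e; rewrite -det_diag -e !det_mulmx det_tr; ring.
Qed.

End MatrixForm.

Section Eta.

Variables (F : fieldType) (v : F -> int).
Hypothesis HF : unram2 v.
Variable m : nat.
Implicit Types (M X : 'M[F]_m) (d : 'rV[F]_m).

Lemma hasse_pairwise (g : 'I_m -> F) s : pairwise (fun i j : 'I_m => (i < j)%N) s ->
  hasse (map g s) = \prod_(i <- s) \prod_(j <- s | (i < j)%N) hilb (g i) (g j).
Proof.
elim: s => [|x s IH]; first by rewrite big_nil.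
rewrite pairwise_cons => /andP[/allP hx hs]; rewrite /= IH // !big_cons ltnn; congr (_ * _).
  by rewrite big_map big_seq [RHS]big_seq_cond; apply: eq_bigl => j; case: (boolP (j \in s)) => // /hx ->.
rewrite big_seq [RHS]big_seq; apply: eq_bigr => i /hx xi.
by rewrite big_cons ltnNge (ltnW xi).
Qed.

Lemma hasse_enum d : hasse [seq d 0 i | i <- enum 'I_m] =
  \prod_(i < m) \prod_(j < m | (i < j)%N) hilb (d 0 i) (d 0 j).
Proof.
rewrite hasse_pairwise; last first.
  have := iota_ltn_sorted 0 m; rewrite (sorted_pairwise ltn_trans) -val_enum_ord pairwise_map.
  by [].
rewrite big_enum; apply: eq_bigr => i _; exact: big_enum_cond.
Qed.

Definition cols X := [seq col i X | i <- enum 'I_m].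

Lemma norms_cols M X d : X^T *m M *m X = diag_mx d ->
  norms (mbt M) (cols X) = [seq d 0 i | i <- enum 'I_m].
Proof.
move=> e; rewrite /norms -map_comp; apply: eq_map => i /=.
by rewrite mbt_col e mxE eqxx mulr1n.
Qed.

Lemma orth_cols M X d : X^T *m M *m X = diag_mx d -> (forall i, d 0 i != 0) ->
  orthF (mbt M) (cols X).
Proof.
move=> e d0; have E i j : mbt M (col i X) (col j X) = d 0 i *+ (i == j).
  by rewrite mbt_col e mxE.
split.
- rewrite map_inj_uniq ?enum_uniq // => i j eij; apply/eqP; apply: contraT => ij.
  have := E i j; rewrite -eij E eqxx (negPf ij) mulr1n mulr0n => /eqP.
  by rewrite (negPf (d0 _)).
- move=> _ _ /mapP[i _ ->] /mapP[j _ ->] ne; rewrite E.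
  by case: (eqVneq i j) ne => [->|_ _]; rewrite ?eqxx ?mulr0n.
- by move=> _ /mapP[i _ ->]; rewrite E eqxx mulr1n.
Qed.

Lemma span_cols M X d x : X \in unitmx -> X^T *m M *m X = diag_mx d -> (forall i, d 0 i != 0) ->
  Span (mbt M) (cols X) x.
Proof.
move=> uX e d0; rewrite /Span big_map big_enum /=.
have sM := diag_sym uX e.
pose y := invmx X *m x; have xE : x = X *m y by rewrite mulKVmx.
have xS : x = \sum_i y i 0 *: col i X.
  rewrite xE; apply/colP => k; rewrite mxE summxE; apply: eq_bigr => i _.
  by rewrite !mxE mulrC.
rewrite {1}xS; apply: eq_bigr => i _; congr (_ *: _).
rewrite {1}xS (bt_suml (mbt_symbil sM)) (bigD1 i) //= big1 => [|j ji].
  rewrite addr0 (btZl (mbt_symbil sM)) mulfK // mbt_col e [diag_mx _ _ _]mxE eqxx mulr1n; exact: d0.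
by rewrite (btZl (mbt_symbil sM)) mbt_col e [diag_mx _ _ _]mxE (negPf ji) mulr0n mulr0.
Qed.

(** The diagonalization that [xget] picks in the definition of eta can be replaced by any other. *)
Lemma eta_eq M X d : X \in unitmx -> X^T *m M *m X = diag_mx d -> (forall i, d 0 i != 0) ->
  Defs.eta M = eta_diag (\det M) d.
Proof.
move=> uX e d0; have sM := diag_sym uX e.
rewrite /Defs.eta; set d' := classical_sets.xget _ _.
have [U [uU e']] : exists U : 'M[F]_m, U \in unitmx /\ U^T *m M *m U = diag_mx d'.
  exact: (@classical_sets.xgetPex _ 0 (fun d : 'rV[F]_m => exists U : 'M[F]_m,
                U \in unitmx /\ U^T *m M *m U = diag_mx d) (ex_intro _ d (ex_intro _ X (conj uX e)))).
have d'0 i : d' 0 i != 0.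
  have : \prod_i d' 0 i != 0.
    have : \prod_i d 0 i != 0 by apply/prodf_neq0 => j _; apply: d0.
    rewrite -(diag_det e) mulf_eq0 negb_or => /andP[_ dM].
    by rewrite -(diag_det e'); apply: mulf_neq0 => //; apply: expf_neq0; rewrite -unitfE.
  by move/prodf_neq0 => /(_ i isT).
rewrite /eta_diag; congr (_ * _); rewrite -!hasse_enum -(norms_cols e) -(norms_cols e').
have [|||||-> _] // := @hasse_basis _ _ HF _ _ (mbt_symbil sM) m (cols U) (cols X).
- by rewrite size_map size_enum_ord.
- by rewrite size_map size_enum_ord.
- exact: orth_cols e' d'0.
- exact: orth_cols e d0.
by move=> x _; apply: span_cols uU e' d'0.
Qed.

End Eta.

(** * Discriminants *)

Section Discriminant.

Variables (F : fieldType) (v : F -> int).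
Hypothesis HF : unram2 v.
Notation wge := (wge v).
Notation wex := (wex v).
Let two0 := two_neq0 HF.

(** Discriminants of unramified quadratic algebras, the split one included. *)
Definition unramD (x : F) : Prop :=
  exists w t, [/\ wge w 0, t != 0 & x = (1 - 4 * w) * t ^+ 2].

(** Ramified discriminants: odd valuation, or units of quadratic defect 2o, up to squares. *)
Definition ramD (x : F) : Prop :=
  (x != 0 /\ odd `|v x|) \/ exists u t, [/\ wex u 0, t != 0 & x = (1 + 2 * u) * t ^+ 2].

Lemma unit_1m4 w : wge w 0 -> wex (1 - 4 * w) 0.
Proof.
by move=> hw; rewrite -mulrN; apply: (unit_1p4 HF); rewrite (wgeN HF).
Qed.

Lemma unramD1 : unramD 1.
Proof. by exists 0, 1; rewrite (wge0 v) oner_eq0; split=> //; ring. Qed.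

Lemma unramDM x y : unramD x -> unramD y -> unramD (x * y).
Proof.
move=> [w [t [hw t0 ->]]] [w' [t' [hw' t0' ->]]].
exists (w + w' - 4 * (w * w')), (t * t'); split; last by ring.
  apply: wgeB => //; first exact: wgeD.
  by apply: (wgeM_le HF (wex_wge (wex4 HF) (lexx _)) (wgeM HF hw hw')).
by rewrite mulf_neq0.
Qed.

Lemma unramD_neq0 x : unramD x -> x != 0.
Proof.
by move=> [w [t [hw t0 ->]]]; rewrite mulf_neq0 ?expf_neq0 // (wex_neq0 (unit_1m4 hw)).
Qed.

Lemma unramD_even x : unramD x -> ~~ odd `|v x|.
Proof.
move=> [w [t [hw t0 ->]]]; have /wexP[n0 h] := unit_1m4 hw.
rewrite (vM HF) ?expf_neq0 // (vX HF) //; lia.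
Qed.

Lemma unramD_sq x t : t != 0 -> unramD x -> unramD (x * t ^+ 2).
Proof.
move=> t0 [w [s [hw s0 ->]]]; exists w, (s * t); split=> //; first by rewrite mulf_neq0.
ring.
Qed.

Lemma unramDM_ramD x y : unramD x -> ramD y -> ramD (x * y).
Proof.
move=> hx [[y0 oy]|[u [t [hu t0 ->]]]].
  left; have x0 := unramD_neq0 hx; split; first by rewrite mulf_neq0.
  have := unramD_even hx; rewrite (vM HF) //; lia.
right; case: hx => w [s [hw s0 ->]].
exists (u - 2 * (w * (1 + 2 * u))), (t * s); split; last by ring.
  apply: (wexD HF hu); rewrite (wgeN HF); apply: (wge_dbl HF (k := 0)) => //.
  apply: (wgeM_le HF hw (l := 0)) => //; apply: wex_wge (unit_1p2 HF _) _ => //.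
  exact: wex_wge hu _.
by rewrite mulf_neq0.
Qed.

Lemma disc_xi_eqsq x y : eqsq x y -> disc_xi v x = disc_xi v y.
Proof.
have aux a b t : t != 0 -> (forall c d : F, (c != 0) || (d != 0) -> ~~ odd `|v (c ^+ 2 - a * d ^+ 2)|) ->
   b = a * t ^+ 2 -> forall c d : F, (c != 0) || (d != 0) -> ~~ odd `|v (c ^+ 2 - b * d ^+ 2)|.
  move=> t0 h -> c d cd; have := h c (t * d); rewrite mulf_eq0 (negPf t0) /= => /(_ cd).
  by rewrite exprMn mulrA.
move=> xy; have [c c0 xE] := xy; have [c' c0' yE] := eqsq_sym xy.
rewrite /disc_xi.
have -> : `[< exists z, x = z ^+ 2 >] = `[< exists z, y = z ^+ 2 >].
  apply/asboolP/asboolP => -[z e]; [exists (z * c') | exists (z * c)].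
    by rewrite yE e exprMn.
  by rewrite xE e exprMn.
case: asboolP => // _; congr (if _ then _ else _).
by apply/asboolP/asboolP => h; [apply: aux c0' h yE | apply: aux c0 h xE].
Qed.

Lemma disc_xi_unram x : unramD x -> disc_xi v x != 0.
Proof.
move=> [w [t [hw t0 ->]]].
rewrite (@disc_xi_eqsq _ (1 - 4 * w)); last by exists t.
rewrite /disc_xi; case: asboolP => // nsq; case: asboolP => // h; case: h.
have nroot z : wge z 0 -> ~~ wge (z ^+ 2 + z - - w) 2.
  move=> hz; apply/negP => h; case: nsq; have [s _ e] := sq_1p4 HF hz h.
  by exists s; rewrite -e; ring.
have key a b : wge a 0 -> wex b 0 -> ~~ odd `|v (a ^+ 2 - (1 - 4 * w) * b ^+ 2)|.
  move=> ha hb; have b0 := wex_neq0 hb; set D := _ - _.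
  have ib : wge b 0 by apply: wex_wge hb _.
  (* If s is a unit, so is D. Otherwise D = 4(r^2 + r + w)b^2 with r = s / (2b), and the bracket is
     a unit because [1 - 4 * w] is not a square. Both valuations are even. *)
  pose s := a - b; have DE : D = s * (s + 2 * b) + 4 * (w * b ^+ 2) by rewrite /D /s; ring.
  have hs : wge s 0 by apply: wgeB.
  have hwb : wge (w * b ^+ 2) 0 by rewrite expr2; apply: (wgeM_le HF hw (wgeM HF ib ib)).
  have [hs2|/(wge_wex (k := 0) hs) hs0] := boolP (wge s 2); last first.
    have : wex D 0.
      rewrite DE; apply: (wexD HF).
        apply: (wexE (wexM HF hs0 (wexD HF hs0 (_ : wge (2 * b) 1)))) => //.
        exact: (wge_dbl HF ib).
      by apply: (wgeM_le HF (wex_wge (wex4 HF) (lexx _)) hwb).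
    by case/wexP => _; lia.
  pose r := s / 2 / b; have hr : wge r 0.
    by apply: (wge_Vexl HF (k := 0) _ hb) => //; apply: (wge_Vexl HF hs2 (wex2 HF)).
  have {}DE : D = 4 * ((r ^+ 2 + r - - w) * b ^+ 2).
    by rewrite DE /r; field; repeat (apply/andP; split).
  have hq : wge (r ^+ 2 + r - - w) 0.
    rewrite opprK; apply: wgeD => //; apply: wgeD => //.
    by rewrite expr2; apply: (wgeM_le HF hr hr).
  have /wexP[_] : wex D 4; last by lia.
  rewrite DE; apply: (wexE (wexM HF (wex4 HF) (wexM HF (wge_wex (k := 0) hq (nroot _ hr)) (wexX HF 2 hb)))) => //.
move=> a b ab.
have [b0|b0] := eqVneq b 0.
  move: ab; rewrite b0 eqxx orbF expr0n mulr0 subr0 => a0; rewrite (vX HF) //; lia.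
have [a0|a0] := eqVneq a 0.
  have /wexP[n0 h] := unit_1m4 hw.
  rewrite a0 expr0n sub0r (vN HF) (vM HF) ?expf_neq0 // (vX HF) //; lia.
wlog ba : / v b <= v a => [hwlog|].
  case: (lerP (v b) (v a)) => [|lt_ab]; first exact: hwlog.
  have /wexP[n0 hn] := unit_1m4 hw.
  have : wex (a ^+ 2 - (1 - 4 * w) * b ^+ 2) (2 * (2 * v a)).
    apply: (wexD HF); first by apply/wexP; rewrite expf_neq0 // (vX HF) //.
    rewrite (wgeN HF); apply/wgeP => _; rewrite (vM HF) ?expf_neq0 // (vX HF) //; lia.
  by case/wexP => _; set z := v (_ - _); lia.
have := key (a / b) 1; have -> : (a / b) ^+ 2 - (1 - 4 * w) * 1 ^+ 2 =
   (a ^+ 2 - (1 - 4 * w) * b ^+ 2) / b ^+ 2 by field; repeat (apply/andP; split).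
have nz : a ^+ 2 - (1 - 4 * w) * b ^+ 2 != 0.
  apply/eqP => /eqP; rewrite subr_eq0 => /eqP e; case: nsq; exists (a / b).
  by rewrite expr_div_n e mulfK // expf_neq0.
rewrite (vM HF) ?invr_eq0 ?expf_neq0 // (vV HF) ?expf_neq0 // (vX HF) // => h.
have : wge (a / b) 0 by apply/wgeP => _; rewrite (vM HF) ?invr_eq0 // (vV HF) //; lia.
by move/h => /(_ (wex1 HF)); set z := v (_ - _); lia.
Qed.

Lemma disc_xi_ram x : ramD x -> disc_xi v x = 0.
Proof.
case=> [[x0 ox]|[u [t [hu t0 ->]]]].
  rewrite /disc_xi; case: asboolP => [[y e]|_].
    move: ox x0; rewrite e expf_eq0 /= => oy y0; move: oy; rewrite (vX HF) //; lia.
  case: asboolP => // h; have := h 0 1; rewrite oner_eq0 orbT => /(_ isT).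
  by rewrite expr0n expr1n mulr1 sub0r (vN HF) ox.
rewrite (@disc_xi_eqsq _ (1 + 2 * u)); last by exists t.
have h2u := wexM HF (wex2 HF) hu.
rewrite /disc_xi; case: asboolP => [[y e]|_].
  have y0 : y != 0.
    have := wex_neq0 (unit_1p2 HF (wex_wge hu (lexx _))).
    by rewrite e expf_eq0 /=.
  have hy : wge y 0.
    have /wexP[_] := unit_1p2 HF (wex_wge hu (lexx _)); rewrite e (vX HF) // => h.
    apply/wgeP; lia.
  (* The two factors are both units or both in 2o, so the product cannot have valuation exactly
     1. *)
  have e2 : 2 * u = (y - 1) * (y - 1 + 2) by have -> : (y - 1) * (y - 1 + 2) = y ^+ 2 - 1 by [ring]; rewrite -e; ring.
  have hs : wge (y - 1) 0 by apply: wgeB => //; apply: wge1.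
  have [h|/(wge_wex (k := 0) hs) h] := boolP (wge (y - 1) 2).
    have : wge (2 * u) 4.
      rewrite e2; apply: (wgeM_le HF h (wgeD HF h (wex_wge (wex2 HF) (lexx _)))) => //.
    by case/wexP: h2u => n0 h2 /wgeP/(_ n0); lia.
  have : wex (2 * u) 0.
    rewrite e2; apply: (wexE (wexM HF h (wexD HF h _))) => //.
    exact: wex_wge (wex2 HF) _.
  by case/wexP: h2u => n0 h2 /wexP[_]; lia.
case: asboolP => // h; have := h 1 1; rewrite oner_eq0 => /(_ isT).
have -> : 1 ^+ 2 - (1 + 2 * u) * 1 ^+ 2 = - (2 * u) by ring.
by rewrite (vN HF); case/wexP: h2u => _; lia.
Qed.

End Discriminant.

(** * Reduced systems *)

Ltac clia := clear; lia.

Section Comb.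

Variables (F : fieldType) (V : lmodType F).

(** Linear combinations as formal sums, indices possibly repeated, so that closure properties follow
    by induction. The test [B] usually bounds the valuation of a coefficient in terms of its
    index. *)
Inductive comb (f : nat -> V) (I : seq nat) (B : nat -> F -> bool) : V -> Prop :=
| comb0 : comb f I B 0
| combS x m c : comb f I B x -> m \in I -> B m c -> comb f I B (x + c *: f m).

Lemma combD f I B x y : comb f I B x -> comb f I B y -> comb f I B (x + y).
Proof.
move=> hx; elim: y / => [|y m c _ IH mI hc]; first by rewrite addr0.
by rewrite addrA; apply: combS.
Qed.

Lemma comb_scale f I (B B' : nat -> F -> bool) s x : comb f I B x -> (forall m c, B m c -> B' m (s * c)) ->
  comb f I B' (s *: x).
Proof.
move=> hx h; elim: x / hx => [|x m c _ IH mI hc]; first by rewrite scaler0; apply: comb0.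
by rewrite scalerDr scalerA; apply: combS => //; apply: h.
Qed.

Lemma comb_sub f I J (B B' : nat -> F -> bool) x : comb f I B x -> {subset I <= J} ->
  (forall m c, m \in I -> B m c -> B' m c) -> comb f J B' x.
Proof.
move=> hx IJ h; elim: x / hx => [|x m c _ IH mI hc]; first exact: comb0.
by apply: combS => //; [apply: IJ | apply: h].
Qed.

Lemma comb1 f I (B : nat -> F -> bool) m c : m \in I -> B m c -> comb f I B (c *: f m).
Proof. by move=> mI hc; rewrite -[_ *: _]add0r; apply: combS => //; apply: comb0. Qed.

Lemma comb_orth (bt : V -> V -> F) f I B x y : symbil bt -> comb f I B x ->
  (forall m, m \in I -> bt (f m) y = 0) -> bt x y = 0.
Proof.
move=> HB hx h; elim: x / hx => [|x m c _ IH mI hc]; first by rewrite (bt0l HB).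
by rewrite (btDl HB) (btZl HB) IH h // mulr0 addr0.
Qed.

Lemma comb_coef f I B x : uniq I -> comb f I B x ->
  exists c : nat -> F, x = \sum_(m <- I) c m *: f m.
Proof.
move=> uI; elim: x / => [|x m c _ [d ->] mI _].
  by exists (fun=> 0); rewrite big1 // => i _; rewrite scale0r.
exists (fun i => d i + (if i == m then c else 0)).
have -> : \sum_(i <- I) (d i + (if i == m then c else 0)) *: f i =
  \sum_(i <- I) d i *: f i + \sum_(i <- I) (if i == m then c else 0) *: f i.
  by rewrite -big_split /=; apply: eq_bigr => i _; rewrite scalerDl.
congr (_ + _); rewrite (bigD1_seq m) //= eqxx big1 ?addr0 // => i /negPf ->.
by rewrite scale0r.
Qed.

End Comb.

Definition flat (ps : seq (nat * nat)) : seq nat := flatten [seq [:: p.1; p.2] | p <- ps].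
Definition idx (ps : seq (nat * nat)) (ss : seq nat) : seq nat := ss ++ flat ps.
Definition lnk (ps : seq (nat * nat)) (i j : nat) : bool := ((i, j) \in ps) || ((j, i) \in ps).

Lemma mem_flat ps p : p \in ps -> (p.1 \in flat ps) && (p.2 \in flat ps).
Proof.
move=> h; apply/andP; split; apply/flattenP; exists [:: p.1; p.2];
  rewrite ?inE ?eqxx ?orbT //; by apply: (map_f (fun p : nat * nat => [:: p.1; p.2])).
Qed.

Lemma pair_neq ps p : uniq (flat ps) -> p \in ps -> p.1 != p.2.
Proof.
elim: ps => //= q ps IH; rewrite !inE => /andP[hq /andP[_ uf]] /orP[/eqP->|pI]; last exact: IH.
by move: hq; rewrite negb_or => /andP[].
Qed.

Section Reduced.

Variables (F : fieldType) (v : F -> int).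
Hypothesis HF : unram2 v.
Notation wge := (wge v).
Notation wex := (wex v).
Let two0 := two_neq0 HF.
Variables (V : lmodType F) (bt : V -> V -> F).
Hypothesis HB : symbil bt.
Implicit Types (f g : nat -> V) (a : nat -> nat) (ps : seq (nat * nat)) (ss I : seq nat).

(** Step t of the filtration attached to [f] and [a], without the integrality of coefficients. All
    bounds are on doubled valuations, so a coefficient has room [(t - a m) / 2]. *)
Definition Lam f a I (t : int) := comb f I (fun m c => wge c (t - (a m)%:Z)).

Lemma Lam_le f a I J t t' x : Lam f a I t x -> {subset I <= J} -> t' <= t -> Lam f a J t' x.
Proof. by move=> h IJ tt; apply: comb_sub h IJ _ => m c _ hc; apply: wge_le hc _; lia. Qed.

Lemma LamD f a I t x y : Lam f a I t x -> Lam f a I t y -> Lam f a I t (x + y).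
Proof. exact: combD. Qed.

Lemma LamZ f a I t t' s r x : Lam f a I t x -> wge s r -> t' <= t + r -> Lam f a I t' (s *: x).
Proof.
by move=> h hs ht; apply: (comb_scale h) => m c hc; apply: (wgeM_le HF hs hc); lia.
Qed.

Lemma Lam_f f a I m : m \in I -> Lam f a I (a m)%:Z (f m).
Proof.
move=> mI; rewrite -[f m]scale1r; apply: comb1 => //; apply: (wge1 HF); lia.
Qed.

Lemma Lam1 f a I t m c : m \in I -> wge c (t - (a m)%:Z) -> Lam f a I t (c *: f m).
Proof. by move=> mI hc; apply: comb1. Qed.

Lemma Lam_trans f f' a I I' t x : (forall m, m \in I' -> Lam f a I (a m)%:Z (f' m)) ->
  Lam f' a I' t x -> Lam f a I t x.
Proof.
move=> h; elim: x / => [|x m c _ IH mI hc]; first exact: comb0.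
apply: LamD => //; apply: (LamZ (h _ mI) hc); lia.
Qed.

Definition bounded f a I :=
  (forall i, i \in I -> wge (bt (f i) (f i)) (2 * (a i)%:Z)) /\
  (forall i j, i \in I -> j \in I -> i != j -> wge (2 * bt (f i) (f j)) ((a i)%:Z + (a j)%:Z)).

Lemma Lam_bt f a I s t x y : bounded f a I -> Lam f a I s x -> Lam f a I t y ->
  wge (2 * bt x y) (s + t).
Proof.
move=> [h1 h2] hx hy; elim: x / hx => [|x i c _ IHx iI hc].
  by rewrite (bt0l HB) mulr0 (wge0 v).
rewrite (btDl HB) mulrDr; apply: wgeD => //; rewrite (btZl HB) mulrCA.
have : wge (2 * bt (f i) y) ((a i)%:Z + t).
  elim: y / hy {IHx} => [|y j d _ IHy jI hd]; first by rewrite (bt0r HB) mulr0 (wge0 v).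
  rewrite (btDr HB) mulrDr; apply: wgeD => //; rewrite (btZr HB) mulrCA.
  apply: (wgeM_le HF hd (l := (a i)%:Z + (a j)%:Z)); last by lia.
  have [->|ij] := eqVneq i j; last exact: h2.
  apply: (wge_dbl HF (h1 _ jI)); lia.
move=> hiy; apply: (wgeM_le HF hc hiy); lia.
Qed.

Lemma Lam_Q f a I s x : bounded f a I -> Lam f a I s x -> wge (bt x x) (2 * s).
Proof.
move=> hb hx; have [h1 h2] := hb; elim: x / hx => [|x i c hx IHx iI hc].
  by rewrite (bt0l HB) (wge0 v).
have -> : bt (x + c *: f i) (x + c *: f i) =
  bt x x + c * (2 * bt x (f i)) + c * c * bt (f i) (f i).
  by rewrite !(btDl HB, btDr HB, btZl HB, btZr HB) [bt (f i) x](btC HB); ring.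
apply: wgeD => //; last by apply: (wgeM_le HF (wgeM HF hc hc) (h1 _ iI)); lia.
apply: wgeD => //; apply: (wgeM_le HF hc (Lam_bt hb hx (Lam_f f a iI))); lia.
Qed.

(* Reduced system with exponents [a]: the indices are matched into pairs [ps] spanning planes of
   unramified discriminant, except for singles [ss] (at most two, by [rs_par]); everything else
   vanishes in the associated graded form. *)
Record RS f a ps ss : Prop := {
  rs_uniq : uniq (idx ps ss);
  rs_diag : forall i, i \in idx ps ss -> wge (bt (f i) (f i)) (2 * (a i)%:Z);
  rs_pair : forall p, p \in ps -> wex (2 * bt (f p.1) (f p.2)) ((a p.1)%:Z + (a p.2)%:Z);
  rs_off : forall i j, i \in idx ps ss -> j \in idx ps ss -> i != j -> ~~ lnk ps i j ->
    wge (2 * bt (f i) (f j)) ((a i)%:Z + (a j)%:Z + 1);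
  rs_sing : forall i, i \in ss -> wex (bt (f i) (f i)) (2 * (a i)%:Z);
  rs_par : forall i j, i \in ss -> j \in ss -> i != j -> odd (a i + a j) }.

Lemma RS_bounded f a ps ss : RS f a ps ss -> bounded f a (idx ps ss).
Proof.
move=> h; split; first exact: rs_diag h.
move=> i j iI jI ij; have [/orP[]|hl] := boolP (lnk ps i j).
- by move/(rs_pair h) => /= hw; apply: wex_wge hw _.
- by move/(rs_pair h) => /=; rewrite (btC HB) addrC => hw; apply: wex_wge hw _.
apply: wge_le (rs_off h iI jI ij hl) _; lia.
Qed.

(** Being reduced is a property of the graded form, which is unchanged by errors of this size. *)
Lemma RS_cong f f' a ps ss : RS f a ps ss ->
  (forall i, i \in idx ps ss ->
     wge (bt (f' i) (f' i) - bt (f i) (f i)) (2 * (a i)%:Z + 2)) ->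
  (forall i j, i \in idx ps ss -> j \in idx ps ss -> i != j ->
     wge (2 * bt (f' i) (f' j) - 2 * bt (f i) (f j)) ((a i)%:Z + (a j)%:Z + 1)) ->
  RS f' a ps ss.
Proof.
move=> h h1 h2.
have dE i : bt (f' i) (f' i) = bt (f i) (f i) + (bt (f' i) (f' i) - bt (f i) (f i)) by ring.
have oE i j : 2 * bt (f' i) (f' j) =
   2 * bt (f i) (f j) + (2 * bt (f' i) (f' j) - 2 * bt (f i) (f j)) by ring.
split; first exact: rs_uniq h.
- move=> i iI; rewrite dE; apply: wgeD => //; first exact: (rs_diag h).
  by apply: wge_le (h1 _ iI) _; lia.
- move=> p pI; rewrite oE.
  have /andP[p1 p2] := mem_flat pI.
  apply: (wexD HF (rs_pair h pI)); apply: h2; rewrite ?mem_cat ?p1 ?p2 ?orbT //.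
  by have := rs_uniq h; rewrite cat_uniq => /and3P[_ _ uf]; apply: pair_neq uf pI.
- move=> i j iI jI ij hl; rewrite oE; apply: wgeD => //; last exact: h2.
  exact: (rs_off h).
- move=> i iI; rewrite dE; apply: (wexD HF (rs_sing h iI)).
  by apply: wge_le (h1 i _) _; [rewrite mem_cat iI | lia].
exact: rs_par h.
Qed.

Lemma RS_sub f a p ps ss : RS f a (p :: ps) ss -> RS f a ps ss.
Proof.
move=> h; have sub : {subset idx ps ss <= idx (p :: ps) ss}.
  by move=> i; rewrite !mem_cat !inE => /orP[->//|->]; rewrite !orbT.
have u := rs_uniq h; move: (u); rewrite cat_uniq => /and3P[us hs].
rewrite /= inE negb_or -!andbA => /and4P[_ n1 n2 uf].
have {n1 n2 hs}nI i : i \in idx ps ss -> (i != p.1) && (i != p.2).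
  move=> iI; rewrite -negb_or; apply: contraTN iI => ip; rewrite mem_cat negb_or.
  apply/andP; split; last by case/orP: ip => /eqP ->.
  apply: contra hs => iss; apply/hasP; exists i => //.
  by rewrite !inE; case/orP: ip => ->; rewrite ?orbT.
split.
- rewrite cat_uniq us uf andbT /=; apply/hasPn => i ifl; apply/negP => iss.
  move: u; rewrite cat_uniq => /and3P[_ /hasPn/(_ i) hh _].
  by move: hh; rewrite !inE ifl !orbT iss => /(_ isT).
- by move=> i /sub; apply: (rs_diag h).
- by move=> q qp; apply: (rs_pair h); rewrite inE qp orbT.
- move=> i j iI jI ij hl; apply: (rs_off h) => //; try exact: sub.
  have /andP[i1 i2] := nI _ iI; case: p i1 i2 {h u sub nI} => p1 p2 /= i1 i2.
  by rewrite /lnk !inE !xpair_eqE (negPf i1) (negPf i2) andbF.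
- exact: rs_sing h.
exact: rs_par h.
Qed.

Lemma Lam_cong_in g f f' a I (J : seq nat) : bounded g a I ->
  (forall i, i \in J -> Lam g a I (a i)%:Z (f i)) ->
  (forall i, i \in J -> Lam g a I ((a i)%:Z + 1) (f' i - f i)) ->
  (forall i, i \in J -> wge (bt (f' i) (f' i) - bt (f i) (f i)) (2 * (a i)%:Z + 2)) /\
  (forall i j, i \in J -> j \in J -> i != j ->
     wge (2 * bt (f' i) (f' j) - 2 * bt (f i) (f j)) ((a i)%:Z + (a j)%:Z + 1)).
Proof.
move=> hb hf hd; split=> [i iI|i j iI jI ij].
  have -> : bt (f' i) (f' i) - bt (f i) (f i) =
     2 * bt (f i) (f' i - f i) + bt (f' i - f i) (f' i - f i).
    by rewrite !(btBl HB, btBr HB) [bt (f' i) (f i)](btC HB); ring.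
  apply: wgeD => //.
    (* The available bound is 2a + 1; a doubled valuation is even, so it is at least 2a + 2. *)
    apply: (wge_par (Lam_bt hb (hf _ iI) (hd _ iI))); lia.
  by apply: wge_le (Lam_Q hb (hd _ iI)) _; lia.
have -> : 2 * bt (f' i) (f' j) - 2 * bt (f i) (f j) =
     2 * bt (f i) (f' j - f j) + 2 * bt (f' i - f i) (f j) + 2 * bt (f' i - f i) (f' j - f j).
  by rewrite !(btBl HB, btBr HB); ring.
apply: wgeD => //; first apply: wgeD => //.
- apply: wge_le (Lam_bt hb (hf _ iI) (hd _ jI)) _; lia.
- apply: wge_le (Lam_bt hb (hd _ iI) (hf _ jI)) _; lia.
- apply: wge_le (Lam_bt hb (hd _ iI) (hd _ jI)) _; lia.
Qed.

Lemma Lam_cong f f' a I : bounded f a I ->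
  (forall i, i \in I -> Lam f a I ((a i)%:Z + 1) (f' i - f i)) ->
  (forall i, i \in I -> wge (bt (f' i) (f' i) - bt (f i) (f i)) (2 * (a i)%:Z + 2)) /\
  (forall i j, i \in I -> j \in I -> i != j ->
     wge (2 * bt (f' i) (f' j) - 2 * bt (f i) (f j)) ((a i)%:Z + (a j)%:Z + 1)).
Proof. by move=> hb; apply: Lam_cong_in => // i iI; apply: Lam_f. Qed.

(** Gram-Schmidt with respect to the planes, one plane at a time. Products outside the matching are
    one half-step smaller than the planes require, hence so are the corrections, and the system
    stays reduced. The last clause passes orthogonality back from [g] to [f]. *)
Lemma clear_pairs f a ps ss : RS f a ps ss -> exists g,
  (forall i, i \in idx ps ss -> Lam f a (flat ps) ((a i)%:Z + 1) (g i - f i)) /\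
  (forall i j, i \in idx ps ss -> j \in idx ps ss -> i != j -> ~~ lnk ps i j ->
     ~~ ((i \in ss) && (j \in ss)) -> bt (g i) (g j) = 0) /\
  (forall z, (forall i, i \in flat ps -> bt (g i) z = 0) -> forall i, i \in flat ps -> bt (f i) z = 0).
Proof.
elim: ps f => [|[i j] ps IH] f h.
  exists f; split=> [l _|]; first by rewrite subrr; apply: comb0.
  by split=> // l m lI mI _ _; move: lI mI; rewrite /idx cats0 => -> ->.
have hs := RS_sub h.
have ij0 : (i, j) \in (i, j) :: ps by rewrite mem_head.
have iI : i \in idx ((i, j) :: ps) ss by rewrite mem_cat !inE eqxx orbT.
have jI : j \in idx ((i, j) :: ps) ss by rewrite mem_cat !inE eqxx !orbT.
have sub : {subset idx ps ss <= idx ((i, j) :: ps) ss}.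
  by move=> l; rewrite !mem_cat !inE => /orP[->//|->]; rewrite !orbT.
have nij l : l \in idx ps ss -> (l != i) && (l != j).
  move=> lI; rewrite -negb_or; apply: contraTN lI => lij; rewrite mem_cat negb_or.
  have := rs_uniq h; rewrite cat_uniq => /and3P[_ hh].
  rewrite /= inE negb_or -!andbA => /and4P[_ n1 n2 _].
  apply/andP; split; last by case/orP: lij => /eqP ->.
  apply: contra hh => lss; apply/hasP; exists l => //.
  by rewrite !inE; case/orP: lij => ->; rewrite ?orbT.
have nl l : l \in idx ps ss -> ~~ lnk ((i, j) :: ps) l i /\ ~~ lnk ((i, j) :: ps) l j.
  move=> lI; have /andP[li lj] := nij _ lI.
  have aux k : k \in [:: i; j] -> ~~ lnk ps l k.
    move=> kij; apply/negP => /orP[] /mem_flat /andP[h1 h2];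
      have := nij k; rewrite mem_cat ?h1 ?h2 orbT => /(_ isT);
      by move: kij; rewrite !inE => /orP[] /eqP->; rewrite eqxx ?andbF.
  by split; rewrite /lnk !inE !xpair_eqE (negPf li) (negPf lj) ?andbF /=; apply: aux; rewrite !inE eqxx ?orbT.
set qii := bt (f i) (f i); set qjj := bt (f j) (f j); set qij := bt (f i) (f j).
pose D := qii * qjj - qij ^+ 2.
have eij : wex (2 * qij) ((a i)%:Z + (a j)%:Z) by apply: (rs_pair h ij0).
have bii : wge qii (2 * (a i)%:Z) by apply: (rs_diag h).
have bjj : wge qjj (2 * (a j)%:Z) by apply: (rs_diag h).
have e4D : wex (4 * D) (2 * ((a i)%:Z + (a j)%:Z)).
  have -> : 4 * D = - (2 * qij) ^+ 2 + 4 * (qii * qjj) by rewrite /D; ring.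
  apply: (wexD HF); first by rewrite (wexN HF); apply: (wexE (wexX HF 2 eij)) => //; clia.
  by apply: (wgeM_le HF (wex_wge (wex4 HF) (lexx _)) (wgeM HF bii bjj)); clia.
have D0 : D != 0 by apply: contraNneq (wex_neq0 e4D) => ->; rewrite mulr0.
(* Cramer's rule for the projection of [f l] to the plane. The determinant [D] has exact valuation
   because its term [qij ^+ 2] dominates. *)
pose x l := (bt (f l) (f i) * qjj - bt (f l) (f j) * qij) / D.
pose y l := (bt (f l) (f j) * qii - bt (f l) (f i) * qij) / D.
have n4 : (4 : F) != 0 := wex_neq0 (wex4 HF).
have hx l : l \in idx ps ss -> wge (x l) ((a l)%:Z + 1 - (a i)%:Z).
  move=> lI; have /andP[li lj] := nij _ lI; have [l1 l2] := nl _ lI.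
  have b1 := rs_off h (sub _ lI) iI li l1; have b2 := rs_off h (sub _ lI) jI lj l2.
  have -> : x l = ((2 * bt (f l) (f i)) * (2 * qjj) - (2 * bt (f l) (f j)) * (2 * qij)) / (4 * D).
    by rewrite /x; field; repeat (apply/andP; split).
  apply: (wge_Vexl HF (k := (a l)%:Z + 1 + (a i)%:Z + 2 * (a j)%:Z) _ e4D); last by clia.
  apply: wgeB => //.
    apply: (wgeM_le HF b1 (wge_dbl HF bjj (lexx _))); clia.
  apply: (wgeM_le HF b2 (wex_wge eij (lexx _))); clia.
have hy l : l \in idx ps ss -> wge (y l) ((a l)%:Z + 1 - (a j)%:Z).
  move=> lI; have /andP[li lj] := nij _ lI; have [l1 l2] := nl _ lI.
  have b1 := rs_off h (sub _ lI) iI li l1; have b2 := rs_off h (sub _ lI) jI lj l2.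
  have -> : y l = ((2 * bt (f l) (f j)) * (2 * qii) - (2 * bt (f l) (f i)) * (2 * qij)) / (4 * D).
    by rewrite /y; field; repeat (apply/andP; split).
  apply: (wge_Vexl HF (k := (a l)%:Z + 1 + (a j)%:Z + 2 * (a i)%:Z) _ e4D); last by clia.
  apply: wgeB => //.
    apply: (wgeM_le HF b2 (wge_dbl HF bii (lexx _))); clia.
  apply: (wgeM_le HF b1 (wex_wge eij (lexx _))); clia.
pose f' l := f l - x l *: f i - y l *: f j.
have hb := RS_bounded h.
have d' l I : l \in idx ps ss -> i \in I -> j \in I -> Lam f a I ((a l)%:Z + 1) (f' l - f l).
  move=> lI i_in j_in; have -> : f' l - f l = (- x l) *: f i + (- y l) *: f j.
    by rewrite /f' !scaleNr addrC addrA addKr.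
  by apply: LamD; apply: Lam1 => //; rewrite (wgeN HF) ?hx ?hy.
have hs' : RS f' a ps ss.
  have hbs := RS_bounded hs.
  have cg : forall l, l \in idx ps ss -> Lam f a (idx ((i, j) :: ps) ss) ((a l)%:Z + 1) (f' l - f l).
    by move=> l lI; apply: d'.
  (* The congruence lemma wants a family on all indices, but [f'] is controlled only off the plane
     being cleared. *)
  pose f'' l := if l \in idx ps ss then f' l else f l.
  have [|c1 c2] := @Lam_cong f f'' a (idx ((i, j) :: ps) ss) hb.
    move=> l lI; rewrite /f''; case: ifP => [l'|_]; first exact: cg.
    by rewrite subrr; apply: comb0.
  apply: (RS_cong hs).
    by move=> l lI; have := c1 _ (sub _ lI); rewrite /f'' lI.
  by move=> l m lI mI lm; have := c2 _ _ (sub _ lI) (sub _ mI) lm; rewrite /f'' lI mI.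
have oi l : bt (f' l) (f i) = 0.
  rewrite /f' !(btBl HB, btZl HB) [bt (f j) _](btC HB) -/qii -/qij /x /y.
  by move: D0; rewrite /D => D0; field; repeat (apply/andP; split).
have oj l : bt (f' l) (f j) = 0.
  rewrite /f' !(btBl HB, btZl HB) -/qjj -/qij /x /y.
  by move: D0; rewrite /D => D0; field; repeat (apply/andP; split).
have [g' [hg [og pg]]] := IH _ hs'.
have hf' I l : l \in idx ps ss -> l \in I -> i \in I -> j \in I -> Lam f a I (a l)%:Z (f' l).
  move=> lI l_in i_in j_in; rewrite -[f' l](subrK (f l)); apply: LamD; last exact: Lam_f.
  by apply: Lam_le (d' _ _ lI i_in j_in) _ _ => //; clia.
have g'o l z : l \in idx ps ss -> (forall m, bt (f' m) z = 0) -> bt (g' l) z = 0.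
  move=> lI hz; rewrite -[g' l](subrK (f' l)) (btDl HB) hz addr0.
  by apply: (comb_orth HB (hg _ lI)).
have cases l : l \in idx ((i, j) :: ps) ss -> [\/ l = i, l = j | l \in idx ps ss].
  rewrite !mem_cat !inE -!orbA => /or4P[lss|/eqP->|/eqP->|lf]; [apply: Or33|exact: Or31|exact: Or32|apply: Or33].
    by rewrite lss.
  by rewrite lf orbT.
exists (fun l => if l \in idx ps ss then g' l else f l); split.
  move=> l lI; case: ifP => lI'; last by rewrite subrr; apply: comb0.
  rewrite -(subrK (f' l) (g' l)) -addrA; apply: LamD; last first.
    by apply: d' => //; rewrite !inE eqxx ?orbT.
  apply: (Lam_trans _ (hg _ lI')) => m mf.
  by apply: hf'; rewrite ?mem_cat ?inE ?mf ?eqxx ?orbT.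
have ni : i \notin idx ps ss by apply/negP => /nij; rewrite eqxx.
have nj : j \notin idx ps ss by apply/negP => /nij; rewrite eqxx andbF.
split; last first.
  move=> z hz.
  have zi : bt (f i) z = 0 by have := hz i; rewrite (negPf ni) mem_head => ->.
  have zj : bt (f j) z = 0 by have := hz j; rewrite (negPf nj) !inE eqxx orbT => ->.
  have zf l : l \in flat ps -> bt (f' l) z = 0.
    apply: pg => m mf; have mI : m \in idx ps ss by rewrite mem_cat mf orbT.
    by have := hz m; rewrite mI => -> //; rewrite !inE mf !orbT.
  move=> l; rewrite !inE => /or3P[/eqP->|/eqP->|lf] //.
  by have := zf _ lf; rewrite /f' !(btBl HB, btZl HB) zi zj !mulr0 !subr0.
move=> l m lI mI lm hl hss.
case: (cases _ lI) => [lE|lE|lI'].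
- rewrite lE (negPf ni); case: (cases _ mI) => [mE|mE|mI'].
  + by move: lm; rewrite lE mE eqxx.
  + by move: hl; rewrite /lnk lE mE mem_head.
  + by rewrite mI' (btC HB); apply: g'o.
- rewrite lE (negPf nj); case: (cases _ mI) => [mE|mE|mI'].
  + by move: hl; rewrite /lnk lE mE mem_head orbT.
  + by move: lm; rewrite lE mE eqxx.
  + by rewrite mI' (btC HB); apply: g'o.
- rewrite lI'; case: (cases _ mI) => [->|->|mI'].
  + by rewrite (negPf ni); apply: g'o.
  + by rewrite (negPf nj); apply: g'o.
  rewrite mI'; apply: og => //.
  by apply: contra hl; rewrite /lnk !inE => /orP[] ->; rewrite ?orbT.
Qed.

End Reduced.

Lemma flat_inj ps p q x : uniq (flat ps) -> p \in ps -> q \in ps ->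
  x \in [:: p.1; p.2] -> x \in [:: q.1; q.2] -> p = q.
Proof.
elim: ps => // r ps IH /=; rewrite inE negb_or -!andbA => /and4P[_ n1 n2 u].
have nr y q' : q' \in ps -> y \in [:: q'.1; q'.2] -> (y != r.1) && (y != r.2).
  move=> /mem_flat /andP[h1 h2] yq; rewrite -negb_or; apply/negP => /orP[] /eqP e; subst y.
    by move: yq; rewrite !inE => /orP[] /eqP e; move: n1; rewrite e ?h1 ?h2.
  by move: yq; rewrite !inE => /orP[] /eqP e; move: n2; rewrite e ?h1 ?h2.
move=> + + xp xq; rewrite !in_cons => /orP[/eqP pE|pI] /orP[/eqP qE|qI].
- by rewrite pE qE.
- by have := nr _ _ qI xq; rewrite -negb_or; move: xp; rewrite pE !inE => ->.
- by have := nr _ _ pI xp; rewrite -negb_or; move: xq; rewrite qE !inE => ->.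
exact: IH.
Qed.

Lemma flat_pair ps x : x \in flat ps -> exists2 p, p \in ps & x \in [:: p.1; p.2].
Proof. by case/flattenP => _ /mapP[p pI ->] xp; exists p. Qed.

(** * Planes with congruent Gram matrices *)

Section Plane.

Variables (F : fieldType) (v : F -> int).
Hypothesis HF : unram2 v.
Notation wge := (wge v).
Notation wex := (wex v).
Let two0 := two_neq0 HF.
Let four0 := wex_neq0 (wex4 HF).

Lemma rep_hyperbolic (al be ga r : F) : r != 0 -> be ^+ 2 - al * ga = r ^+ 2 ->
  exists x y, al * x ^+ 2 + 2 * be * x * y + ga * y ^+ 2 = 1.
Proof.
move=> r0 e; have [a0|a0] := eqVneq al 0.
  have b0 : be != 0.
    by apply: contraNneq r0 => b0; move: e; rewrite a0 b0 mul0r subr0 expr0n => /esym/eqP; rewrite expf_eq0.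
  exists ((1 - ga) / (2 * be)), 1; rewrite a0; field; by repeat (apply/andP; split).
(* Completing the square turns [al] times the form into X^2 - (ry)^2, and ((1 + al)/2)^2 - ((al -
   1)/2)^2 = al. *)
pose y := (al - 1) / (2 * r); pose X := (1 + al) / 2.
exists ((X - be * y) / al), y; apply: (mulfI a0).
have -> : al * (al * ((X - be * y) / al) ^+ 2 + 2 * be * ((X - be * y) / al) * y + ga * y ^+ 2) =
   X ^+ 2 - (be ^+ 2 - al * ga) * y ^+ 2 by field.
by rewrite e /X /y; field; repeat (apply/andP; split).
Qed.

(** Both discriminants are 1 - 4w and 1 - 4w1 up to squares, with w and w1 congruent modulo 2, hence
    they agree modulo squares. A common value [c] then makes the planes diagonalizable with the same
    entries: c = 1 if they are hyperbolic, c = [al] otherwise. *)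
Lemma plane_common (al be ga al1 be1 ga1 : F) (A B : int) :
  wge al (2 * A) -> wge ga (2 * B) -> wex (2 * be) (A + B) ->
  wge (al1 - al) (2 * A + 2) -> wge (ga1 - ga) (2 * B + 2) ->
  wge (2 * be1 - 2 * be) (A + B + 1) ->
  exists c D s s1 x y x1 y1, [/\ c != 0, unramD v D, s != 0 & s1 != 0] /\
   [/\ be ^+ 2 - al * ga = D * s ^+ 2, be1 ^+ 2 - al1 * ga1 = D * s1 ^+ 2,
       al * x ^+ 2 + 2 * be * x * y + ga * y ^+ 2 = c &
       al1 * x1 ^+ 2 + 2 * be1 * x1 * y1 + ga1 * y1 ^+ 2 = c].
Proof.
move=> ha hg hb da dg db.
have [z zE] := wex_par hb.
have {}db : wge (2 * be1 - 2 * be) (A + B + 2) by apply: (wge_par db); clear - zE; lia.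
have hb1 : wex (2 * be1) (A + B).
  have -> : 2 * be1 = 2 * be + (2 * be1 - 2 * be) by ring.
  by apply: (wexD HF hb); apply: wge_le db _; clia.
have ha1 : wge al1 (2 * A).
  have -> : al1 = al + (al1 - al) by ring.
  by apply: wgeD => //; apply: wge_le da _; clia.
have hg1 : wge ga1 (2 * B).
  have -> : ga1 = ga + (ga1 - ga) by ring.
  by apply: wgeD => //; apply: wge_le dg _; clia.
have b0 : be != 0 by apply: contraNneq (wex_neq0 hb) => ->; rewrite mulr0.
have b10 : be1 != 0 by apply: contraNneq (wex_neq0 hb1) => ->; rewrite mulr0.
pose w := al * ga / (2 * be) ^+ 2; pose w1 := al1 * ga1 / (2 * be1) ^+ 2.
have hw : wge w 0 by apply: (wge_Vexl HF (wgeM HF ha hg) (wexX HF 2 hb)); clia.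
have hw1 : wge w1 0 by apply: (wge_Vexl HF (wgeM HF ha1 hg1) (wexX HF 2 hb1)); clia.
have dw : wge (w1 - w) 2.
  have -> : w1 - w = (((al1 - al) * ga1 + al * (ga1 - ga)) * (2 * be) ^+ 2 -
      al * ga * ((2 * be1 - 2 * be) * (2 * be1 - 2 * be + 2 * (2 * be)))) / ((2 * be) ^+ 2 * (2 * be1) ^+ 2).
    by rewrite /w /w1; field; repeat (apply/andP; split).
  apply: (wge_Vexl HF (k := 4 * (A + B) + 2) _ (wexM HF (wexX HF 2 hb) (wexX HF 2 hb1))); last by clia.
  apply: wgeB => //.
    apply: (wgeM_le HF (k := 2 * (A + B) + 2) _ (wex_wge (wexX HF 2 hb) (lexx _))); last by clia.
    apply: wgeD => //.
      apply: (wgeM_le HF da hg1); clia.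
    apply: (wgeM_le HF ha dg); clia.
  apply: (wgeM_le HF (wgeM HF ha hg) (l := 2 * (A + B) + 2)); last by clia.
  apply: (wgeM_le HF db (l := A + B)); last by clia.
  apply: wgeD => //; first by apply: wge_le db _; clia.
  by apply: (wge_dbl HF (wex_wge hb (lexx _))); clia.
have h1w := unit_1m4 HF hw; have D0 := wex_neq0 h1w.
have [t t0 tE] : exists2 t, t != 0 & 1 - 4 * w1 = (1 - 4 * w) * t ^+ 2.
  apply: (sqrt_ratio HF h1w).
  have -> : 1 - 4 * w1 - (1 - 4 * w) = - (4 * (w1 - w)) by ring.
  by rewrite (wgeN HF); apply: (wgeM_le HF (wex_wge (wex4 HF) (lexx _)) dw).
have dE : be ^+ 2 - al * ga = (1 - 4 * w) * be ^+ 2.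
  by rewrite /w; field; repeat (apply/andP; split).
have dE1' : be1 ^+ 2 - al1 * ga1 = (1 - 4 * w1) * be1 ^+ 2.
  by rewrite /w1; field; repeat (apply/andP; split).
have dE1 : be1 ^+ 2 - al1 * ga1 = (1 - 4 * w) * (t * be1) ^+ 2.
  by rewrite dE1' tE; ring.
have uD : unramD v (1 - 4 * w) by exists w, 1; rewrite oner_eq0 hw expr1n mulr1.
have tb0 : t * be1 != 0 by rewrite mulf_neq0.
case: (pselect (exists r, 1 - 4 * w = r ^+ 2)) => [[r rE]|nsq].
  have r0 : r != 0 by apply: contraNneq D0 => r0; rewrite rE r0 expr0n.
  have [||x [y e]] := @rep_hyperbolic al be ga (r * be).
  - by rewrite mulf_neq0.
  - by rewrite dE rE -exprMn.
  have [||x1 [y1 e1]] := @rep_hyperbolic al1 be1 ga1 (r * (t * be1)).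
  - by rewrite mulf_neq0.
  - by rewrite dE1 rE -exprMn.
  by exists 1, (1 - 4 * w), be, (t * be1), x, y, x1, y1; rewrite oner_eq0.
have w2 : ~~ wge w 2.
  apply/negP => h; apply: nsq; have [|s _ e] := @sq_1p4 _ _ HF (- w) 0 (wge0 v 0).
    by have -> : 0 ^+ 2 + 0 - - w = w by ring.
  by exists s; rewrite -e; ring.
have xw : wex w 0 := wge_wex (k := 0) hw w2.
have wE : al * ga = w * (2 * be) ^+ 2.
  by rewrite /w; field; repeat (apply/andP; split).
have xag : wex (al * ga) (2 * (A + B)).
  rewrite wE; apply: (wexE (wexM HF xw (wexX HF 2 hb))) => //; clia.
have [al0 xa] : al != 0 /\ wex al (2 * A).
  case/wexP: xag => n0 vag; move: n0; rewrite mulf_eq0 negb_or => /andP[a0 g0].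
  split=> //; apply/wexP; split=> //.
  move: vag; rewrite (vM HF) //; move/wgeP/(_ a0): ha; move/wgeP/(_ g0): hg; clia.
have xa1 : wex al1 (2 * A).
  have -> : al1 = al + (al1 - al) by ring.
  by apply: (wexD HF xa); apply: wge_le da _; clia.
have al10 := wex_neq0 xa1.
(* In the anisotropic case w is a unit, which forces [al] and [al1] to have the same exact
   valuation; their ratio is a unit, hence a norm from the unramified extension. *)
have [|X [Y XY]] := @normg_unram_unit _ _ HF (1 - 4 * w1) w1 (al / al1) hw1 erefl.
  by apply: (wexE (wexM HF xa (wexV HF xa1))) => //; clia.
exists al, (1 - 4 * w), be, (t * be1), 1, 0, ((al1 * X - be1 * (al1 * Y / be1)) / al1), (al1 * Y / be1).
split; [by split | split=> //; first by ring].
apply: (mulfI al10).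
have -> : al1 * (al1 * ((al1 * X - be1 * (al1 * Y / be1)) / al1) ^+ 2 +
   2 * be1 * ((al1 * X - be1 * (al1 * Y / be1)) / al1) * (al1 * Y / be1) +
   ga1 * (al1 * Y / be1) ^+ 2) =
   (al1 * X) ^+ 2 - (be1 ^+ 2 - al1 * ga1) * (al1 * Y / be1) ^+ 2.
  by field; repeat (apply/andP; split).
rewrite dE1'; have -> : al = al1 * (X ^+ 2 - (1 - 4 * w1) * Y ^+ 2) by rewrite -XY mulrC divfK.
by field.
Qed.

End Plane.

(** * Simultaneous almost diagonalization *)

Section Diag.

Variables (F : fieldType) (v : F -> int).
Hypothesis HF : unram2 v.
Notation wge := (wge v).
Notation wex := (wex v).
Variables (V : lmodType F) (bt : V -> V -> F).
Hypothesis HB : symbil bt.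
Implicit Types (f g h : nat -> V) (a : nat -> nat) (ps : seq (nat * nat)) (ss I : seq nat).

Notation cspan f I := (comb f I (fun _ _ => true)).

(** The planes are split into orthogonal vectors over [F]; the singles are left as they are,
    possibly not orthogonal to each other, since only valuations matter for them. *)
Definition almost_diag h a ps ss :=
  [/\ forall i j, i \in idx ps ss -> j \in idx ps ss -> i != j -> ~~ ((i \in ss) && (j \in ss)) ->
        bt (h i) (h j) = 0,
      forall p, p \in ps -> [/\ bt (h p.1) (h p.1) != 0, bt (h p.2) (h p.2) != 0 &
        unramD v (- (bt (h p.1) (h p.1) * bt (h p.2) (h p.2)))],
      forall i, i \in ss -> wex (bt (h i) (h i)) (2 * (a i)%:Z) &
      forall i j, i \in ss -> j \in ss -> i != j ->
        wge (2 * bt (h i) (h j)) ((a i)%:Z + (a j)%:Z + 1)].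

Lemma plane_vectors gi gj (c D s x y : F) : c != 0 -> D != 0 -> s != 0 ->
  bt gi gj ^+ 2 - bt gi gi * bt gj gj = D * s ^+ 2 ->
  bt gi gi * x ^+ 2 + 2 * bt gi gj * x * y + bt gj gj * y ^+ 2 = c ->
  exists x' y', let hi := x *: gi + y *: gj in let hj := x' *: gi + y' *: gj in
   [/\ bt hi hi = c, bt hj hj = - (c * D) & bt hi hj = 0].
Proof.
move=> c0 D0 s0; set al := bt gi gi; set ga := bt gj gj; set be := bt gi gj => dE cE.
exists (- (x * be + y * ga) / s), ((x * al + y * be) / s) => /=.
rewrite !(btDl HB, btDr HB, btZl HB, btZr HB) [bt gj gi](btC HB) -/al -/be -/ga; split.
- by rewrite -cE; ring.
- rewrite -cE; have -> : D = (be ^+ 2 - al * ga) / s ^+ 2 by rewrite dE mulfK // expf_neq0.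
  by field.
- by field.
Qed.

Lemma common_planes g g1 a ps : uniq (flat ps) ->
  (forall p, p \in ps -> [/\ wge (bt (g p.1) (g p.1)) (2 * (a p.1)%:Z),
     wge (bt (g p.2) (g p.2)) (2 * (a p.2)%:Z) &
     wex (2 * bt (g p.1) (g p.2)) ((a p.1)%:Z + (a p.2)%:Z)]) ->
  (forall p, p \in ps -> [/\ wge (bt (g1 p.1) (g1 p.1) - bt (g p.1) (g p.1)) (2 * (a p.1)%:Z + 2),
     wge (bt (g1 p.2) (g1 p.2) - bt (g p.2) (g p.2)) (2 * (a p.2)%:Z + 2) &
     wge (2 * bt (g1 p.1) (g1 p.2) - 2 * bt (g p.1) (g p.2)) ((a p.1)%:Z + (a p.2)%:Z + 1)]) ->
  exists h h1, (forall l, l \notin flat ps -> h l = g l /\ h1 l = g1 l) /\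
   forall p, p \in ps ->
    [/\ cspan g [:: p.1; p.2] (h p.1), cspan g [:: p.1; p.2] (h p.2),
       cspan g1 [:: p.1; p.2] (h1 p.1) & cspan g1 [:: p.1; p.2] (h1 p.2)] /\
    [/\ bt (h p.1) (h p.2) = 0, bt (h1 p.1) (h1 p.2) = 0,
       bt (h1 p.1) (h1 p.1) = bt (h p.1) (h p.1) & bt (h1 p.2) (h1 p.2) = bt (h p.2) (h p.2)] /\
    [/\ bt (h p.1) (h p.1) != 0, bt (h p.2) (h p.2) != 0 &
        unramD v (- (bt (h p.1) (h p.1) * bt (h p.2) (h p.2)))].
Proof.
elim: ps => [|[i j] ps IH] u hb hc; first by exists g, g1.
move: u; rewrite /= inE negb_or -!andbA => /and4P[ij n1 n2 u].
have [||h [h1 [hn hp]]] := IH u.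
- by move=> p pI; apply: hb; rewrite inE pI orbT.
- by move=> p pI; apply: hc; rewrite inE pI orbT.
have [/= b1 b2 b3] := hb (i, j) (mem_head _ _); have [/= c1 c2 c3] := hc (i, j) (mem_head _ _).
have [c [D [s [s1 [x [y [x1 [y1 [[c0 uD s0 s10] [e1 e2 e3 e4]]]]]]]]]] :=
  plane_common HF b1 b2 b3 c1 c2 c3.
have D0 := unramD_neq0 HF uD.
have [x' [y' /= [r1 r2 r3]]] := plane_vectors c0 D0 s0 e1 e3.
have [x1' [y1' /= [t1 t2 t3]]] := plane_vectors c0 D0 s10 e2 e4.
have cs (g0 : nat -> V) (p q : F) : cspan g0 [:: i; j] (p *: g0 i + q *: g0 j).
  by apply: combD; apply: comb1 => //; rewrite !inE eqxx ?orbT.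
exists (fun l => if l == i then x *: g i + y *: g j else
                 if l == j then x' *: g i + y' *: g j else h l),
       (fun l => if l == i then x1 *: g1 i + y1 *: g1 j else
                 if l == j then x1' *: g1 i + y1' *: g1 j else h1 l); split.
  move=> l; rewrite !inE !negb_or => /and3P[/negPf-> /negPf-> ln]; exact: hn.
move=> p; rewrite inE => /orP[/eqP->|pI] /=.
  rewrite eqxx [j == i]eq_sym (negPf ij) eqxx; split; first by split.
  rewrite r1 r2 r3 t1 t2 t3; split=> //.
  have -> : - (c * - (c * D)) = D * c ^+ 2 by ring.
  by rewrite oppr_eq0 mulf_neq0 //; split=> //; apply: unramD_sq.
have /andP[p1 p2] := mem_flat pI.
have ne l : l \in flat ps -> ((l == i) = false) * ((l == j) = false).
  by move=> lf; split; apply/negP => /eqP e; [move: n1 | move: n2]; rewrite -e lf.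
by rewrite !(ne _ p1) !(ne _ p2); apply: hp.
Qed.

(** Two systems with the same graded form get literally equal diagonal values on the planes; the
    values on singles merely keep the same valuation. *)
Lemma common_diag f f1 a ps ss : RS v bt f a ps ss ->
  (forall i, i \in idx ps ss ->
     wge (bt (f1 i) (f1 i) - bt (f i) (f i)) (2 * (a i)%:Z + 2)) ->
  (forall i j, i \in idx ps ss -> j \in idx ps ss -> i != j ->
     wge (2 * bt (f1 i) (f1 j) - 2 * bt (f i) (f j)) ((a i)%:Z + (a j)%:Z + 1)) ->
  exists h h1,
   [/\ forall i, i \in idx ps ss -> cspan f (idx ps ss) (h i),
       forall i, i \in idx ps ss -> cspan f1 (idx ps ss) (h1 i),
       almost_diag h a ps ss, almost_diag h1 a ps ss &
       forall i, i \in flat ps -> bt (h1 i) (h1 i) = bt (h i) (h i)].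
Proof.
move=> hR q1 q2; have hR1 := RS_cong HF hR q1 q2.
have [g [gl [go _]]] := clear_pairs HF HB hR; have [g1 [gl1 [go1 _]]] := clear_pairs HF HB hR1.
have sf : {subset flat ps <= idx ps ss} by move=> l lf; rewrite mem_cat lf orbT.
have clos (f0 g0 : nat -> V) : RS v bt f0 a ps ss ->
   (forall i, i \in idx ps ss -> Lam v f0 a (flat ps) ((a i)%:Z + 1) (g0 i - f0 i)) ->
  (forall i, i \in idx ps ss -> wge (bt (g0 i) (g0 i) - bt (f0 i) (f0 i)) (2 * (a i)%:Z + 2)) /\
  (forall i j, i \in idx ps ss -> j \in idx ps ss -> i != j ->
     wge (2 * bt (g0 i) (g0 j) - 2 * bt (f0 i) (f0 j)) ((a i)%:Z + (a j)%:Z + 1)).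
  move=> h0 hl; apply: (Lam_cong HF HB (RS_bounded HF HB h0)) => i iI.
  exact: Lam_le (hl _ iI) sf (lexx _).
have [k1 k2] := clos _ _ hR gl; have [m1 m2] := clos _ _ hR1 gl1.
have hG := RS_cong HF hR k1 k2; have hG1 := RS_cong HF hR1 m1 m2.
have u : uniq (flat ps) by have := rs_uniq hR; rewrite cat_uniq => /and3P[].
have [||h [h1 [hn hp]]] := @common_planes g g1 a ps u.
- move=> p pI; have /andP[p1 p2] := mem_flat pI.
  by split; [apply: (rs_diag hG); apply: sf|apply: (rs_diag hG); apply: sf|apply: (rs_pair hG)].
- have eqd (x y z w : F) : w - x = (w - z) + (z - y) - (x - y) by ring.
  move=> p pI; have /andP[/sf p1 /sf p2] := mem_flat pI.
  have p12 := pair_neq u pI; split.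
  + rewrite (eqd _ (bt (f p.1) (f p.1)) (bt (f1 p.1) (f1 p.1))).
    by apply: wgeB; [|apply: wgeD|] => //; [apply: m1|apply: q1|apply: k1].
  + rewrite (eqd _ (bt (f p.2) (f p.2)) (bt (f1 p.2) (f1 p.2))).
    by apply: wgeB; [|apply: wgeD|] => //; [apply: m1|apply: q1|apply: k1].
  + rewrite (eqd _ (2 * bt (f p.1) (f p.2)) (2 * bt (f1 p.1) (f1 p.2))).
    by apply: wgeB; [|apply: wgeD|] => //; [apply: m2|apply: q2|apply: k2].
have nss l : l \in ss -> l \notin flat ps.
  by move=> lss; have := rs_uniq hR; rewrite cat_uniq => /and3P[_ /hasPn hh _]; apply/negP => /hh; rewrite /= lss.
have gspan (f0 g0 : nat -> V) i : i \in idx ps ss ->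
   Lam v f0 a (flat ps) ((a i)%:Z + 1) (g0 i - f0 i) -> cspan f0 (idx ps ss) (g0 i).
  move=> iI hl; rewrite -[g0 i](subrK (f0 i)); apply: combD.
    by apply: comb_sub hl sf _.
  by rewrite -[f0 i]scale1r; apply: comb1.
have tspan (f0 g0 : nat -> V) I x : (forall i, i \in I -> cspan f0 (idx ps ss) (g0 i)) ->
   cspan g0 I x -> cspan f0 (idx ps ss) x.
  move=> hI; elim: x / => [|x m c _ IHx mI _]; first exact: comb0.
  by apply: combD => //; apply: comb_scale (hI _ mI) _.
have allspan (f0 g0 h0 : nat -> V) :
   (forall i, i \in idx ps ss -> Lam v f0 a (flat ps) ((a i)%:Z + 1) (g0 i - f0 i)) ->
   (forall l, l \notin flat ps -> h0 l = g0 l) ->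
   (forall p, p \in ps -> cspan g0 [:: p.1; p.2] (h0 p.1) /\ cspan g0 [:: p.1; p.2] (h0 p.2)) ->
   forall i, i \in idx ps ss -> cspan f0 (idx ps ss) (h0 i).
  move=> hl h0n h0p i iI; move: (iI); rewrite mem_cat => /orP[iss|/flat_pair[p pI ip]].
    by rewrite h0n ?nss //; apply: gspan => //; apply: hl.
  have /andP[/sf p1 /sf p2] := mem_flat pI.
  have [s1 s2] := h0p _ pI.
  have gg m : m \in [:: p.1; p.2] -> cspan f0 (idx ps ss) (g0 m).
    by rewrite !inE => /orP[] /eqP ->; apply: gspan => //; apply: hl.
  by move: ip; rewrite !inE => /orP[] /eqP ->; apply: tspan gg _.
have ad (g0 h0 : nat -> V) : RS v bt g0 a ps ss ->
   (forall i j, i \in idx ps ss -> j \in idx ps ss -> i != j -> ~~ lnk ps i j ->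
     ~~ ((i \in ss) && (j \in ss)) -> bt (g0 i) (g0 j) = 0) ->
   (forall l, l \notin flat ps -> h0 l = g0 l) ->
   (forall p, p \in ps -> [/\ cspan g0 [:: p.1; p.2] (h0 p.1), cspan g0 [:: p.1; p.2] (h0 p.2) &
      bt (h0 p.1) (h0 p.2) = 0]) ->
   (forall p, p \in ps -> [/\ bt (h0 p.1) (h0 p.1) != 0, bt (h0 p.2) (h0 p.2) != 0 &
        unramD v (- (bt (h0 p.1) (h0 p.1) * bt (h0 p.2) (h0 p.2)))]) ->
   almost_diag h0 a ps ss.
  move=> hg0 go0 h0n h0p h0u; split=> //; last first.
  - move=> i j iss jss ij; rewrite !h0n ?nss //.
    apply: (rs_off hg0); rewrite ?mem_cat ?iss ?jss //.
    by apply/negP => /orP[] /mem_flat /andP[] /=; rewrite (negPf (nss _ iss)).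
  - by move=> i iss; rewrite h0n ?nss //; apply: (rs_sing hg0).
  have blk l : l \in idx ps ss -> (l \in ss /\ h0 l = g0 l) \/
      exists p, [/\ p \in ps, l \in [:: p.1; p.2] & cspan g0 [:: p.1; p.2] (h0 l)].
    rewrite mem_cat => /orP[lss|/flat_pair[p pI lp]]; first by left; rewrite h0n ?nss.
    right; exists p; split=> //; have [s1 s2 _] := h0p _ pI.
    by move: lp; rewrite !inE => /orP[] /eqP ->.
  have sp p l : p \in ps -> l \in [:: p.1; p.2] -> l \in flat ps.
    by move=> /mem_flat /andP[h3 h4]; rewrite !inE => /orP[] /eqP->.
  have op p l y : p \in ps -> l \in ss -> cspan g0 [:: p.1; p.2] y -> bt y (g0 l) = 0.
    move=> pI lss hy; apply: (comb_orth HB hy) => m mp.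
    have mf := sp _ _ pI mp.
    apply: go0; rewrite ?mem_cat ?mf ?lss ?orbT //.
    * by apply: contraTneq mf => ->; apply: nss.
    * by apply/negP => /orP[] /mem_flat /andP[] /=; rewrite (negPf (nss _ lss)).
    * by apply/negP => /andP[/nss]; rewrite mf.
  move=> i j iI jI ij nb.
  case: (blk _ iI) => [[iss iE]|[p [pI ip hpi]]]; case: (blk _ jI) => [[jss jE]|[q [qI jq hqj]]].
  - by move: nb; rewrite iss jss.
  - by rewrite iE (btC HB); apply: op hqj.
  - by rewrite jE; apply: op hpi.
  have [pq|pq] := eqVneq p q.
    subst q; have [_ _ o12] := h0p _ pI.
    move: ip jq ij; rewrite !inE => /orP[] /eqP-> /orP[] /eqP->; rewrite ?eqxx // => _.
    by rewrite (btC HB).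
  apply: (comb_orth HB hpi) => m mp; rewrite (btC HB); apply: (comb_orth HB hqj) => l lq.
  have mf := sp _ _ pI mp; have lf := sp _ _ qI lq.
  rewrite (btC HB); apply: go0; rewrite ?mem_cat ?mf ?lf ?orbT //.
  + by apply: contraNneq pq => ml; rewrite (flat_inj u pI qI mp) // ml.
  + apply/negP => /orP[] hml.
      have e1 : (m, l) = p by apply: (flat_inj u hml pI _ mp); rewrite inE eqxx.
      have e2 : (m, l) = q by apply: (flat_inj u hml qI _ lq); rewrite !inE eqxx orbT.
      by move/eqP: pq; apply; rewrite -e1 -e2.
    have e1 : (l, m) = p by apply: (flat_inj u hml pI _ mp); rewrite !inE eqxx orbT.
    have e2 : (l, m) = q by apply: (flat_inj u hml qI _ lq); rewrite inE eqxx.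
    by move/eqP: pq; apply; rewrite -e1 -e2.
  + by apply/negP => /andP[/nss]; rewrite mf.
exists h, h1; split.
- apply: (allspan f g h gl); first by move=> l /hn[].
  by move=> p /hp[[? ? ? ?] _].
- apply: (allspan f1 g1 h1 gl1); first by move=> l /hn[].
  by move=> p /hp[[? ? ? ?] _].
- apply: (ad g h hG go); first by move=> l /hn[].
  + by move=> p /hp[[? ? ? ?] [[? ? ? ?] _]].
  + by move=> p /hp[_ [_ ?]].
- apply: (ad g1 h1 hG1 go1); first by move=> l /hn[].
  + by move=> p /hp[[? ? ? ?] [[? ? ? ?] _]].
  + by move=> p /hp[_ [[_ _ -> ->] ?]].
move=> i /flat_pair[p pI]; rewrite !inE; have [_ [[_ _ e1 e2] _]] := hp _ pI.
by case/orP => /eqP ->.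
Qed.

End Diag.

Lemma size_flat ps : size (flat ps) = (size ps).*2.
Proof. by elim: ps => //= p ps ->. Qed.

(** * Invariants of reduced systems *)

Section Gram.

Variables (F : fieldType) (V : lmodType F) (bt : V -> V -> F).
Hypothesis HB : symbil bt.
Implicit Types (f h : nat -> V).

Notation cspan f I := (comb f I (fun _ _ => true)).

Definition gram f k : 'M[F]_k := \matrix_(i, j) bt (f i) (f j).

Lemma gram_transform f h k : (forall l, (l < k)%N -> cspan f (iota 0 k) (h l)) ->
  exists X : 'M[F]_k, X^T *m gram f k *m X = gram h k.
Proof.
move=> hh.
have /(fin_all_exists (P := fun (l : 'I_k) c => h l = \sum_(m <- iota 0 k) c m *: f m))[c cE] :
    forall l : 'I_k, exists c : nat -> F, h l = \sum_(m <- iota 0 k) c m *: f m.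
  by move=> l; apply: comb_coef (iota_uniq _ _) (hh l (ltn_ord l)).
have cE' (l : 'I_k) : h l = \sum_(m < k) c l m *: f m.
  by rewrite cE -(big_mkord xpredT (fun m => c l m *: f m)) /index_iota subn0.
exists (\matrix_(m, l) c l m); apply/matrixP => i j.
rewrite [RHS]mxE !cE' (bt_sumr HB) mxE; apply: eq_bigr => n _.
rewrite [X in _ * X]mxE (btZr HB) mulrC; congr (_ * _).
by rewrite (bt_suml HB) mxE; apply: eq_bigr => m _; rewrite (btZl HB) !mxE.
Qed.

Lemma gram_diag h k : (forall i j, (i < k)%N -> (j < k)%N -> i != j -> bt (h i) (h j) = 0) ->
  gram h k = diag_mx (\row_l bt (h l) (h l)).
Proof.
move=> o; apply/matrixP => i j; rewrite !mxE.
have [->|ij] := eqVneq i j; first by rewrite mulr1n.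
by rewrite mulr0n o.
Qed.

Lemma prod_iota (n : nat -> F) k : \prod_(l < k) n l = \prod_(l <- iota 0 k) n l.
Proof. by rewrite -(big_mkord xpredT) /index_iota subn0. Qed.

Lemma det_gram_diag h k : (forall i j, (i < k)%N -> (j < k)%N -> i != j -> bt (h i) (h j) = 0) ->
  \det (gram h k) = \prod_(l <- iota 0 k) bt (h l) (h l).
Proof.
move=> o; rewrite (gram_diag o) det_diag -prod_iota.
by apply: eq_bigr => i _; rewrite mxE.
Qed.

End Gram.

Section Zeta.

Variables (F : fieldType) (v : F -> int).
Hypothesis HF : unram2 v.
Notation wge := (wge v).
Notation wex := (wex v).
Let two0 := two_neq0 HF.
Variables (V : lmodType F) (bt : V -> V -> F).
Hypothesis HB : symbil bt.
Implicit Types (f g h : nat -> V) (a : nat -> nat) (ps : seq (nat * nat)) (ss I : seq nat).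

Notation cspan f I := (comb f I (fun _ _ => true)).
Notation gram := (gram bt).
Notation adiag := (almost_diag v bt).

(** The sign, one -1 for each plane, is the one that the discriminant of the whole form carries. *)
Lemma unram_prod (n : nat -> F) ps :
  (forall p, p \in ps -> unramD v (- (n p.1 * n p.2))) ->
  unramD v ((-1) ^+ size ps * \prod_(l <- flat ps) n l).
Proof.
elim: ps => [|p ps IH] h; first by rewrite big_nil mulr1 expr0; apply: unramD1.
rewrite /= !big_cons exprS.
have -> : -1 * (-1) ^+ size ps * (n p.1 * (n p.2 * \prod_(j <- flat ps) n j)) =
  - (n p.1 * n p.2) * ((-1) ^+ size ps * \prod_(l <- flat ps) n l) by ring.
apply: (unramDM HF); first by apply: h; rewrite mem_head.
by apply: IH => q qI; apply: h; rewrite inE qI orbT.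
Qed.

Lemma det_congr k (M N Y : 'M[F]_k) : Y^T *m M *m Y = N -> \det N != 0 ->
  \det Y != 0 /\ eqsq (\det N) (\det M).
Proof.
move=> <-; rewrite !det_mulmx det_tr => h.
have Y0 : \det Y != 0 by apply: contraNneq h => ->; rewrite mulr0.
by split=> //; exists (\det Y) => //; ring.
Qed.

Lemma xi_congr k s (M N Y : 'M[F]_k) : Y^T *m M *m Y = N -> \det N != 0 -> k = s.*2 ->
  xi v M = disc_xi v ((-1) ^+ s * \det N).
Proof.
move=> e N0 kE; rewrite /xi; have -> : k./2 = s by rewrite kE doubleK.
apply: disc_xi_eqsq.
have [Y0 [c c0 ->]] := det_congr e N0.
(* (-4)^s and (-1)^s differ by the square of 2^s. *)
exists (2 ^+ s / c); first by rewrite mulf_neq0 ?invr_eq0 ?expf_neq0.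
have -> : (-4) ^+ s = (-1) ^+ s * (2 ^+ s) ^+ 2 :> F.
  by rewrite -exprM mulnC exprM -exprMn; congr (_ ^+ _); ring.
by move: (_ ^+ s) (_ ^+ s) => p q; field.
Qed.

Lemma v_eqsq (x y : F) : x != 0 -> eqsq x y -> odd `|v x| = odd `|v y|.
Proof.
move=> x0 [c c0 xE]; have y0 : y != 0 by apply: contraNneq x0 => y0; rewrite xE y0 mul0r.
rewrite xE (vM HF) ?expf_neq0 // (vX HF) //; move: (v y) (v c) => p q; clia.
Qed.

Lemma idx_size ps ss k : perm_eq (idx ps ss) (iota 0 k) -> k = (size ss + (size ps).*2)%N.
Proof. by move/perm_size; rewrite size_cat size_flat size_iota. Qed.

Lemma idx_lt ps ss k l : perm_eq (idx ps ss) (iota 0 k) -> (l < k)%N = (l \in idx ps ss).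
Proof. by move/perm_mem ->; rewrite mem_iota. Qed.

Lemma flat_norm_neq0 h a ps ss : adiag h a ps ss -> \prod_(l <- flat ps) bt (h l) (h l) != 0.
Proof.
case=> _ hp _ _; rewrite prodf_seq_neq0; apply/allP => l /flat_pair[p pI lp] /=.
have [h1 h2 _] := hp _ pI; by move: lp; rewrite !inE => /orP[] /eqP ->.
Qed.

Lemma state0 k (M Y : 'M[F]_k) h a ps : perm_eq (idx ps [::]) (iota 0 k) ->
  adiag h a ps [::] -> Y^T *m M *m Y = gram h k ->
  [/\ ~~ odd k, xi v M != 0 & ~~ odd `|v (\det M)|].
Proof.
move=> pk ad e; have [o hp _ _] := ad; have kE := idx_size pk.
have dN : \det (gram h k) = \prod_(l <- flat ps) bt (h l) (h l).
  rewrite det_gram_diag ?(perm_big _ pk) // => i j; rewrite !(idx_lt _ pk) => iI jI ij.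
  by apply: o.
have d0 : \det (gram h k) != 0 by rewrite dN (flat_norm_neq0 ad).
have un : unramD v ((-1) ^+ size ps * \det (gram h k)).
  by rewrite dN; apply: unram_prod => p /hp[].
split.
- by rewrite kE add0n odd_double.
- by rewrite (xi_congr e d0 kE); apply: disc_xi_unram.
have [_ es] := det_congr e d0; rewrite -(v_eqsq d0 es).
have := unramD_even HF un; rewrite (vM HF) // ?expf_neq0 ?oppr_eq0 ?oner_eq0 //.
rewrite (vX HF) ?oppr_eq0 ?oner_eq0 // (vN HF) (v1 HF) mulr0 add0r //.
Qed.

Lemma state1_det k (M Y : 'M[F]_k) h a ps s : perm_eq (idx ps [:: s]) (iota 0 k) ->
  adiag h a ps [:: s] -> Y^T *m M *m Y = gram h k ->
  [/\ forall i j, (i < k)%N -> (j < k)%N -> i != j -> bt (h i) (h j) = 0,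
   \det (gram h k) = bt (h s) (h s) * \prod_(l <- flat ps) bt (h l) (h l) &
   \det (gram h k) != 0].
Proof.
move=> pk ad e; have [o hp hs _] := ad; have kE := idx_size pk.
have o' i j : (i < k)%N -> (j < k)%N -> i != j -> bt (h i) (h j) = 0.
  rewrite !(idx_lt _ pk) => iI jI ij; apply: o => //.
  by rewrite !inE; apply: contraNN ij => /andP[/eqP-> /eqP->].
have dE : \det (gram h k) = bt (h s) (h s) * \prod_(l <- flat ps) bt (h l) (h l).
  by rewrite (det_gram_diag o') -(perm_big _ pk) big_cons.
split=> //; rewrite dE mulf_neq0 ?(flat_norm_neq0 ad) //.
exact: wex_neq0 (hs _ (mem_head _ _)).
Qed.

Lemma state1 k (M Y : 'M[F]_k) h a ps s : perm_eq (idx ps [:: s]) (iota 0 k) ->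
  adiag h a ps [:: s] -> Y^T *m M *m Y = gram h k ->
  odd k /\ odd `|v (\det M)| = odd (a s).
Proof.
move=> pk ad e; have [o' dE d0] := state1_det pk ad e; have [o hp hs _] := ad.
have kE := idx_size pk.
split; first by rewrite kE add1n /= odd_double.
have [_ es] := det_congr e d0; rewrite -(v_eqsq d0 es) dE.
have /wexP[n0 vs] := hs _ (mem_head _ _).
rewrite (vM HF) ?(flat_norm_neq0 ad) //.
have un : unramD v ((-1) ^+ size ps * \prod_(l <- flat ps) bt (h l) (h l)).
  by apply: unram_prod => p /hp[].
have := unramD_even HF un; rewrite (vM HF) // ?(flat_norm_neq0 ad) ?expf_neq0 ?oppr_eq0 ?oner_eq0 //.
rewrite (vX HF) ?oppr_eq0 ?oner_eq0 // (vN HF) (v1 HF) mulr0 add0r.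
move: vs; set x := v (bt _ _); set y := v (\prod_(_ <- _) _); move: x y (a s) => x y z; clia.
Qed.

(** The discriminant of the span of two singles. If xy dominates, its valuation A + B is odd; if z^2
    dominates, it does so by exactly one factor 2, which leaves a unit of defect 2o times a square.
    As A + B + 1 is even, the next possible value of the doubled valuation of 2z is A + B + 3. *)
Lemma ram_pair (x y z : F) (A B : int) : wex x (2 * A) -> wex y (2 * B) -> odd `|A + B| ->
  wge (2 * z) (A + B + 1) -> ramD v (z ^+ 2 - x * y).
Proof.
move=> hx hy oAB hz.
have hxy := wexM HF hx hy; have h4xy := wexM HF (wex4 HF) hxy.
have n4 := wex_neq0 (wex4 HF).
have [hz3|hz3] := boolP (wge (2 * z) (A + B + 3)).
  left; have h : wex (4 * (z ^+ 2 - x * y)) (2 * (A + B + 2)).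
    have -> : 4 * (z ^+ 2 - x * y) = - (4 * (x * y)) + (2 * z) * (2 * z) by ring.
    apply: (wexD HF); last by apply: (wgeM_le HF hz3 hz3); clia.
    by rewrite (wexN HF); apply: (wexE h4xy) => //; clia.
  case/wexP: h => n0 vz; move: n0; rewrite mulf_eq0 negb_or => /andP[_ n0]; split=> //.
  move: vz; rewrite (vM HF) //.
  have /wexP[_ v4] := wex4 HF.
  by move: v4 oAB; move: (v 4) (v _) => p q; clear; lia.
right; have [m mE] : exists m : int, A + B + 1 = 2 * m.
  by exists ((A + B + 1) %/ 2)%Z; clear -oAB; lia.
have hz1 : wex (2 * z) (A + B + 1).
  rewrite mE; apply: (@wge_wex _ v); first by rewrite -mE.
  by move: hz3; apply: contra => h; apply: wge_le h _; clear -mE; lia.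
have z0 : z != 0 by apply: contraNneq (wex_neq0 hz1) => ->; rewrite mulr0.
exists (- (2 * (x * y) / (2 * z) ^+ 2)), z; split=> //; last first.
  by field; repeat (apply/andP; split).
rewrite (wexN HF); apply: (wexE (wexM HF (wexM HF (wex2 HF) hxy) (wexV HF (wexX HF 2 hz1)))) => //.
clia.
Qed.

Lemma state2 k (M Y : 'M[F]_k) h a ps s t : perm_eq (idx ps [:: s; t]) (iota 0 k) ->
  s != t -> odd (a s + a t) ->
  adiag h a ps [:: s; t] -> Y^T *m M *m Y = gram h k ->
  ~~ odd k /\ xi v M = 0.
Proof.
move=> pk st par ad e; have [o hp hs hst] := ad; have kE := idx_size pk.
have sI : s \in [:: s; t] by rewrite inE eqxx.
have tI : t \in [:: s; t] by rewrite !inE eqxx orbT.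
have xs := hs _ sI; have xt := hs _ tI; have ns := wex_neq0 xs.
pose h' l := if l == t then h t - (bt (h s) (h t) / bt (h s) (h s)) *: h s else h l.
have [X XE] : exists X : 'M[F]_k, X^T *m gram h k *m X = gram h' k.
  apply: (gram_transform HB) => l lk; rewrite /h'; case: ifP => [/eqP lt|_].
    apply: combD; first by rewrite -[h t]scale1r; apply: comb1; rewrite // -lt mem_iota.
    rewrite -scaleNr; apply: comb1 => //; rewrite mem_iota (idx_lt _ pk).
    by rewrite mem_cat sI.
  by rewrite -[h l]scale1r; apply: comb1; rewrite // mem_iota.
have u : uniq (idx ps [:: s; t]) by rewrite (perm_uniq pk) iota_uniq.
have o0 i j : i \in idx ps [:: s; t] -> j \in idx ps [:: s; t] -> i != j ->
   i != t -> j != t -> bt (h i) (h j) = 0.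
  move=> iI jI ij it jt; apply: o => //; rewrite !inE (negPf it) (negPf jt) !orbF.
  by apply: contraNN ij => /andP[/eqP-> /eqP->].
have ot i : i \in idx ps [:: s; t] -> i != t -> bt (h' t) (h i) = 0.
  move=> iI it; rewrite /h' eqxx (btBl HB) (btZl HB).
  have [->|is_] := eqVneq i s; first by rewrite divfK // [bt (h t) _](btC HB) subrr.
  have -> : bt (h t) (h i) = 0.
    apply: o => //; first by rewrite mem_cat tI.
      by rewrite eq_sym.
    by rewrite tI !inE (negPf it) (negPf is_).
  have -> : bt (h s) (h i) = 0.
    apply: o => //; first by rewrite mem_cat sI.
      by rewrite eq_sym.
    by rewrite sI !inE (negPf it) (negPf is_).
  by rewrite mulr0 subr0.
have o' i j : (i < k)%N -> (j < k)%N -> i != j -> bt (h' i) (h' j) = 0.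
  rewrite !(idx_lt _ pk) => iI jI ij.
  have [it|it] := eqVneq i t.
    have jt : j != t by rewrite -it eq_sym.
    by rewrite it {2}/h' (negPf jt) ot.
  have [jt|jt] := eqVneq j t.
    by rewrite jt {1}/h' (negPf it) (btC HB) ot.
  by rewrite /h' (negPf it) (negPf jt) o0.
have nt' : bt (h' t) (h' t) = bt (h t) (h t) - bt (h s) (h t) ^+ 2 / bt (h s) (h s).
  rewrite /h' eqxx !(btBl HB, btBr HB, btZl HB, btZr HB) [bt (h t) (h s)](btC HB).
  by field.
have e' : (Y *m X)^T *m M *m (Y *m X) = gram h' k.
  by rewrite trmx_mul -XE -e !mulmxA.
have ram : ramD v (- (bt (h s) (h s) * bt (h' t) (h' t))).
  have -> : - (bt (h s) (h s) * bt (h' t) (h' t)) =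
    bt (h s) (h t) ^+ 2 - bt (h s) (h s) * bt (h t) (h t) by rewrite nt'; field.
  apply: (ram_pair xs xt); first by move: par; move: (a s) (a t) => p q; clia.
  exact: hst.
have fl : \prod_(l <- flat ps) bt (h' l) (h' l) = \prod_(l <- flat ps) bt (h l) (h l).
  rewrite big_seq [RHS]big_seq; apply: eq_bigr => l lf; rewrite /h'.
  case: ifP => // /eqP lt; move: u; rewrite cat_uniq => /and3P[_ /hasPn/(_ l lf)].
  by rewrite lt /= tI.
have dE : (-1) ^+ (size ps).+1 * \det (gram h' k) =
   ((-1) ^+ size ps * \prod_(l <- flat ps) bt (h l) (h l)) * - (bt (h s) (h s) * bt (h' t) (h' t)).
  rewrite (det_gram_diag o') -(perm_big _ pk) !big_cons fl.
  have -> : h' s = h s by rewrite /h' (negPf st).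
  rewrite exprS /=; ring.
have ramd : ramD v ((-1) ^+ (size ps).+1 * \det (gram h' k)).
  rewrite dE; apply: (unramDM_ramD HF) => //; apply: unram_prod => p /hp[] //.
have d0 : \det (gram h' k) != 0.
  rewrite (det_gram_diag o') -(perm_big _ pk) !big_cons fl mulf_neq0 ?mulf_neq0 ?(flat_norm_neq0 ad) //.
    by rewrite /h' (negPf st).
  case: ram => [[n0 _]|[u0 [t0 [hu ht E]]]].
    by move: n0; rewrite oppr_eq0 mulf_eq0 negb_or => /andP[].
  have : - (bt (h s) (h s) * bt (h' t) (h' t)) != 0.
    rewrite E mulf_neq0 ?expf_neq0 //.
    exact: wex_neq0 (unit_1p2 HF (wex_wge hu (lexx _))).
  by rewrite oppr_eq0 mulf_eq0 negb_or => /andP[].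
split; first by rewrite kE /= odd_double.
rewrite (xi_congr (s := (size ps).+1) e' d0) ?(disc_xi_ram HF ramd) //.
Qed.

(** With x the value of the single vector, the factor of eta that involves -1 and the determinant
    supplies the signs that complete products of two values to discriminants of planes. *)
Lemma hilb_pairs_prod (n : nat -> F) ps x : x != 0 -> (forall l, l \in flat ps -> n l != 0) ->
  hilb (-1) x ^+ size ps * \prod_(l <- flat ps) hilb x (n l) =
  \prod_(p <- ps) hilb x (- (n p.1 * n p.2)).
Proof.
move=> x0; elim: ps => [|p ps IH] hn; first by rewrite !big_nil expr0 mulr1.
rewrite /= !big_cons -IH; last by move=> l lf; apply: hn; rewrite !inE lf !orbT.
have n1 : n p.1 != 0 by apply: hn; rewrite inE eqxx.
have n2 : n p.2 != 0 by apply: hn; rewrite !inE eqxx orbT.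
have m1 : (-1 : F) != 0 by rewrite oppr_eq0 oner_eq0.
have -> : - (n p.1 * n p.2) = -1 * (n p.1 * n p.2) by rewrite mulN1r.
rewrite (hilbMr HF) ?mulf_neq0 // (hilbMr HF) // [hilb x (-1)]hilbC exprS; ring.
Qed.

(** The ratio of [x] and [y] is a unit, and units are norms from unramified algebras. *)
Lemma hilb_same_val (x y D : F) : x != 0 -> y != 0 -> v x = v y -> unramD v D ->
  hilb x D = hilb y D.
Proof.
move=> x0 y0 vxy uD; have D0 := unramD_neq0 HF uD.
have yE : y = x * (y / x) by rewrite mulrC divfK.
have yx0 : y / x != 0 by rewrite mulf_neq0 ?invr_eq0.
rewrite [in RHS]yE (hilbMl HF) // [hilb (y / x) D]hilbC.
case: uD => w [t [hw t0 ->]]; rewrite (hilb_unram_unit HF) ?mulr1 //.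
  by apply/wexP; rewrite (vM HF) ?invr_eq0 // (vV HF) // vxy subrr mulr0.
exact: wex_neq0 (unit_1m4 HF hw).
Qed.

Lemma state1_eta k (M Y M1 Y1 : 'M[F]_k) h h1 a ps s : perm_eq (idx ps [:: s]) (iota 0 k) ->
  adiag h a ps [:: s] -> Y^T *m M *m Y = gram h k ->
  adiag h1 a ps [:: s] -> Y1^T *m M1 *m Y1 = gram h1 k ->
  (forall i, i \in flat ps -> bt (h1 i) (h1 i) = bt (h i) (h i)) ->
  Defs.eta M = Defs.eta M1.
Proof.
move=> pk ad e ad1 e1 hh; have kE := idx_size pk.
(* In this form the value of the single occurs only in symbols with unramified discriminants, so eta
   sees no more of it than its valuation; everything else depends on the planes alone. *)
have main (M0 Y0 : 'M[F]_k) h0 : adiag h0 a ps [:: s] -> Y0^T *m M0 *m Y0 = gram h0 k ->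
   Defs.eta M0 = hilb (-1 : F) (-1) ^+ (k.+1 %/ 4) *
     hilb (-1) (\prod_(l <- flat ps) bt (h0 l) (h0 l)) ^+ size ps *
     (\prod_(p <- ps) hilb (bt (h0 s) (h0 s)) (- (bt (h0 p.1) (h0 p.1) * bt (h0 p.2) (h0 p.2)))) *
     hasse [seq bt (h0 l) (h0 l) | l <- flat ps].
  move=> ad0 e0; have [o' dE d0] := state1_det pk ad0 e0; have [_ hp hs _] := ad0.
  have ns := wex_neq0 (hs _ (mem_head _ _)).
  have fn := flat_norm_neq0 ad0.
  have [Y00 es] := det_congr e0 d0.
  have e0' := e0; rewrite (gram_diag o') in e0'.
  have nl l : l \in flat ps -> bt (h0 l) (h0 l) != 0.
    by move=> /flat_pair[p pI lp]; have [n1 n2 _] := hp _ pI; move: lp; rewrite !inE => /orP[] /eqP->.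
  rewrite (eta_eq HF _ e0'); last 2 first.
  - by rewrite unitmxE unitfE.
  - move=> i; rewrite mxE; have := ltn_ord i; rewrite (idx_lt _ pk) inE => /orP[/eqP->//|]; exact: nl.
  have m1 : (-1 : F) != 0 by rewrite oppr_eq0 oner_eq0.
  rewrite /eta_diag -hasse_enum.
  have -> : [seq (\row_l bt (h0 l) (h0 l)) 0 i | i <- enum 'I_k] =
     [seq bt (h0 l) (h0 l) | l <- iota 0 k].
    by rewrite -val_enum_ord -map_comp; apply: eq_map => i; rewrite /= mxE.
  rewrite -(hasse_perm (perm_map (fun l => bt (h0 l) (h0 l)) pk)).
  have -> : (k.-1 %/ 2)%N = size ps by rewrite kE add1n /= divn2 doubleK.
  have -> : hilb (-1) (\det M0) = hilb (-1) (bt (h0 s) (h0 s)) * hilb (-1) (\prod_(l <- flat ps) bt (h0 l) (h0 l)).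
    rewrite -(hilbMr HF) // -dE; case: (eqsq_sym es) => c c0 ->.
    by rewrite (hilb_sqr HF).
  rewrite -(hilb_pairs_prod (n := fun l => bt (h0 l) (h0 l)) ns nl) /= big_map exprMn; ring.
rewrite (main _ _ _ ad e) (main _ _ _ ad1 e1).
have mE : [seq bt (h1 l) (h1 l) | l <- flat ps] = [seq bt (h l) (h l) | l <- flat ps].
  by apply/eq_in_map => l; apply: hh.
have pE : \prod_(l <- flat ps) bt (h1 l) (h1 l) = \prod_(l <- flat ps) bt (h l) (h l).
  by rewrite big_seq [RHS]big_seq; apply: eq_bigr => l; apply: hh.
rewrite mE pE; congr (_ * _ * _).
rewrite big_seq [RHS]big_seq; apply: eq_bigr => p pI.
have /andP[p1 p2] := mem_flat pI; rewrite (hh _ p1) (hh _ p2).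
have [_ hp hs _] := ad; have [_ _ hs1 _] := ad1.
have /wexP[n0 v0] := hs _ (mem_head _ _); have /wexP[n1 v1] := hs1 _ (mem_head _ _).
apply: hilb_same_val => //; last by case: (hp _ pI).
by move: v0 v1; move: (v _) (v _) (a s) => x y z; clia.
Qed.

Lemma RS_refl_cong f (I : seq nat) a :
  (forall i, i \in I -> wge (bt (f i) (f i) - bt (f i) (f i)) (2 * (a i)%:Z + 2)) /\
  (forall i j, i \in I -> j \in I -> i != j ->
     wge (2 * bt (f i) (f j) - 2 * bt (f i) (f j)) ((a i)%:Z + (a j)%:Z + 1)).
Proof. by split=> *; rewrite subrr (wge0 v). Qed.

Lemma span_gram f h ps ss k : perm_eq (idx ps ss) (iota 0 k) ->
  (forall i, i \in idx ps ss -> cspan f (idx ps ss) (h i)) ->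
  exists X : 'M[F]_k, X^T *m gram f k *m X = gram h k.
Proof.
move=> pk hh; apply: (gram_transform HB) => l; rewrite (idx_lt _ pk) => lI.
by apply: comb_sub (hh _ lI) _ _ => // m; rewrite (perm_mem pk).
Qed.

(** The dictionary between the number of singles and the invariants in the pre-optimality
    conditions. Three singles are impossible, since two of them would have exponents of the same
    parity. *)
Lemma RS_state k (M Y : 'M[F]_k) f a ps ss : perm_eq (idx ps ss) (iota 0 k) ->
  RS v bt f a ps ss -> Y^T *m M *m Y = gram f k ->
  match ss with
  | [::] => [/\ ~~ odd k, xi v M != 0 & ~~ odd `|v (\det M)|]
  | [:: s] => odd k /\ odd `|v (\det M)| = odd (a s)
  | [:: s; t] => ~~ odd k /\ xi v M = 0
  | _ => False
  end.
Proof.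
move=> pk hR e; have [c1 c2] := RS_refl_cong f (idx ps ss) a.
have [h [_ [hs _ ad _ _]]] := common_diag HF HB hR c1 c2.
have [X XE] := span_gram pk hs.
have e' : (Y *m X)^T *m M *m (Y *m X) = gram h k by rewrite trmx_mul -XE -e !mulmxA.
have par := rs_par hR.
have : uniq ss by have := rs_uniq hR; rewrite cat_uniq => /andP[].
case: ss pk hR {c1 c2 hs} ad par => [|s [|t [|z ss]]] pk hR ad par us.
- exact: state0 pk ad e'.
- exact: state1 pk ad e'.
- have st : s != t by move: us; rewrite /= inE andbT.
  by apply: (state2 pk st _ ad e'); apply: par; rewrite // !inE eqxx ?orbT.
move: us; rewrite /= !inE !negb_or -!andbA => /and5P[st sz _ tz _].
have p1 : odd (a s + a t) by apply: par; rewrite // !inE eqxx ?orbT.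
have p2 : odd (a s + a z) by apply: par; rewrite // !inE eqxx ?orbT.
have : odd (a t + a z) by apply: par; rewrite // !inE eqxx ?orbT.
by move: p1 p2; move: (a s) (a t) (a z) => x y w; clia.
Qed.

Lemma zeta_cong k (M Y M1 Y1 : 'M[F]_k) f f1 a ps ss : perm_eq (idx ps ss) (iota 0 k) ->
  RS v bt f a ps ss ->
  (forall i, i \in idx ps ss ->
     wge (bt (f1 i) (f1 i) - bt (f i) (f i)) (2 * (a i)%:Z + 2)) ->
  (forall i j, i \in idx ps ss -> j \in idx ps ss -> i != j ->
     wge (2 * bt (f1 i) (f1 j) - 2 * bt (f i) (f j)) ((a i)%:Z + (a j)%:Z + 1)) ->
  Y^T *m M *m Y = gram f k -> Y1^T *m M1 *m Y1 = gram f1 k ->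
  zeta v M = zeta v M1.
Proof.
move=> pk hR q1 q2 e e1; have hR1 := RS_cong HF hR q1 q2.
have st := RS_state pk hR e; have st1 := RS_state pk hR1 e1.
have [h [h1 [hs hs1 ad ad1 hh]]] := common_diag HF HB hR q1 q2.
have [X XE] := span_gram pk hs; have [X1 XE1] := span_gram pk hs1.
have e' : (Y *m X)^T *m M *m (Y *m X) = gram h k by rewrite trmx_mul -XE -e !mulmxA.
have e1' : (Y1 *m X1)^T *m M1 *m (Y1 *m X1) = gram h1 k by rewrite trmx_mul -XE1 -e1 !mulmxA.
rewrite /zeta.
case: ss pk {hR hR1 q1 q2 hs hs1} ad ad1 hh st st1 => [|s [|t [|//]]] pk ad ad1 hh.
- move=> [/negPf ko _ _] _; rewrite ko; have kE := idx_size pk.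
  have dN (h0 : nat -> V) : adiag h0 a ps [::] -> \det (gram h0 k) = \prod_(l <- flat ps) bt (h0 l) (h0 l).
    case=> o _ _ _; rewrite det_gram_diag ?(perm_big _ pk) // => i j; rewrite !(idx_lt _ pk) => iI jI ij.
    by apply: o.
  have d0 : \det (gram h k) != 0 by rewrite dN // (flat_norm_neq0 ad).
  have d10 : \det (gram h1 k) != 0 by rewrite dN // (flat_norm_neq0 ad1).
  rewrite (xi_congr e' d0 kE) (xi_congr e1' d10 kE) !dN //; congr (disc_xi _ (_ * _)).
  by rewrite big_seq [RHS]big_seq; apply: eq_bigr => l lf; rewrite hh.
- move=> [ko _] _; rewrite ko; exact: state1_eta pk ad e' ad1 e1' hh.
by move=> [/negPf -> ->] [_ ->].
Qed.

End Zeta.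

(** * Uniqueness of the Gross-Keating invariant *)

Lemma lexle_split s t : size s = size t -> lexle s t -> s = t \/
  exists p, [/\ (p < size s)%N, forall i, (i < p)%N -> nth 0%N s i = nth 0%N t i &
                (nth 0%N s p < nth 0%N t p)%N].
Proof.
elim: s t => [|x s IH] [|y t] //=; first by left.
move=> [sz] /orP[xy|/andP[/eqP-> st]]; first by right; exists 0%N.
case: (IH _ sz st) => [->|[p [ps h1 h2]]]; first by left.
by right; exists p.+1; split=> // -[|i] //; rewrite ltnS; apply: h1.
Qed.

Lemma lexle_total s t : lexle s t || lexle t s.
Proof.
elim: s t => [|x s IH] [|y t] //=; case: (ltngtP x y) => //= _; exact: IH.
Qed.

Lemma lexle_anti s t : size s = size t -> lexle s t -> lexle t s -> s = t.
Proof.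
elim: s t => [|x s IH] [|y t] //= [sz]; case: (ltngtP x y) => //= -> h1 h2.
by rewrite (IH t).
Qed.

Section Uniqueness.

Variables (F : fieldType) (v : F -> int).
Hypothesis HF : unram2 v.
Notation wge := (wge v).
Notation wex := (wex v).

Lemma wge_prod (I : Type) (r : seq I) (x : I -> F) (k : I -> int) :
  (forall i, wge (x i) (k i)) -> wge (\prod_(i <- r) x i) (\sum_(i <- r) k i).
Proof.
move=> h; elim: r => [|i r IH]; first by rewrite !big_nil (wge1 HF).
by rewrite !big_cons; apply: (wgeM HF).
Qed.

Lemma wge_det n (U : 'M[F]_n) (f g : 'I_n -> int) : (forall i j, wge (U i j) (f i + g j)) ->
  wge (\det U) (\sum_i f i + \sum_j g j).
Proof.
move=> h; rewrite /determinant; apply: wge_sum => // s _.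
apply: (wgeM_le HF (k := 0) (l := \sum_i (f i + g (perm.fun_of_perm s i)))) => //.
- by case: (perm.odd_perm s); rewrite ?expr1 ?expr0 ?(wgeN HF); apply: (wge1 HF).
- by apply: wge_prod.
rewrite add0r big_split /= lerD2l [leLHS](reindex_inj (@perm.perm_inj _ s)) //=.
Qed.

(** A matrix with unit determinant that preserves the filtration given by [c] has an inverse that
    preserves it; read off from the cofactors. *)
Lemma wge_inv n (U : 'M[F]_n) (c : 'I_n -> int) : U \in unitmx -> wex (\det U) 0 ->
  (forall i j, wge (U i j) (c j - c i)) -> forall i j, wge (invmx U i j) (c j - c i).
Proof.
move=> uU dU h i j; rewrite /invmx uU mxE [\adj U i j]mxE /cofactor.
apply: (wgeM_le HF (k := 0) (l := c j - c i)) => //; last by lia.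
  by have := wexV HF dU; rewrite oppr0 => h'; apply: wex_wge h' _.
apply: (wgeM_le HF (k := 0) (l := c j - c i)) => //; last by lia.
  by rewrite -signr_odd; case: (odd _); rewrite ?expr1 ?expr0 ?(wgeN HF); apply: (wge1 HF).
have := @wge_det _ (row' j (col' i U)) (fun k => - c (lift j k)) (fun k => c (lift i k)).
have e1 : \sum_k - c (lift j k) = c j - \sum_k c k.
  by rewrite sumrN [\sum_k c k](bigD1_ord j) //= opprD addrA subrr add0r.
have e2 : \sum_k c (lift i k) = \sum_k c k - c i.
  by rewrite [in RHS](bigD1_ord i) //= addrAC subrr add0r.
rewrite e1 e2 => hd; apply: wge_le (hd _) _.
  by move=> k l; rewrite !mxE addrC; apply: h.
by move: (\sum_k c k) => S; lia.
Qed.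

Definition Lev n (a : seq nat) (m : nat) (x : 'cV[F]_n) : Prop :=
  forall i : 'I_n, wge (x i 0) (m%:Z - (nth 0%N a i)%:Z) && wge (x i 0) 0.

(* The quadratic form induced on each graded piece [Lev a m / Lev a m.+1] has trivial radical; for
   a form in [inS v A a] this makes the filtration [Lev a] intrinsic. *)
Definition nonsing n (A : 'M[F]_n) (a : seq nat) : Prop :=
  forall (m : nat) x, Lev a m x -> wge (mbt A x x) (2 * m%:Z + 2) ->
    (forall y, Lev a m y -> wge (2 * mbt A x y) (2 * m%:Z + 2)) -> Lev a m.+1 x.

Lemma inS_off n (M : 'M[F]_n) a i j : M^T = M -> inS v M a ->
  wge (2 * M i j) ((nth 0%N a i)%:Z + (nth 0%N a j)%:Z).
Proof.
move=> sM [_ _ _ h]; case: (leqP i j) => ij; first by have := h i j ij; rewrite PoszD.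
have e : M j i = M i j by rewrite -{1}sM mxE.
by have := h j i (ltnW ij); rewrite PoszD addrC e.
Qed.

Lemma GLo_unit n (U : 'M[F]_n) : GLo v U ->
  [/\ U \in unitmx, wex (\det U) 0 & forall i j, wge (U i j) 0].
Proof.
move=> /andP[/forallP h1 h2]; rewrite unit_wex in h2; split=> //.
  by rewrite unitmxE unitfE (wex_neq0 h2).
by move=> i j; have /forallP/(_ j) := h1 i; rewrite integral_wge.
Qed.

Section Step.

Variables (n : nat) (A U : 'M[F]_n) (a a' : seq nat).
Hypotheses (sA : A^T = A) (hNS : nonsing A a) (hU : GLo v U).
Hypothesis hS : inS v (U^T *m A *m U) a'.
Notation c m i := (minn (nth 0%N a i) m).
Notation c' m i := (minn (nth 0%N a' i) m).

Let sA' : (U^T *m A *m U)^T = U^T *m A *m U.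
Proof. by rewrite !trmx_mul trmxK sA mulmxA. Qed.

(** A column of [U] whose target exponent exceeds m has such a small value and such small products
    that it lies in the radical of the graded form of level m, hence one level deeper. *)
Lemma level_step m : (forall i, (i < n)%N -> c m i = c' m i) ->
  (forall i j : 'I_n, wge (U i j) ((c m j)%:Z - (nth 0%N a i)%:Z)) ->
  forall i j : 'I_n, (m < nth 0%N a' j)%N -> wge (U i j) ((m.+1)%:Z - (nth 0%N a i)%:Z).
Proof.
move=> hm hP i j hj; have [uU dU iU] := GLo_unit hU.
have cj : c m j = m by rewrite hm // (minn_idPr (ltnW hj)).
(* After truncation at m both exponent sequences agree, so [U] preserves a single filtration and its
   inverse does too. This bounds the coordinates of [y] in the new basis. *)
have hUc k l : wge (U k l) ((c m l)%:Z - (c m k)%:Z).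
  case: (leqP (nth 0%N a k) m) => hk; first by rewrite ?(minn_idPl hk) hP.
  apply: wge_le (iU k l) _; rewrite ?(minn_idPr (ltnW hk)).
  by have := geq_minr (nth 0%N a l) m; lia.
have hZ := wge_inv uU dU hUc.
have hx : Lev a m (col j U).
  by move=> k; rewrite mxE iU andbT; have := hP k j; rewrite cj.
have := hNS hx _ _ i; rewrite mxE => /(_ _ _)/andP[] // {i}.
  rewrite mbt_col; have [_ _ hd _] := hS; have := hd j; rewrite vge_wge => h.
  by apply: wge_le h _; lia.
move=> y hy.
have -> : mbt A (col j U) y = \sum_l (U^T *m A *m U) j l * (invmx U *m y) l 0.
  transitivity ((row j (U^T *m A *m U) *m (invmx U *m y)) 0 0); last first.
    by rewrite mxE; apply: eq_bigr => l _; rewrite mxE.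
  by rewrite mulmxA -row_mul mulmxK // row_mul -tr_col.
rewrite mulr_sumr; apply: wge_sum => // l _; rewrite mulrA.
have hyl : wge ((invmx U *m y) l 0) (m%:Z - (c m l)%:Z).
  rewrite mxE; apply: wge_sum => // k _.
  apply: (wgeM_le HF (hZ l k) (l := m%:Z - (c m k)%:Z)); last by lia.
  have /andP[h1 h2] := hy k.
  case: (leqP (nth 0%N a k) m) => hk; first by rewrite ?(minn_idPl hk).
  by apply: wge_le h2 _; rewrite ?(minn_idPr (ltnW hk)); lia.
apply: (wge_par (wgeM HF (inS_off j l sA' hS) hyl)) => z.
have := hm l (ltn_ord l); have := geq_minl (nth 0%N a' l) m.
by move: (c m l) (c' m l) (nth _ _ _) (nth _ _ _) hj; lia.
Qed.

Lemma level_all M : (forall m, (m <= M)%N -> forall i, (i < n)%N -> c m i = c' m i) ->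
  forall i j : 'I_n, wge (U i j) ((c M j)%:Z - (nth 0%N a i)%:Z).
Proof.
elim: M => [|m IH] hM i j.
  have [_ _ iU] := GLo_unit hU; apply: wge_le (iU i j) _; rewrite minn0; lia.
have hP := IH (fun m' h => hM m' (leqW h)).
have hm := hM m (leqnSn m); have hm1 := hM m.+1 (leqnn _) j (ltn_ord j).
case: (leqP (nth 0%N a' j) m) => hj; last first.
  apply: wge_le (level_step hm hP i hj) _; have := geq_minr (nth 0%N a j) m.+1; lia.
apply: wge_le (hP i j) _; move: (hm j (ltn_ord j)) hm1 hj.
by move: (nth 0%N a j) (nth 0%N a' j) (nth 0%N a i) => x y z; clia.
Qed.

(** If [a'] were larger, with first difference at p, then all entries of [U] in rows up to p and
    columns from p on would be divisible by 2. That block has p + 1 rows and n - p columns, too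
    large for a unit determinant. *)
Lemma GK_unique : size a = n -> sorted leq a -> lexle a a' ->
  a' = a /\ forall i j, wge (invmx U i j) ((nth 0%N a j)%:Z - (nth 0%N a i)%:Z).
Proof.
move=> sa so le; have [sa' so' _ _] := hS; have [uU dU iU] := GLo_unit hU.
have nthle (s : seq nat) i j : sorted leq s -> (i <= j)%N -> (j < size s)%N -> (nth 0%N s i <= nth 0%N s j)%N.
  move=> ss ij js; apply: (sorted_leq_nth leq_trans leqnn 0%N ss) => //.
  by rewrite inE (leq_ltn_trans ij).
case: (lexle_split _ le) => [|aa'|[p [pn h1 h2]]]; first by rewrite sa sa'.
  split=> //; pose M := \max_(x <- a) x.
  have hM i : (i < n)%N -> c M i = nth 0%N a i.
    move=> hi; apply/minn_idPl; apply: (@leq_bigmax_seq _ _ xpredT id) => //.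
    by rewrite mem_nth // sa.
  apply: (wge_inv uU dU) => i j; have := @level_all M _ i j.
  by rewrite hM //; apply => m _ k _; rewrite aa'.
exfalso; rewrite sa in pn.
have hH m : (m <= nth 0%N a p)%N -> forall i, (i < n)%N -> c m i = c' m i.
  move=> hm i hi; case: (ltnP i p) => ip; first by rewrite h1.
  have q1 := nthle _ _ _ so ip (_ : (i < size a)%N); have q2 := nthle _ _ _ so' ip (_ : (i < size a')%N).
  rewrite (minn_idPr _) ?(minn_idPr _) //.
    by apply: leq_trans (leq_trans hm (ltnW h2)) (q2 _); rewrite sa'.
  by apply: leq_trans hm (q1 _); rewrite sa.
have hP := level_all hH.
have hC := level_step (hH _ (leqnn _)) hP.
(* Weight 2 on the rows up to p and -2 on the columns before p make the bound positive exactly on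
   the block of even entries; the total is 2(p + 1) - 2p = 2. *)
have : wge (\det U) (\sum_(i < n) (if (i < p.+1)%N then 2 else 0 : int) + \sum_(j < n) (if (j < p)%N then -2 else 0 : int)).
  apply: wge_det => i j; case: ifP => ip; case: ltnP => jp; rewrite ?addr0 ?subrr ?add0r.
  - exact: iU.
  - have hj : (nth 0%N a p < nth 0%N a' j)%N.
      by apply: leq_trans h2 (nthle _ _ _ so' jp _); rewrite sa'.
    apply: (wge_par (hC i j hj)) => z; have := nthle _ _ _ so (ip : (i <= p)%N) (_ : (p < size a)%N).
    by rewrite sa => /(_ pn); move: (nth _ _ _) (nth _ _ _) => x y; lia.
  - by apply: wge_le (iU i j) _.
  - exact: iU.
case/wexP: dU => d0 vd /wgeP/(_ d0); rewrite vd.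
have e1 : \sum_(i < n) (if (i < p.+1)%N then 2 else 0 : int) = 2 * p.+1%:Z.
  rewrite -big_mkcond -(big_ord_widen n (fun=> 2 : int)) // sumr_const card_ord.
  by rewrite -[LHS]mulr_natr; congr (_ * _); rewrite natz.
have e2 : \sum_(j < n) (if (j < p)%N then -2 else 0 : int) = (-2) * p%:Z.
  rewrite -big_mkcond -(big_ord_widen n (fun=> -2 : int)) ?(ltnW pn) // sumr_const card_ord.
  by rewrite -[LHS]mulr_natr; congr (_ * _); rewrite natz.
by rewrite e1 e2; lia.
Qed.

End Step.

Lemma GK_eq n (A : 'M[F]_n) a : A^T = A -> inS v A a -> nonsing A a -> GK v A = a.
Proof.
move=> sA hA hN; have [sa so _ _] := hA.
have inA : inSU v A a.
  exists 1%:M; split; last by rewrite trmx1 mul1mx mulmx1.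
  apply/andP; split; last by rewrite det1 unit_wex (wex1 HF).
  apply/forallP => i; apply/forallP => j; rewrite integral_wge mxE.
  by case: (i == j); rewrite ?mulr1n ?mulr0n ?(wge0 v) ?(wge1 HF).
have mx a' : inSU v A a' -> lexle a' a.
  move=> [U [hU hS]]; have [//|/negPf h] := boolP (lexle a' a).
  have := lexle_total a' a; rewrite h /= => le.
  by have [e _] := GK_unique sA hN hU hS sa so le; move: h le; rewrite e => ->.
rewrite /GK; set P := (fun _ => _).
have Pa : P a by split.
have [hin hmax] := @classical_sets.xgetPex _ [::] P (ex_intro _ a Pa).
apply: lexle_anti; [by case: (hin) => U [_ [-> _ _ _]] | exact: mx | exact: hmax].
Qed.

End Uniqueness.

(** * Reduced systems at every level give trivial radicals *)

Section Nonsing.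

Variables (F : fieldType) (v : F -> int).
Hypothesis HF : unram2 v.
Notation wge := (wge v).
Notation wex := (wex v).
Variables (V : lmodType F) (bt : V -> V -> F).
Hypothesis HB : symbil bt.

Lemma lnk_unique ps i j l : uniq (flat ps) -> lnk ps i j -> lnk ps l j -> l = i.
Proof.
move=> u h1 h2.
have aux p q : p \in ps -> q \in ps -> j \in [:: p.1; p.2] -> j \in [:: q.1; q.2] -> p = q.
  by move=> pI qI; apply: (flat_inj u pI qI).
have mj1 (x : nat) : j \in [:: (x, j).1; (x, j).2] by rewrite !inE eqxx orbT.
have mj2 (x : nat) : j \in [:: (j, x).1; (j, x).2] by rewrite !inE eqxx.
have nj (x : nat) : (x, j) \in ps -> x != j by move=> /(pair_neq u).
case/orP: h1 => h1; case/orP: h2 => h2.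
- by have [->] := aux _ _ h2 h1 (mj1 _) (mj1 _).
- have [e1 e2] := aux _ _ h1 h2 (mj1 _) (mj2 _).
  by have := nj _ h1; rewrite e1 eqxx.
- have [e1 e2] := aux _ _ h2 h1 (mj1 _) (mj2 _).
  by have := nj _ h2; rewrite e1 eqxx.
- by have [->] := aux _ _ h2 h1 (mj2 _) (mj2 _).
Qed.

Variables (n : nat) (A : 'M[F]_n) (f : nat -> V) (a : nat -> nat).
Hypothesis AE : forall i j : 'I_n, A i j = bt (f i) (f j).
Hypothesis hb : bounded v bt f a (iota 0 n).
Hypothesis hR : forall m : nat, exists k ps ss,
  [/\ (k <= n)%N, forall i, (i < n)%N -> (i < k)%N = (a i <= m)%N,
      perm_eq (idx ps ss) (iota 0 k) & RS v bt f a ps ss].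

Let s := mkseq a n.
Let bs (x : 'cV[F]_n) : V := \sum_(i < n) x i 0 *: f i.

Lemma mbt_bs x y : mbt A x y = bt (bs x) (bs y).
Proof.
rewrite /mbt /bs (bt_sumr HB) mxE; apply: eq_bigr => j _.
rewrite (btZr HB) mulrC (bt_suml HB) mxE; congr (_ * _); apply: eq_bigr => i _.
by rewrite (btZl HB) mxE AE.
Qed.

Lemma nth_s (i : 'I_n) : nth 0%N s i = a i.
Proof. by rewrite nth_mkseq. Qed.

(** At level m only indices with [a i <= m] and the parity of m need an argument: the others gain a
    half-step from parity or from integrality of the coordinates. Members of a plane are handled by
    the bilinear condition, the one remaining single by the quadratic one. *)
Lemma nonsing_RS : nonsing v A s.
Proof.
move=> m x hx hQ hB; have [k [ps [ss [kn kE pk hRS]]]] := hR m.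
have u : uniq (flat ps) by have := rs_uniq hRS; rewrite cat_uniq => /and3P[].
have xm (i : 'I_n) : wge (x i 0) (m%:Z - (a i)%:Z) by have /andP[] := hx i; rewrite nth_s.
have x0 (i : 'I_n) : wge (x i 0) 0 by have /andP[] := hx i.
have inI (i : 'I_n) : (i : nat) \in iota 0 n by rewrite mem_iota ltn_ord.
have kI i : (i < k)%N = (i \in idx ps ss) by rewrite (perm_mem pk) mem_iota.
have paired (i : 'I_n) j : lnk ps i j -> ~~ odd (a i + m) -> wge (x i 0) (m.+1%:Z - (a i)%:Z).
  move=> hl par.
  have jI : j \in idx ps ss.
    by rewrite mem_cat; case/orP: hl => /mem_flat /andP[h1 h2]; rewrite ?h1 ?h2 orbT.
  have jk : (j < k)%N by rewrite kI.
  have jn : (j < n)%N := leq_trans jk kn.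
  have aj : (a j <= m)%N by rewrite -kE.
  have ik : (i < k)%N.
    by rewrite kI mem_cat; case/orP: hl => /mem_flat /andP[h1 h2]; rewrite ?h1 ?h2 orbT.
  have ex : wex (2 * bt (f i) (f j)) ((a i)%:Z + (a j)%:Z).
    by case/orP: hl => /(rs_pair hRS) //=; rewrite (btC HB) addrC.
  have [z zE] := wex_par ex.
  have [h hE] : exists h : nat, m = (a j + h.*2)%N.
    by exists ((m - a j)./2); move: par zE aj; move: (a i) (a j) => p q; clear; lia.
  (* The test vector is the partner [f j], scaled to lie in level m = [a j] + 2h; its product with
     [x] isolates coordinate i. *)
  pose y : 'cV[F]_n := \col_l (if (l == j :> nat) then 2 ^+ h else 0).
  have yL : Lev v s m y.
    move=> l; rewrite mxE nth_s; case: eqP => [->|_]; last by rewrite !(wge0 v).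
    by rewrite !(wex_wge (wex2X HF h)) //; move: hE; move: (a j) => p; clear; lia.
  have byE : bs y = 2 ^+ h *: f j.
    rewrite /bs (bigD1 (Ordinal jn)) //= mxE eqxx big1 ?addr0 // => l lj.
    by rewrite mxE (negPf (_ : (l != j :> nat))) ?scale0r.
  have := hB y yL; rewrite mbt_bs byE (btZr HB) /bs (bt_suml HB) (bigD1 i) //= !mulrDr.
  set T := _ * (_ * bt (x i 0 *: f i) (f j)); set S := _ * (_ * \sum_(_ < _ | _) _) => hTS.
  have hS : wge S (2 * m%:Z + 2).
    rewrite /S !mulr_sumr; apply: wge_sum => // l li.
    have -> : 2 * (2 ^+ h * bt (x l 0 *: f l) (f j)) = x l 0 * 2 ^+ h * (2 * bt (f l) (f j)).
      by rewrite (btZl HB); ring.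
    have [lj|lj] := eqVneq (l : nat) j.
      rewrite lj; apply: (wgeM_le HF (k := 2 * (m%:Z - (a j)%:Z)) (l := 2 * (a j)%:Z + 2)); last by clear; lia.
        apply: (wgeM_le HF (xm l) (wex_wge (wex2X HF h) (lexx _))).
        by rewrite lj; move: hE; move: (a j) => p; clear; lia.
      by apply: (wge_dbl HF (rs_diag hRS jI)).
    have [lk|lk] := ltnP l k.
      have hlj : wge (2 * bt (f l) (f j)) ((a l)%:Z + (a j)%:Z + 1).
        apply: (rs_off hRS) => //; first by rewrite -kI.
        apply/negP => /(lnk_unique u hl) /val_inj li'; by move: li; rewrite li' eqxx.
      have h1 := wgeM HF (wgeM HF (xm l) (wex_wge (wex2X HF h) (lexx _))) hlj.
      apply: (wge_par h1); move: hE; move: (a j) (a l) => p q; clear; lia.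
    have al : (m < a l)%N by rewrite ltnNge -kE // -leqNgt.
    have hlj : wge (2 * bt (f l) (f j)) ((a l)%:Z + (a j)%:Z).
      by apply: hb.2 => //; rewrite mem_iota jn.
    have h1 := wgeM HF (wgeM HF (x0 l) (wex_wge (wex2X HF h) (lexx _))) hlj.
    apply: (wge_par h1); move: hE al; move: (a j) (a l) => p q; clear; lia.
  have hT : wge T (2 * m%:Z + 2).
    by have -> : T = (T + S) - S by [ring]; apply: wgeB.
  have xE : x i 0 = T / (2 ^+ h * (2 * bt (f i) (f j))).
    have n0 := wex_neq0 (wexM HF (wex2X HF h) ex).
    rewrite /T (btZl HB); move: n0; move: (x i 0) (bt (f i) (f j)) (2 ^+ h) => xx b p n0.
    apply: (mulIf n0); rewrite divfK //; ring.
  rewrite xE; apply: (wge_Vexl HF hT (wexM HF (wex2X HF h) ex)).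
  by move: hE; move: (a j) (a i) => p q; clear; lia.
have nonsing_i (i : 'I_n) : ((i : nat) \notin ss) || odd (a i + m) -> wge (x i 0) (m.+1%:Z - (a i)%:Z).
  case: (boolP (odd (a i + m))) => [o _|/negP par].
    by apply: (wge_par (xm i)); move: o; move: (a i) => p; clear; lia.
  rewrite orbF => iss.
  have [ik|ik] := ltnP i k; last first.
    have al : (m < a i)%N by rewrite ltnNge -kE // -leqNgt.
    by apply: wge_le (x0 i) _; move: al; move: (a i) => p; clear; lia.
  move: ik; rewrite kI mem_cat (negPf iss) /= => /flat_pair[p pI ip].
  have [j hl] : exists j, lnk ps i j.
    move: ip; rewrite !inE => /orP[] /eqP->; [exists p.2 | exists p.1]; rewrite /lnk -surjective_pairing pI ?orbT //.
  by apply: paired hl _; apply/negP.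
move=> i; rewrite nth_s x0 andbT.
have [iss|iss] := boolP ((i : nat) \in ss); last by apply: nonsing_i; rewrite iss.
have [par|par] := boolP (odd (a i + m)); first by apply: nonsing_i; rewrite par orbT.
(* Singles have exponents of different parity, so no second single interferes at this level, and the
   value of [x] is dominated by the term of [f i]. *)
have others (l : 'I_n) : l != i -> wge (x l 0) (m.+1%:Z - (a l)%:Z).
  move=> li; apply: nonsing_i; case: (boolP ((l : nat) \in ss)) => //= lss.
  have := rs_par hRS lss iss (_ : (l != i :> nat)) => /(_ li).
  by move: par; move: (a i) (a l) => p q; clear; lia.
pose R := \sum_(l < n | l != i) x l 0 *: f l.
have bxE : bs x = x i 0 *: f i + R by rewrite /bs (bigD1 i).
have hR' : Lam v f a (iota 0 n) m.+1%:Z R.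
  apply: (big_ind (Lam v f a (iota 0 n) m.+1%:Z)).
  - exact: comb0.
  - by move=> *; apply: LamD.
  - by move=> l li; apply: Lam1 => //; apply: others.
have hi : Lam v f a (iota 0 n) m%:Z (x i 0 *: f i) by apply: Lam1.
move: hQ; rewrite mbt_bs bxE.
have -> : bt (x i 0 *: f i + R) (x i 0 *: f i + R) =
   x i 0 * x i 0 * bt (f i) (f i) + (2 * bt (x i 0 *: f i) R + bt R R).
  by rewrite !(btDl HB, btDr HB, btZl HB, btZr HB) [bt R (f i)](btC HB); ring.
set T := x i 0 * _ * _; set S := _ + bt R R => hTS.
have hS : wge S (2 * m%:Z + 2).
  apply: wgeD => //; last by apply: wge_le (Lam_Q HF HB hb hR') _; clear; lia.
  by apply: (wge_par (Lam_bt HF HB hb hi hR')); clear; lia.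
have hT : wge T (2 * m%:Z + 2) by have -> : T = (T + S) - S by [ring]; apply: wgeB.
have [xi0|xi0] := eqVneq (x i 0) 0; first by rewrite xi0 (wge0 v).
have /wexP[q0 vq] := rs_sing hRS iss.
move/wgeP: hT; rewrite /T !(mulf_neq0, xi0, q0) // => /(_ isT).
rewrite !(vM HF) ?mulf_neq0 // => hv; apply/wgeP => _.
by move: hv vq; move: (v _) (v _) (a i) => p q r; clear; lia.
Qed.

End Nonsing.

(** * Extending a reduced system by a vector *)

Definition upd (T : Type) (f : nat -> T) k x : nat -> T := fun l => if l == k then x else f l.

Lemma updE T (f : nat -> T) k x : upd f k x k = x.
Proof. by rewrite /upd eqxx. Qed.
Lemma updN T (f : nat -> T) k x l : l != k -> upd f k x l = f l.
Proof. by rewrite /upd => /negPf ->. Qed.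

Section Extend.

Variables (F : fieldType) (v : F -> int).
Hypothesis HF : unram2 v.
Notation wge := (wge v).
Notation wex := (wex v).
Variables (V : lmodType F) (bt : V -> V -> F).
Hypothesis HB : symbil bt.
Implicit Types (f g h : nat -> V) (a : nat -> nat) (ps : seq (nat * nat)) (ss I : seq nat).
Notation RS := (RS v bt).
Notation Lam := (Lam v).

Lemma RS_agree f f' a a' ps ss : RS f a ps ss -> {in idx ps ss, f =1 f'} ->
  {in idx ps ss, a =1 a'} -> RS f' a' ps ss.
Proof.
move=> h hf ha; have sp p : p \in ps -> p.1 \in idx ps ss /\ p.2 \in idx ps ss.
  by move=> /mem_flat /andP[h1 h2]; rewrite !mem_cat h1 h2 !orbT.
have sI i : i \in ss -> i \in idx ps ss by rewrite mem_cat => ->.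
split; first exact: rs_uniq h.
- by move=> i iI; rewrite -hf // -ha //; apply: (rs_diag h).
- by move=> p pI; have [p1 p2] := sp _ pI; rewrite -!hf // -!ha //; apply: (rs_pair h).
- by move=> i j iI jI ij hl; rewrite -!hf // -!ha //; apply: (rs_off h).
- by move=> i iI; rewrite -hf ?sI // -ha ?sI //; apply: (rs_sing h).
- by move=> i j iI jI ij; rewrite -!ha ?sI //; apply: (rs_par h).
Qed.

Lemma RS_perm f a ps ss ss' : perm_eq ss ss' -> RS f a ps ss -> RS f a ps ss'.
Proof.
move=> pp h; have pI : perm_eq (idx ps ss) (idx ps ss') by rewrite perm_cat2r.
have m := perm_mem pI; have ms := perm_mem pp.
split; first by rewrite -(perm_uniq pI); apply: rs_uniq h.
- by move=> i; rewrite -m; apply: (rs_diag h).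
- exact: rs_pair h.
- by move=> i j; rewrite -!m; apply: (rs_off h).
- by move=> i; rewrite -ms; apply: (rs_sing h).
- by move=> i j; rewrite -!ms; apply: (rs_par h).
Qed.

Lemma ext_single f a ps ss k x c : RS f a ps ss -> k \notin idx ps ss ->
  wex (bt x x) (2 * c%:Z) ->
  (forall l, l \in idx ps ss -> wge (2 * bt (f l) x) ((a l)%:Z + c%:Z + 1)) ->
  (forall l, l \in ss -> odd (a l + c)) ->
  RS (upd f k x) (upd a k c) ps (k :: ss).
Proof.
move=> h kI hx hl hp.
have h' : RS (upd f k x) (upd a k c) ps ss.
  by apply: (RS_agree h) => l lI; rewrite updN //; apply: contraNneq kI => <-.
have nk l : l \in idx ps ss -> l != k by move=> lI; apply: contraNneq kI => <-.
have hl' l : l \in idx ps ss -> wge (2 * bt (upd f k x l) (upd f k x k)) ((upd a k c l)%:Z + (upd a k c k)%:Z + 1).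
  by move=> lI; rewrite !updE !updN ?nk //; apply: hl.
have hp' l : l \in ss -> odd (upd a k c l + upd a k c k).
  by move=> lI; rewrite !updE !updN ?nk // ?hp // mem_cat lI.
split.
- by rewrite /= -/(idx _ _) kI; apply: rs_uniq h.
- move=> i; rewrite in_cons => /orP[/eqP->|]; last exact: (rs_diag h').
  by rewrite !updE; apply: wex_wge hx _.
- exact: rs_pair h'.
- move=> i j; rewrite !in_cons => /orP[/eqP->|iI] /orP[/eqP->|jI]; rewrite ?eqxx // => ij hlk.
  + by rewrite (btC HB) [(upd a k c k)%:Z + _]addrC; apply: hl'.
  + exact: hl'.
  + exact: (rs_off h').
- move=> i; rewrite in_cons => /orP[/eqP->|]; last exact: (rs_sing h').
  by rewrite !updE.
- move=> i j; rewrite !in_cons => /orP[/eqP->|iI] /orP[/eqP->|jI]; rewrite ?eqxx // => ij.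
  + by rewrite addnC; apply: hp'.
  + exact: hp'.
  + exact: (rs_par h').
Qed.

Lemma ext_pair f a ps ss ss' i k x c : RS f a ps ss -> perm_eq ss (i :: ss') ->
  k \notin idx ps ss -> wge (bt x x) (2 * c%:Z) ->
  wex (2 * bt (f i) x) ((a i)%:Z + c%:Z) ->
  (forall l, l \in idx ps ss -> l != i -> wge (2 * bt (f l) x) ((a l)%:Z + c%:Z + 1)) ->
  RS (upd f k x) (upd a k c) ((i, k) :: ps) ss'.
Proof.
move=> h pp kI hx hi hl.
have h' : RS (upd f k x) (upd a k c) ps ss.
  by apply: (RS_agree h) => l lI; rewrite updN //; apply: contraNneq kI => <-.
have nk l : l \in idx ps ss -> l != k by move=> lI; apply: contraNneq kI => <-.
have iss : i \in ss by rewrite (perm_mem pp) mem_head.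
have iI : i \in idx ps ss by rewrite mem_cat iss.
have hl' l : l \in idx ps ss -> l != i -> wge (2 * bt (upd f k x l) (upd f k x k)) ((upd a k c l)%:Z + (upd a k c k)%:Z + 1).
  by move=> lI li; rewrite !updE !updN ?nk //; apply: hl.
have pI : perm_eq (idx ((i, k) :: ps) ss') (k :: idx ps ss).
  rewrite /idx /= perm_sym -[k :: _]/([:: k] ++ ss ++ flat ps) perm_catCA /=.
  apply: (@perm_trans _ ((i :: ss') ++ k :: flat ps)); first by rewrite perm_cat2r.
  by rewrite -[i :: ss']/([:: i] ++ ss') -catA perm_catCA.
have m := perm_mem pI.
have ssub l : l \in ss' -> l \in ss by rewrite (perm_mem pp) inE => ->; rewrite orbT.
split.
- by rewrite (perm_uniq pI) /= kI; apply: rs_uniq h.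
- move=> l; rewrite m in_cons => /orP[/eqP->|]; last exact: (rs_diag h').
  by rewrite !updE.
- move=> p; rewrite in_cons => /orP[/eqP->|]; last exact: (rs_pair h').
  by rewrite /= !updE !updN ?nk.
- move=> l j; rewrite !m !in_cons => /orP[/eqP->|lI] /orP[/eqP->|jI]; rewrite ?eqxx // => lj hlk.
  + rewrite (btC HB) [(upd a k c k)%:Z + _]addrC; apply: hl' => //.
    by apply: contraNneq hlk => ->; rewrite /lnk mem_head orbT.
  + apply: hl' => //.
    by apply: contraNneq hlk => ->; rewrite /lnk mem_head.
  + apply: (rs_off h') => //.
    by apply: contra hlk; rewrite /lnk !in_cons => /orP[] ->; rewrite !orbT.
- by move=> l /ssub; apply: (rs_sing h').
- by move=> l j /ssub lI /ssub jI; apply: (rs_par h').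
Qed.

Lemma ext_pair2 f a ps ss k k' x x' c : RS f a ps ss -> k != k' ->
  k \notin idx ps ss -> k' \notin idx ps ss ->
  wge (bt x x) (2 * c%:Z) -> wge (bt x' x') (2 * c%:Z) ->
  wex (2 * bt x x') (c%:Z + c%:Z) ->
  (forall l, l \in idx ps ss -> wge (2 * bt (f l) x) ((a l)%:Z + c%:Z + 1)) ->
  (forall l, l \in idx ps ss -> wge (2 * bt (f l) x') ((a l)%:Z + c%:Z + 1)) ->
  RS (upd (upd f k x) k' x') (upd (upd a k c) k' c) ((k, k') :: ps) ss.
Proof.
move=> h kk kI kI' hx hx' he hl hl'.
set f' := upd _ _ _; set a' := upd _ _ _.
have nk l : l \in idx ps ss -> l != k by move=> lI; apply: contraNneq kI => <-.
have nk' l : l \in idx ps ss -> l != k' by move=> lI; apply: contraNneq kI' => <-.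
have fE l : l \in idx ps ss -> f' l = f l by move=> lI; rewrite /f' !updN ?nk ?nk'.
have aE l : l \in idx ps ss -> a' l = a l by move=> lI; rewrite /a' !updN ?nk ?nk'.
have h' : RS f' a' ps ss by apply: (RS_agree h) => l lI; rewrite ?fE ?aE.
have [fk fk'] : f' k = x /\ f' k' = x' by rewrite /f' updE updN // updE.
have [ak ak'] : a' k = c /\ a' k' = c by rewrite /a' updE updN // updE.
have pI : perm_eq (idx ((k, k') :: ps) ss) (k :: k' :: idx ps ss).
  by apply/permPl; apply: (perm_catCA ss [:: k; k'] (flat ps)).
have m := perm_mem pI.
have kk'' : k' != k by rewrite eq_sym.
split.
- by rewrite (perm_uniq pI) /= inE negb_or kk kI kI'; apply: rs_uniq h.
- move=> l; rewrite m !in_cons => /or3P[/eqP->|/eqP->|]; last exact: (rs_diag h').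
    by rewrite fk ak.
  by rewrite fk' ak'.
- move=> p; rewrite in_cons => /orP[/eqP->|]; last exact: (rs_pair h').
  by rewrite /= fk fk' ak ak'.
- have lk : lnk ((k, k') :: ps) k k' by rewrite /lnk mem_head.
  have lk' : lnk ((k, k') :: ps) k' k by rewrite /lnk mem_head orbT.
  move=> l j; rewrite !m !in_cons => /or3P[/eqP->|/eqP->|lI] /or3P[/eqP->|/eqP->|jI];
    rewrite ?eqxx ?lk ?lk' // => lj hlk.
  + by rewrite fk ak fE // aE // (btC HB) [c%:Z + _]addrC; apply: hl.
  + by rewrite fk' ak' fE // aE // (btC HB) [c%:Z + _]addrC; apply: hl'.
  + by rewrite fk ak fE // aE //; apply: hl.
  + by rewrite fk' ak' fE // aE //; apply: hl'.
  + apply: (rs_off h') => //.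
    by apply: contra hlk; rewrite /lnk !in_cons => /orP[] ->; rewrite !orbT.
- exact: rs_sing h'.
- exact: rs_par h'.
Qed.

(** [r i] is the single [f i] made orthogonal to all planes without changing its graded class, so
    that adding multiples of it to a new vector creates no products with planes. *)
Lemma rho_ex f a ps ss : RS f a ps ss -> exists r : nat -> V,
  [/\ forall i, i \in ss -> Lam f a (idx ps ss) (a i)%:Z (r i),
      forall i l, i \in ss -> l \in flat ps -> bt (f l) (r i) = 0,
      forall i j, i \in ss -> j \in ss -> bt (f j) (r i) = bt (r j) (r i),
      forall i, i \in ss -> wex (bt (r i) (r i)) (2 * (a i)%:Z) &
      forall i j, i \in ss -> j \in ss -> i != j -> wge (2 * bt (r i) (r j)) ((a i)%:Z + (a j)%:Z + 1)].
Proof.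
move=> h; have [r [rl [ro rp]]] := clear_pairs HF HB h; exists r.
have sI i : i \in ss -> i \in idx ps ss by rewrite mem_cat => ->.
have sf : {subset flat ps <= idx ps ss} by move=> l lf; rewrite mem_cat lf orbT.
have nss l : l \in ss -> l \notin flat ps.
  by move=> lss; have := rs_uniq h; rewrite cat_uniq => /and3P[_ /hasPn hh _]; apply/negP => /hh; rewrite /= lss.
have o1 i l : i \in ss -> l \in flat ps -> bt (f l) (r i) = 0.
  move=> iss; apply: rp => m mf; apply: (ro _ _ (sf _ mf) (sI _ iss)).
  - by apply: contraTneq mf => ->; apply: nss.
  - by apply/negP => /orP[] /mem_flat /andP[] /=; rewrite (negPf (nss _ iss)).
  - by apply/negP => /andP[/nss]; rewrite mf.
have cl i : i \in idx ps ss -> Lam f a (idx ps ss) ((a i)%:Z + 1) (r i - f i).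
  by move=> iI; apply: Lam_le (rl i iI) sf (lexx _).
have [c1 c2] := Lam_cong HF HB (RS_bounded HF HB h) cl.
have hr := RS_cong HF h c1 c2.
split=> //.
- move=> i iss; rewrite -[r i](subrK (f i)); apply: LamD; last by apply: (Lam_f HF); apply: sI.
  by apply: (Lam_le HF (rl _ (sI _ iss)) sf); clear; lia.
- move=> i j iss jss; apply/eqP; rewrite -subr_eq0 -(btBl HB) -opprB (btNl HB) oppr_eq0; apply/eqP.
  by apply: (comb_orth HB (rl _ (sI _ jss))) => m mf; apply: o1.
- exact: rs_sing hr.
- move=> i j iss jss ij; apply: (rs_off hr (sI _ iss) (sI _ jss)) => //.
  by apply/negP => /orP[] /mem_flat /andP[] /=; rewrite (negPf (nss _ iss)).
Qed.

(* The residue field is perfect, so the leading term of [al] is minus a square times that of [be]. *)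
Lemma adjust (al be : F) (A B h : int) : wge al (2 * A) -> wex be (2 * B) -> A - B = 2 * h ->
  exists s, [/\ wge s (A - B), wge (al + s ^+ 2 * be) (2 * A + 2) & wex al (2 * A) -> wex s (A - B)].
Proof.
move=> ha hb hE; have [t t0 vt] := ex_val HF h; have b0 := wex_neq0 hb.
have ht : wex t (A - B) by apply/wexP; rewrite t0 vt hE.
have hbt := wexM HF hb (wexX HF 2 ht).
have hr : wge (- (al / (be * t ^+ 2))) 0.
  by rewrite (wgeN HF); apply: (wge_Vexl HF ha hbt); clear; lia.
have [s0 hs0 hs] := sqrt_mod2 HF hr.
exists (s0 * t); split.
- by apply: (wgeM_le HF hs0 (wex_wge ht (lexx _))); clear; lia.
- have -> : al + (s0 * t) ^+ 2 * be = (s0 ^+ 2 - - (al / (be * t ^+ 2))) * (be * t ^+ 2).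
    by field; repeat (apply/andP; split).
  by apply: (wgeM_le HF hs (wex_wge hbt (lexx _))); clear; lia.
move=> xa; suff xs0 : wex s0 0 by apply: (wexE (wexM HF xs0 ht)) => //; clear; lia.
have : wex (s0 ^+ 2) 0.
  have -> : s0 ^+ 2 = - (al / (be * t ^+ 2)) + (s0 ^+ 2 - - (al / (be * t ^+ 2))) by ring.
  apply: (wexD HF); last by apply: wge_le hs _.
  by rewrite (wexN HF); apply: (wexE (wexM HF xa (wexV HF hbt))) => //; clear; lia.
case/wexP => n0 v0; have s00 : s0 != 0 by apply: contraNneq n0 => ->; rewrite expr0n.
by apply/wexP; split=> //; move: v0; rewrite (vX HF) //; clear; lia.
Qed.

Section NewVector.

Variables (f : nat -> V) (a : nat -> nat) (ps : seq (nat * nat)) (ss : seq nat) (k K : nat).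
Hypothesis hR : RS f a ps ss.
Hypothesis kI : k \notin idx ps ss.
Hypothesis k1I : k.+1 \notin idx ps ss.
Variable e : V.
Hypothesis eo : forall l, l \in idx ps ss -> bt (f l) e = 0.
Hypothesis eK : wex (bt e e) (2 * K%:Z).

Notation LamK := (Lam f a (idx ps ss) K%:Z).

(** A second new vector of the same scale, coming from the same block of degree 2 or from the next
    block. *)
Definition twin e' := [/\ forall l, l \in idx ps ss -> bt (f l) e' = 0, bt e e' = 0 &
  wex (bt e' e') (2 * K%:Z)].

Lemma new_single : (forall l, l \in ss -> odd (a l + K)) ->
  RS (upd f k e) (upd a k K) ps (k :: ss).
Proof.
by move=> hp; apply: ext_single => // l lI; rewrite eo // mulr0 (wge0 v).
Qed.

Lemma Lam_orth t x z : (forall l, l \in idx ps ss -> bt (f l) z = 0) ->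
  Lam f a (idx ps ss) t x -> bt x z = 0.
Proof. by move=> hz hx; apply: (comb_orth HB hx). Qed.

(** A multiple of [r i] cancels the leading term of the value of [e] and makes the doubled valuation
    of 2 times the product with [f i] exactly [a i + K + 2]. If the value gains two orders, this is
    a plane of exponents [a i] and K + 2; if it gains one, the new vector is a single of the other
    parity. *)
Lemma new_odd i : ss = [:: i] -> ~~ odd (a i + K) ->
  exists2 y, LamK y &
   RS (upd f k (e + y)) (upd a k K.+2) ((i, k) :: ps) [::] \/
   RS (upd f k (e + y)) (upd a k K.+1) ps [:: k; i].
Proof.
move=> ssE par; have iss : i \in ss by rewrite ssE mem_head.
have [r [rL ro rb rx _]] := rho_ex hR; have ri := rx _ iss.
have [h hE] : exists h : int, K%:Z - (a i)%:Z = 2 * h.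
  by exists ((K%:Z - (a i)%:Z) %/ 2)%Z; move: par; move: (a i) => p; clear; lia.
have [s [sK sq sx]] := adjust (wex_wge eK (lexx _)) ri hE; have {}sx := sx eK.
have yL : LamK (s *: r i) by apply: (LamZ HF (rL _ iss) sK); clear; lia.
have er : bt e (r i) = 0 by rewrite (btC HB); apply: Lam_orth (rL _ iss).
exists (s *: r i) => //.
have qE : bt (e + s *: r i) (e + s *: r i) = bt e e + s ^+ 2 * bt (r i) (r i).
  by rewrite !(btDl HB, btDr HB, btZl HB, btZr HB) [bt (r i) e](btC HB) er; ring.
have li l : l \in idx ps ss -> l != i -> bt (f l) (e + s *: r i) = 0.
  move=> lI ln; rewrite (btDr HB) (btZr HB) eo // add0r ro ?mulr0 //.
  by move: lI; rewrite mem_cat ssE inE (negPf ln).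
have xi : wex (2 * bt (f i) (e + s *: r i)) (K%:Z + (a i)%:Z + 2).
  rewrite (btDr HB) (btZr HB) eo ?mem_cat ?iss // add0r (rb _ _ iss iss).
  by apply: (wexE (wexM HF (wex2 HF) (wexM HF sx ri))) => //; clear; lia.
have [hq|hq] := boolP (wge (bt (e + s *: r i) (e + s *: r i)) (2 * K.+2%:Z)).
  left; apply: (ext_pair (ss := ss)) => //; first by rewrite ssE.
    by apply: (wexE xi) => //; clear; lia.
  by move=> l lI ln; rewrite li // mulr0 (wge0 v).
right; rewrite -ssE; apply: ext_single => //.
- apply: wge_wex; first by rewrite qE; apply: wge_le sq _; clear; lia.
  by apply: contra hq => hq; apply: wge_le hq _; clear; lia.
- move=> l lI; have [->|ln] := eqVneq l i; last by rewrite li // mulr0 (wge0 v).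
  by apply: wex_wge xi _; clear; lia.
by move=> l; rewrite ssE inE => /eqP->; move: par; move: (a i) => p; clear; lia.
Qed.

(** Both vectors are corrected by the same [r i]; their product becomes s s' times the value of
    [r i], of valuation exactly K, so together they form a plane with exponents K + 1. *)
Lemma new_pair e' i (r : nat -> V) : twin e' -> i \in ss -> ~~ odd (a i + K) ->
  Lam f a (idx ps ss) (a i)%:Z (r i) ->
  (forall l, l \in flat ps -> bt (f l) (r i) = 0) ->
  bt (f i) (r i) = bt (r i) (r i) -> wex (bt (r i) (r i)) (2 * (a i)%:Z) ->
  (forall j, j \in ss -> j != i -> wge (2 * bt (f j) (r i)) ((a i)%:Z + (a j)%:Z + 3)) ->
  exists y y', [/\ LamK y, LamK y' &
   RS (upd (upd f k (e + y)) k.+1 (e' + y')) (upd (upd a k K.+1) k.+1 K.+1) ((k, k.+1) :: ps) ss].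
Proof.
move=> [eo' ee' eK'] iss par rL ro rb ri rj.
have [h hE] : exists h : int, K%:Z - (a i)%:Z = 2 * h.
  by exists ((K%:Z - (a i)%:Z) %/ 2)%Z; move: par; move: (a i) => p; clear; lia.
have [s [sK sq sx]] := adjust (wex_wge eK (lexx _)) ri hE; have {}sx := sx eK.
have [s' [sK' sq' sx']] := adjust (wex_wge eK' (lexx _)) ri hE; have {}sx' := sx' eK'.
have er : bt e (r i) = 0 by rewrite (btC HB); apply: Lam_orth rL.
have er' : bt e' (r i) = 0 by rewrite (btC HB); apply: Lam_orth rL.
exists (s *: r i), (s' *: r i); split.
- by apply: (LamZ HF rL sK); clear; lia.
- by apply: (LamZ HF rL sK'); clear; lia.
have lb (z : V) (t : F) : (forall l, l \in idx ps ss -> bt (f l) z = 0) -> wex t (K%:Z - (a i)%:Z) ->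
    forall l, l \in idx ps ss -> wge (2 * bt (f l) (z + t *: r i)) ((a l)%:Z + K.+1%:Z + 1).
  move=> hz ht l lI; rewrite (btDr HB) (btZr HB) hz // add0r mulrCA.
  move: (lI); rewrite mem_cat => /orP[lss|lf]; last by rewrite ro // !mulr0 (wge0 v).
  have [->|ln] := eqVneq l i.
    rewrite rb; apply: (wgeM_le HF (wex_wge ht (lexx _)) (wex_wge (wexM HF (wex2 HF) ri) (lexx _))).
    by clear; lia.
  by apply: (wgeM_le HF (wex_wge ht (lexx _)) (rj _ lss ln)); clear; lia.
apply: ext_pair2 => //.
- by rewrite neq_ltn ltnSn.
- have -> : bt (e + s *: r i) (e + s *: r i) = bt e e + s ^+ 2 * bt (r i) (r i).
    by rewrite !(btDl HB, btDr HB, btZl HB, btZr HB) [bt (r i) e](btC HB) er; ring.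
  by apply: wge_le sq _; clear; lia.
- have -> : bt (e' + s' *: r i) (e' + s' *: r i) = bt e' e' + s' ^+ 2 * bt (r i) (r i).
    by rewrite !(btDl HB, btDr HB, btZl HB, btZr HB) [bt (r i) e'](btC HB) er'; ring.
  by apply: wge_le sq' _; clear; lia.
- have -> : 2 * bt (e + s *: r i) (e' + s' *: r i) = 2 * (s * s' * bt (r i) (r i)).
    by rewrite !(btDl HB, btDr HB, btZl HB, btZr HB) [bt (r i) e'](btC HB) er er' ee'; ring.
  by apply: (wexE (wexM HF (wex2 HF) (wexM HF (wexM HF sx sx') ri))) => //; clear; lia.
- exact: lb.
- exact: lb.
Qed.

Lemma new_odd_two e' i : twin e' -> ss = [:: i] -> ~~ odd (a i + K) ->
  exists y y', [/\ LamK y, LamK y' &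
   RS (upd (upd f k (e + y)) k.+1 (e' + y')) (upd (upd a k K.+1) k.+1 K.+1) ((k, k.+1) :: ps) [:: i]].
Proof.
move=> tw ssE par; have iss : i \in ss by rewrite ssE mem_head.
have [r [rL ro rb rx _]] := rho_ex hR.
have [|||y [y' h]] := new_pair tw iss par (rL _ iss) _ _ (rx _ iss).
- by move=> l; apply: ro.
- exact: rb.
- by move=> j; rewrite ssE inE => ->.
by exists y, y'; rewrite -ssE.
Qed.

(** Here i is the single with the parity of K. After the correction by [r i] all depends on the
    product of the two singles: if it is as large as allowed, the new vector pairs with j at
    exponent K + 1. If not, a second correction by [r j] gives a plane with i at exponent K + 2, and
    a twin may be used instead to form a plane at K + 1. *)
Lemma new_even i j : ss = [:: i; j] -> ~~ odd (a i + K) ->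
  (exists2 y, LamK y & RS (upd f k (e + y)) (upd a k K.+1) ((j, k) :: ps) [:: i]) \/
  ((exists2 y, LamK y & RS (upd f k (e + y)) (upd a k K.+2) ((i, k) :: ps) [:: j]) /\
   (forall e', twin e' -> exists y y', [/\ LamK y, LamK y' &
   RS (upd (upd f k (e + y)) k.+1 (e' + y')) (upd (upd a k K.+1) k.+1 K.+1) ((k, k.+1) :: ps) [:: i; j]])).
Proof.
move=> ssE par.
have iss : i \in ss by rewrite ssE mem_head.
have jss : j \in ss by rewrite ssE !inE eqxx orbT.
have ij : i != j by have := rs_uniq hR; rewrite ssE /= inE negb_or => /andP[/andP[]].
have parj := rs_par hR iss jss ij.
have [r [rL ro rb rx rr]] := rho_ex hR; have ri := rx _ iss; have rj := rx _ jss.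
have rij := rr _ _ iss jss ij.
have [h hE] : exists h : int, K%:Z - (a i)%:Z = 2 * h.
  by exists ((K%:Z - (a i)%:Z) %/ 2)%Z; move: par; move: (a i) => p; clear; lia.
have [s [sK sq sx]] := adjust (wex_wge eK (lexx _)) ri hE; have {}sx := sx eK.
have er l : l \in ss -> bt e (r l) = 0 by move=> lss; rewrite (btC HB); apply: Lam_orth (rL _ lss).
have qE : bt (e + s *: r i) (e + s *: r i) = bt e e + s ^+ 2 * bt (r i) (r i).
  by rewrite !(btDl HB, btDr HB, btZl HB, btZr HB) [bt (r i) e](btC HB) er //; ring.
have yL : LamK (s *: r i) by apply: (LamZ HF (rL _ iss) sK); clear; lia.
have cases l : l \in idx ps ss -> [\/ l = i, l = j | l \in flat ps].
  by rewrite mem_cat ssE !inE -orbA => /or3P[/eqP|/eqP|]; [apply: Or31|apply: Or32|apply: Or33].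
have fi : 2 * bt (f i) (s *: r i) = s * (2 * bt (r i) (r i)).
  by rewrite (btZr HB) (rb _ _ iss iss); ring.
have fj : 2 * bt (f j) (s *: r i) = s * (2 * bt (r i) (r j)).
  by rewrite (btZr HB) (rb _ _ iss jss) [bt (r j) _](btC HB); ring.
have xfi : wex (2 * bt (f i) (s *: r i)) (K%:Z + (a i)%:Z + 2).
  rewrite fi; apply: (wexE (wexM HF sx (wexM HF (wex2 HF) ri))) => //; clear; lia.
have [h3|h3] := boolP (wge (2 * bt (r i) (r j)) ((a i)%:Z + (a j)%:Z + 3)); last first.
  left; exists (s *: r i) => //.
  have [z zE] : exists z : int, (a i)%:Z + (a j)%:Z + 1 = 2 * z.
    by exists (((a i)%:Z + (a j)%:Z + 1) %/ 2)%Z; move: parj; move: (a i) (a j) => p q; clear; lia.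
  have xij : wex (2 * bt (r i) (r j)) ((a i)%:Z + (a j)%:Z + 1).
    rewrite zE; apply: wge_wex; first by rewrite -zE.
    by apply: contra h3 => h3; apply: wge_le h3 _; move: zE; clear; lia.
  apply: (ext_pair (ss := ss)) => //.
  - by rewrite ssE -[[:: i; j]]/([:: i] ++ [:: j]) perm_catC.
  - by rewrite qE; apply: wge_le sq _; clear; lia.
  - rewrite (btDr HB) eo ?mem_cat ?jss // add0r fj.
    by apply: (wexE (wexM HF sx xij)) => //; clear; lia.
  move=> l lI lj; rewrite (btDr HB) eo // add0r; case: (cases _ lI) => [->|le|lf].
  - by apply: wex_wge xfi _; clear; lia.
  - by rewrite le eqxx in lj.
  by rewrite (btZr HB) ro // !mulr0 (wge0 v).
right; split; last first.
  move=> e' tw; have [|||y [y' hh]] := new_pair tw iss par (rL _ iss) _ _ (rx _ iss).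
  - by move=> l; apply: ro.
  - exact: rb.
  - move=> l; rewrite ssE !inE => /orP[->//|/eqP-> _].
    by rewrite (rb _ _ iss jss) (btC HB).
  by exists y, y'; rewrite -ssE.
have [h' hE'] : exists h : int, (K%:Z + 1) - (a j)%:Z = 2 * h.
  exists ((K%:Z + 1 - (a j)%:Z) %/ 2)%Z; move: par parj; move: (a i) (a j) => p q; clear; lia.
(* The value now has order at least K + 1, which has the parity of [a j], so [r j] can cancel the
   next term. *)
have [|s' [sK' sq' _]] := @adjust (bt (e + s *: r i) (e + s *: r i)) _ (K%:Z + 1) _ _ _ rj hE'.
  by rewrite qE; apply: wge_le sq _; clear; lia.
have yL' : LamK (s' *: r j) by apply: (LamZ HF (rL _ jss) sK'); clear; lia.
exists (s *: r i + s' *: r j); first exact: LamD.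
have fi' : 2 * bt (f i) (s' *: r j) = s' * (2 * bt (r i) (r j)).
  by rewrite (btZr HB) (rb _ _ jss iss); ring.
have fj' : 2 * bt (f j) (s' *: r j) = s' * (2 * bt (r j) (r j)).
  by rewrite (btZr HB) (rb _ _ jss jss); ring.
apply: (ext_pair (ss := ss)) => //.
- by rewrite ssE.
- have -> : bt (e + (s *: r i + s' *: r j)) (e + (s *: r i + s' *: r j)) =
     (bt (e + s *: r i) (e + s *: r i) + s' ^+ 2 * bt (r j) (r j)) + s * s' * (2 * bt (r i) (r j)).
    rewrite qE !(btDl HB, btDr HB, btZl HB, btZr HB) [bt (r i) e](btC HB) [bt (r j) e](btC HB).
    by rewrite [bt (r j) (r i)](btC HB) !er //; ring.
  apply: wgeD => //; first by apply: wge_le sq' _; clear; lia.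
  by apply: (wgeM_le HF (wgeM HF sK sK') h3); clear; lia.
- rewrite !(btDr HB) eo ?mem_cat ?iss // add0r mulrDr.
  apply: (wexE (k := K%:Z + (a i)%:Z + 2) _ erefl); last by clear; lia.
  apply: (wexD HF xfi); rewrite fi'; apply: (wgeM_le HF sK' h3); clear; lia.
move=> l lI li; rewrite !(btDr HB) eo // add0r mulrDr; case: (cases _ lI) => [le|->|lf].
- by rewrite le eqxx in li.
- apply: wgeD => //.
    rewrite fj; apply: (wgeM_le HF sK h3); clear; lia.
  rewrite fj'; apply: (wgeM_le HF sK' (wex_wge (wexM HF (wex2 HF) rj) (lexx _))); clear; lia.
by rewrite !(btZr HB) !ro // !mulr0 addr0 (wge0 v).
Qed.

End NewVector.

End Extend.

(** * Pre-optimal forms *)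

Section Blocks.

Variable F : fieldType.
Implicit Types (b : blk F) (s : seq (nat * blk F)).

Lemma degs_cat s1 s2 : degs (s1 ++ s2) = (degs s1 + degs s2)%N.
Proof. by rewrite /degs map_cat sumn_cat. Qed.

Lemma blk_entryC b i j : blk_entry b i j = blk_entry b j i.
Proof.
case: b => [s|x y z] /=; first by rewrite eq_sym; case: eqP => // ->.
by rewrite [(j == 0%N) && _]andbC [(j == 1%N) && (i == 1%N)]andbC orbC [(j == 0%N) && _]andbC
  [(j == 1%N) && _]andbC.
Qed.

Lemma entC s i j : ent s i j = ent s j i.
Proof.
elim: s i j => [|[k b] s IH] i j //=.
rewrite [(j < _)%N && _]andbC [(_ <= j)%N && _]andbC blk_entryC IH.
by [].
Qed.

Lemma ent_catl s1 s2 i j : (i < degs s1)%N -> (j < degs s1)%N -> ent (s1 ++ s2) i j = ent s1 i j.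
Proof.
elim: s1 i j => [|[k b] s1 IH] i j //=; rewrite /degs /= -/(degs s1) => hi hj.
case: ifP => // _; case: ifP => // /andP[h1 h2]; apply: IH; lia.
Qed.

Lemma ent_catr s1 s2 i j : ent (s1 ++ s2) (degs s1 + i) (degs s1 + j) = ent s2 i j.
Proof.
elim: s1 i j => [|[k b] s1 IH] i j //=; rewrite /degs /= -/(degs s1) => //.
have -> : (deg b + degs s1 + i < deg b)%N = false by lia.
have -> : (deg b <= deg b + degs s1 + i)%N by lia.
have -> : (deg b <= deg b + degs s1 + j)%N by lia.
by rewrite /= -!addnA !addKn.
Qed.

Lemma ent_cat0 s1 s2 i j : (i < degs s1)%N -> (degs s1 <= j)%N -> ent (s1 ++ s2) i j = 0.
Proof.
elim: s1 i j => [|[k b] s1 IH] i j //=; rewrite /degs /= -/(degs s1) => hi hj.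
have -> : (j < deg b)%N = false by lia.
rewrite andbF; case: ifP => // /andP[h1 h2]; apply: IH; lia.
Qed.

Variable bl : seq (nat * blk F).
Let d0 : nat * blk F := (0%N, BD [::]).
Notation off t := (degs (take t bl)).

Lemma offS t : (t < size bl)%N -> off t.+1 = (off t + deg (Cb bl t.+1))%N.
Proof.
by move=> ht; rewrite (take_nth d0 ht) -cats1 degs_cat /= /degs /= addn0.
Qed.

Lemma off_le t t' : (t <= t')%N -> (off t <= off t')%N.
Proof.
move=> tt; rewrite -(cat_take_drop t (take t' bl)) take_takel // degs_cat; lia.
Qed.

Lemma off_le_n t : (off t <= degs bl)%N.
Proof. by rewrite -{2}(cat_take_drop t bl) degs_cat leq_addr. Qed.

Lemma ent_take t i j : (i < off t)%N -> (j < off t)%N -> ent (take t bl) i j = ent bl i j.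
Proof. by move=> hi hj; rewrite -{2}(cat_take_drop t bl) ent_catl. Qed.

Lemma ent_off0 t i j : (i < off t)%N -> (off t <= j)%N -> ent bl i j = 0.
Proof. by move=> hi hj; rewrite -(cat_take_drop t bl) ent_cat0. Qed.

Lemma ent_blk t x y : (t < size bl)%N -> (x < deg (Cb bl t.+1))%N -> (y < deg (Cb bl t.+1))%N ->
  ent bl (off t + x) (off t + y) = 2 ^+ (kb bl t.+1) * blk_entry (Cb bl t.+1) x y.
Proof.
move=> ht; rewrite /Cb /kb /= -/d0 => hx hy.
rewrite -{1}(cat_take_drop t bl) ent_catr (drop_nth d0 ht).
by case: (nth d0 bl t) hx hy => k b /= -> ->.
Qed.

(** Standard basis vectors indexed by natural numbers, zero beyond the range, so that no ordinal
    casts occur when the basis is extended. *)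
Definition ebas (n j : nat) : 'cV[F]_n := \col_i (i == j :> nat)%:R.

Notation n := (degs bl).
Notation e := (ebas n).
Notation bt := (mbt (assemble bl)).

Lemma assemble_sym : (assemble bl)^T = assemble bl.
Proof. by apply/matrixP => i j; rewrite !mxE entC. Qed.

Lemma bt_symbil : symbil bt. Proof. exact: mbt_symbil assemble_sym. Qed.

Lemma mbt_ebas m (M : 'M[F]_m) (i j : 'I_m) : mbt M (ebas m i) (ebas m j) = M i j.
Proof.
have eE (l : 'I_m) : ebas m l = col l 1%:M by apply/colP => x; rewrite !mxE.
by rewrite !eE mbt_col trmx1 mul1mx mulmx1.
Qed.

Lemma bt_e i j : (i < n)%N -> (j < n)%N -> bt (e i) (e j) = ent bl i j.
Proof. by move=> hi hj; have := mbt_ebas (assemble bl) (Ordinal hi) (Ordinal hj); rewrite mxE. Qed.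

Lemma bt_e_off0 t i j : (i < off t)%N -> (off t <= j)%N -> bt (e i) (e j) = 0.
Proof.
move=> hi hj; have [hn|hn] := ltnP j n.
  by rewrite bt_e ?(ent_off0 hi hj) // (leq_trans hi) ?off_le_n.
have -> : e j = 0 by apply/colP => x; rewrite !mxE (ltn_eqF (leq_trans (ltn_ord x) hn)).
exact: (bt0r bt_symbil).
Qed.

Lemma Bpre_gram t : Bpre bl t = gram bt e (off t).
Proof.
apply/matrixP => i j; rewrite !mxE ent_take // bt_e //.
  exact: leq_trans (ltn_ord i) (off_le_n t).
exact: leq_trans (ltn_ord j) (off_le_n t).
Qed.

Lemma det_gram_last (V : lmodType F) (b : V -> V -> F) (f : nat -> V) k : symbil b ->
  (forall l, (l < k)%N -> b (f l) (f k) = 0) ->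
  \det (gram b f k.+1) = b (f k) (f k) * \det (gram b f k).
Proof.
move=> HB h; rewrite (expand_det_row _ ord_max) (bigD1 ord_max) //= big1 ?addr0 => [|j jm].
  rewrite mxE /cofactor /= addnn -signr_odd odd_double expr0 mul1r; congr (_ * \det _).
  by apply/matrixP => i j; rewrite !mxE !lift_max.
rewrite mxE (btC HB) h ?mul0r //.
by have := ltn_ord j; rewrite ltnS leq_eqVlt => /orP[/eqP jk|//]; move/eqP: jm; case; apply: val_inj.
Qed.

End Blocks.

(** * Stages of the block-by-block construction *)

Section Stages.

Variables (F : fieldType) (v : F -> int).
Hypothesis HF : unram2 v.
Notation wge := (wge v).
Variable bl : seq (nat * blk F).
Notation off t := (degs (take t bl)).
Notation n := (degs bl).
Notation e := (ebas F n).
Notation bt := (mbt (assemble bl)).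
Notation RS := (RS v bt).
Let HB := bt_symbil bl.

Notation icomb I := (comb e I (fun _ c => wge c 0)).

(** A matching of the first [c] indices alone, which form whole blocks. It can differ from the
    restriction of a later matching, as a single may be paired with a vector beyond [c]. *)
Definition history (f : nat -> 'cV[F]_n) (a : nat -> nat) c := exists t ps ss,
  [/\ (t <= size bl)%N, off t = c, perm_eq (idx ps ss) (iota 0 c) & RS f a ps ss].

Record Stage (t : nat) (f : nat -> 'cV[F]_n) (a : nat -> nat) ps ss : Prop := {
  st_perm : perm_eq (idx ps ss) (iota 0 (off t));
  st_RS : RS f a ps ss;
  st_tri : forall l, (l < off t)%N -> icomb (iota 0 l) (f l - e l);
  st_mono : forall i j, (i <= j)%N -> (j < off t)%N -> (a i <= a j)%N;
  st_hist : forall c, (c.+1 < off t)%N -> (a c < a c.+1)%N -> history f a c.+1 }.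

Lemma icomb_sub i j x : (i <= j)%N -> icomb (iota 0 i) x -> icomb (iota 0 j) x.
Proof.
by move=> ij h; apply: comb_sub h _ _ => // m; rewrite !mem_iota /= => h; apply: leq_trans h ij.
Qed.

Lemma icomb_e l k : (l < k)%N -> icomb (iota 0 k) (e l).
Proof.
by move=> lk; rewrite -[e l]scale1r; apply: comb1; rewrite ?mem_iota //; apply: (wge1 HF).
Qed.

Lemma icomb_scale k c x : wge c 0 -> icomb (iota 0 k) x -> icomb (iota 0 k) (c *: x).
Proof. by move=> hc h; apply: comb_scale h _ => m d hd; apply: (wgeM_le HF hc hd). Qed.

Lemma tri_icomb k (f : nat -> 'cV[F]_n) l : (forall l, (l < k)%N -> icomb (iota 0 l) (f l - e l)) ->
  (l < k)%N -> icomb (iota 0 k) (f l).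
Proof.
move=> h lk; rewrite -[f l](subrK (e l)); apply: combD; last exact: icomb_e.
by apply: icomb_sub (h _ lk); apply: ltnW.
Qed.

(** Exponents up to K + 1 are harmless: the coefficients then have doubled valuation at least -1,
    hence are integral. *)
Lemma Lam_icomb k (f : nat -> 'cV[F]_n) a K ps ss y :
  (forall l, (l < k)%N -> icomb (iota 0 l) (f l - e l)) ->
  perm_eq (idx ps ss) (iota 0 k) -> (forall l, (l < k)%N -> (a l <= K.+1)%N) ->
  Lam v f a (idx ps ss) K%:Z y -> icomb (iota 0 k) y.
Proof.
move=> tri pk aK; elim: y / => [|y m c _ IH mI hc]; first exact: comb0.
apply: combD => //; have mk : (m < k)%N by rewrite (idx_lt _ pk).
apply: icomb_scale; last exact: tri_icomb tri mk.
by apply: (wge_par hc); have := aK _ mk; move: (a m) => p; clear; lia.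
Qed.

Lemma tri_orth t (f : nat -> 'cV[F]_n) l q :
  icomb (iota 0 l) (f l - e l) -> (l < off t)%N -> (off t <= q)%N -> bt (f l) (e q) = 0.
Proof.
move=> h hl hq; rewrite -[f l](subrK (e l)) (btDl HB) (bt_e_off0 hl hq) addr0.
apply: (comb_orth HB h) => m; rewrite mem_iota /= => ml.
exact: bt_e_off0 (ltn_trans ml hl) hq.
Qed.

Lemma tri_Bpre t (f : nat -> 'cV[F]_n) : (forall l, (l < off t)%N -> icomb (iota 0 l) (f l - e l)) ->
  exists Y : 'M[F]_(off t), Y^T *m Bpre bl t *m Y = gram bt f (off t).
Proof.
move=> tri; rewrite Bpre_gram; apply: (gram_transform HB) => l lk.
by apply: comb_sub (tri_icomb tri lk) _ _.
Qed.

Lemma RS_Bpre t (f : nat -> 'cV[F]_n) a ps ss :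
  (forall l, (l < off t)%N -> icomb (iota 0 l) (f l - e l)) ->
  perm_eq (idx ps ss) (iota 0 (off t)) -> RS f a ps ss ->
  match ss with
  | [::] => [/\ ~~ odd (off t), xi v (Bpre bl t) != 0 & ~~ odd `|v (\det (Bpre bl t))|]
  | [:: s] => odd (off t) /\ odd `|v (\det (Bpre bl t))| = odd (a s)
  | [:: s; _] => ~~ odd (off t) /\ xi v (Bpre bl t) = 0
  | _ => False
  end.
Proof.
move=> tri pk hR; have [Y YE] := tri_Bpre tri.
by have := RS_state HF HB pk hR YE; case: ss {pk hR} => [|s [|s' []]].
Qed.

(** All new vectors share the exponent [c], so the only possible new jump is at the seam, where the
    old matching is recorded. *)
Lemma stage_ext t t' f a ps ss f' a' ps' ss' c : Stage t f a ps ss ->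
  (t <= t')%N -> (t' <= size bl)%N ->
  (forall l, (l < off t)%N -> f' l = f l) -> (forall l, (l < off t)%N -> a' l = a l) ->
  perm_eq (idx ps' ss') (iota 0 (off t')) -> RS f' a' ps' ss' ->
  (forall l, (off t <= l < off t')%N -> icomb (iota 0 l) (f' l - e l)) ->
  (forall l, (off t <= l < off t')%N -> a' l = c) ->
  (forall l, (l < off t)%N -> (a l <= c)%N) ->
  Stage t' f' a' ps' ss'.
Proof.
move=> hS tt tsz ff aa pk hR tri ac al.
have ot := off_le bl tt.
have ag ps0 ss0 c0 : (c0 <= off t)%N -> perm_eq (idx ps0 ss0) (iota 0 c0) -> RS f a ps0 ss0 -> RS f' a' ps0 ss0.
  move=> hc p0 r0; apply: (RS_agree r0) => l; rewrite -(idx_lt _ p0) => lc.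
    by rewrite ff // (leq_trans lc).
  by rewrite aa // (leq_trans lc).
split=> //.
- move=> l lt'; have [lt|lt] := ltnP l (off t); last by apply: tri; rewrite lt.
  by rewrite ff //; apply: (st_tri hS).
- move=> i j ij jt'; have [jt|jt] := ltnP j (off t).
    by rewrite !aa ?(leq_ltn_trans ij) //; apply: (st_mono hS).
  rewrite (ac j) ?jt //; have [it|it] := ltnP i (off t); first by rewrite aa // al.
  by rewrite ac // it (leq_ltn_trans ij).
- move=> c0 ct' lt; have [ct|ct] := ltnP c0.+1 (off t).
    move: lt; rewrite !aa // ?(ltnW ct) // => /(st_hist hS ct)[t0 [ps0 [ss0 [h1 h2 h3 h4]]]].
    by exists t0, ps0, ss0; split=> //; apply: (ag _ _ _ _ h3 h4); apply: ltnW.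
  move: ct; rewrite leq_eqVlt => /orP[/eqP ct|ct].
    exists t, ps, ss; split=> //; first exact: leq_trans tt tsz.
      by rewrite -ct; apply: st_perm hS.
    by apply: (ag _ _ _ (leqnn _) (st_perm hS) (st_RS hS)).
  have e1 : a' c0 = c by apply: ac; rewrite -ltnS ct (ltnW ct').
  have e2 : a' c0.+1 = c by apply: ac; rewrite (ltnW ct) ct'.
  by move: lt; rewrite e1 e2 ltnn.
Qed.

End Stages.

Lemma idx_pair_perm ps ss ss' i k : perm_eq ss (i :: ss') ->
  perm_eq (idx ((i, k) :: ps) ss') (k :: idx ps ss).
Proof.
move=> pp; rewrite /idx /= perm_sym -[k :: _]/([:: k] ++ ss ++ flat ps) perm_catCA /=.
apply: (@perm_trans _ ((i :: ss') ++ k :: flat ps)); first by rewrite perm_cat2r.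
by rewrite -[i :: ss']/([:: i] ++ ss') -catA perm_catCA.
Qed.

Lemma idx_pair2_perm ps ss k k' : perm_eq (idx ((k, k') :: ps) ss) (k :: k' :: idx ps ss).
Proof. by apply/permPl; apply: (perm_catCA ss [:: k; k'] (flat ps)). Qed.

Lemma perm_iotaS I J k : perm_eq J (k :: I) -> perm_eq I (iota 0 k) -> perm_eq J (iota 0 k.+1).
Proof.
move=> JI Ik; apply: (perm_trans JI); rewrite -addn1 iotaD cats1 perm_sym perm_rcons perm_cons.
by rewrite perm_sym.
Qed.

(** * Bounds on exponents forced by pre-optimality *)

Section Steps.

Variables (F : fieldType) (v : F -> int).
Hypothesis HF : unram2 v.
Notation wge := (wge v).
Notation wex := (wex v).
Variable bl : seq (nat * blk F).
Hypothesis hok : all (fun p => blk_ok v p.2) bl.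
Hypothesis hpo : pre_optimal v bl.
Notation off t := (degs (take t bl)).
Notation n := (degs bl).
Notation e := (ebas F n).
Notation bt := (mbt (assemble bl)).
Notation RS := (RS v bt).
Notation Stage := (@Stage F v bl).
Notation icomb I := (comb e I (fun _ c => wge c 0)).
Let HB := bt_symbil bl.

Definition nextD t K := [/\ (t < size bl)%N, isD (Cb bl t.+1) & kb bl t.+1 = K].

(* How far the exponents may exceed the scale of the last block; (PO1)-(PO6) exclude the blocks
   that would then break the monotonicity of [a]. *)
Definition Last t (a : nat -> nat) (ss : seq nat) : Prop :=
  (0 < t)%N ->
  if isD (Cb bl t) then
    [\/ (forall l, (l < off t)%N -> (a l <= kb bl t)%N),
        (forall l, (l < off t)%N -> (a l <= (kb bl t).+1)%N) /\
        (nextD t (kb bl t) -> exists2 s, ss = [:: s] & ~~ odd (a s + kb bl t)) |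
        [/\ (forall l, (l < off t)%N -> (a l <= (kb bl t).+2)%N), ~ nextD t (kb bl t) &
         ss = [::] \/ exists s, [/\ ss = [:: s], odd (a s + kb bl t), xi v (Bpre bl t.-1) = 0 & (2 <= t)%N]]]
  else forall l, (l < off t)%N -> (a l <= kb bl t)%N.

Lemma blk_okP t : (t < size bl)%N -> blk_ok v (Cb bl t.+1).
Proof. by move=> ht; have /(all_nthP (0%N, BD [::]))/(_ t ht) := hok. Qed.

Lemma deg_pos t : (t < size bl)%N -> (0 < deg (Cb bl t.+1))%N.
Proof. by move=> /blk_okP; case: (Cb bl t.+1) => //= s /andP[]. Qed.

(** (PO1) for an explicit list of diagonal blocks of one scale, as used with two or three
    neighbours. *)
Lemma D_deg2 js K : uniq js -> (forall j, j \in js -> (1 <= j <= size bl)%N /\ (kb bl j == K) && isD (Cb bl j)) ->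
  (\sum_(j <- js) deg (Cb bl j) <= 2)%N.
Proof.
move=> u h; have [po1 _] := hpo; apply: leq_trans (po1 K).
rewrite -[leqRHS]big_filter; set s := filter _ _.
have us : uniq s by rewrite filter_uniq // iota_uniq.
have sub : {subset js <= s}.
  by move=> j /h[hj hP]; rewrite mem_filter hP mem_index_iota ltnS.
have pp : perm_eq s (js ++ filter (fun j => j \notin js) s).
  apply: uniq_perm => //.
    rewrite cat_uniq u filter_uniq // andbT /=; apply/hasPn => j.
    by rewrite mem_filter => /andP[].
  move=> j; rewrite mem_cat mem_filter; case: (boolP (j \in js)) => [/sub -> //|_ /=].
  by [].
by rewrite (perm_big _ pp) big_cat leq_addr.
Qed.

Lemma Dblock_norm t x : (t < size bl)%N -> isD (Cb bl t.+1) -> (x < deg (Cb bl t.+1))%N ->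
  wex (bt (e (off t + x)) (e (off t + x))) (2 * (kb bl t.+1)%:Z).
Proof.
move=> ht hD hx.
have hn : (off t + x < n)%N.
  by apply: leq_trans (off_le_n bl t.+1); rewrite offS // ltn_add2l.
rewrite bt_e // ent_blk //; have := blk_okP ht.
case: (Cb bl t.+1) hD hx => //= s _ hx /andP[_ /allP hu]; rewrite eqxx.
have := hu _ (mem_nth 0 hx); rewrite unit_wex => hu'.
by apply: (wexE (wexM HF (wex2X HF _) hu')) => //; clear; lia.
Qed.

Lemma Eblock t : (t < size bl)%N -> ~~ isD (Cb bl t.+1) ->
  [/\ off t.+1 = (off t).+2, wge (bt (e (off t)) (e (off t))) (2 * (kb bl t.+1)%:Z),
      wge (bt (e (off t).+1) (e (off t).+1)) (2 * (kb bl t.+1)%:Z) &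
      wex (2 * bt (e (off t)) (e (off t).+1)) ((kb bl t.+1)%:Z + (kb bl t.+1)%:Z)].
Proof.
move=> ht hE; have h := offS ht; have ok := blk_okP ht.
have d2 : deg (Cb bl t.+1) = 2%N by case: (Cb bl t.+1) hE.
rewrite d2 addn2 in h.
have hn1 : ((off t).+1 < n)%N by rewrite -h off_le_n.
have hn0 := ltnW hn1.
have E x y : (x < 2)%N -> (y < 2)%N -> ent bl (off t + x) (off t + y) =
    2 ^+ (kb bl t.+1) * blk_entry (Cb bl t.+1) x y by move=> hx hy; apply: ent_blk; rewrite ?d2.
have := E 0%N 0%N isT isT; have := E 1%N 1%N isT isT; have := E 0%N 1%N isT isT.
rewrite addn0 addn1 !bt_e // => -> -> ->; split=> //; move: hE ok {d2 E};
  case: (Cb bl t.+1) => //= x y z _; rewrite !vge_wge integral_wge unit_wex => /and4P[hx hz hy hu];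
  rewrite mulr1 in hx hz.
- by apply: (wgeM_le HF (wex_wge (wex2X HF _) (lexx _)) (wge_half HF hx)); clear; lia.
- by apply: (wgeM_le HF (wex_wge (wex2X HF _) (lexx _)) (wge_half HF hz)); clear; lia.
have : wex ((2 * y) ^+ 2) 0.
  have -> : (2 * y) ^+ 2 = - (2 * x * (2 * z) - (2 * y) ^+ 2) + (2 * x) * (2 * z) by ring.
  by apply: (wexD HF); rewrite ?(wexN HF) //; apply: (wgeM_le HF hx hz).
case/wexP => y20 vy; have y0 : 2 * y != 0 by apply: contraNneq y20 => ->; rewrite expr0n.
have xy : wex (2 * y) 0 by apply/wexP; split=> //; move: vy; rewrite (vX HF) //; clear; lia.
have -> : 2 * (2 ^+ kb bl t.+1 * y) = 2 ^+ kb bl t.+1 * (2 * y) by ring.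
by apply: (wexE (wexM HF (wex2X HF _) xy)) => //; clear; lia.
Qed.

Section OneStep.

Variables (t : nat) (f : nat -> 'cV[F]_n) (a : nat -> nat) (ps : seq (nat * nat)) (ss : seq nat).
Hypothesis hS : Stage t f a ps ss.
Hypothesis hL : Last t a ss.
Hypothesis ht : (t < size bl)%N.
Notation k := (off t).
Notation K := (kb bl t.+1).

Let pk := st_perm hS.
Let hR := st_RS hS.
Let tri := st_tri hS.

Lemma k_notin : k \notin idx ps ss. Proof. by rewrite -(idx_lt _ pk) ltnn. Qed.
Lemma k1_notin : k.+1 \notin idx ps ss. Proof. by rewrite -(idx_lt _ pk) ltnNge leqnSn. Qed.

Lemma state_t : match ss with
  | [::] => [/\ ~~ odd k, xi v (Bpre bl t) != 0 & ~~ odd `|v (\det (Bpre bl t))|]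
  | [:: s] => odd k /\ odd `|v (\det (Bpre bl t))| = odd (a s)
  | [:: s; _] => ~~ odd k /\ xi v (Bpre bl t) = 0
  | _ => False
  end.
Proof. exact: (@RS_Bpre _ _ HF bl t f a ps ss tri pk hR). Qed.

Lemma f_orth q : (k <= q)%N -> forall l, l \in idx ps ss -> bt (f l) (e q) = 0.
Proof. by move=> kq l; rewrite -(idx_lt _ pk) => lk; apply: tri_orth (tri lk) lk kq. Qed.

Lemma ext1 t' y c ps' ss' : t' = t.+1 -> off t' = k.+1 -> icomb (iota 0 k) y ->
  (forall l, (l < k)%N -> (a l <= c)%N) -> perm_eq (idx ps' ss') (k :: idx ps ss) ->
  RS (upd f k (e k + y)) (upd a k c) ps' ss' ->
  Stage t' (upd f k (e k + y)) (upd a k c) ps' ss'.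
Proof.
move=> tE kE hy hc pp hR'.
have lk l : (k <= l < off t')%N -> l = k.
  by rewrite kE => h; apply/eqP; rewrite eqn_leq -ltnS andbC.
apply: (stage_ext hS (t' := t') (c := c)) => //; rewrite ?tE //.
- by move=> l h; rewrite updN // ltn_eqF.
- by move=> l h; rewrite updN // ltn_eqF.
- by rewrite -tE kE; apply: perm_iotaS pp pk.
- by rewrite -tE => l /lk ->; rewrite updE addrAC subrr add0r.
- by rewrite -tE => l /lk ->; rewrite updE.
Qed.

Lemma ext2 t' y y' c ps' ss' : (t < t')%N -> (t' <= size bl)%N -> off t' = k.+2 ->
  icomb (iota 0 k) y -> icomb (iota 0 k.+1) y' ->
  (forall l, (l < k)%N -> (a l <= c)%N) -> perm_eq (idx ps' ss') (iota 0 k.+2) ->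
  RS (upd (upd f k (e k + y)) k.+1 (e k.+1 + y')) (upd (upd a k c) k.+1 c) ps' ss' ->
  Stage t' (upd (upd f k (e k + y)) k.+1 (e k.+1 + y')) (upd (upd a k c) k.+1 c) ps' ss'.
Proof.
move=> tt tsz kE hy hy' hc pp hR'.
have lk l : (k <= l < off t')%N -> l = k \/ l = k.+1.
  by rewrite kE; case: (ltngtP l k) => //= [h|->]; [right; apply/eqP; rewrite eqn_leq h -ltnS andbT|left].
have kk : k != k.+1 by rewrite neq_ltn ltnSn.
apply: (stage_ext hS (t' := t') (c := c)) => //; first exact: ltnW.
- by move=> l h; rewrite !updN // ltn_eqF // ltnW.
- by move=> l h; rewrite !updN // ltn_eqF // ltnW.
- by rewrite kE.
- by move=> l /lk[]->; rewrite ?updE ?(updN _ _ kk) ?updE addrAC subrr add0r.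
- by move=> l /lk[]->; rewrite ?updE ?(updN _ _ kk) ?updE.
Qed.

Lemma po2_adj : (0 < t)%N ->
  [/\ isD (Cb bl t) -> isD (Cb bl t.+1) -> (kb bl t <= K)%N,
      ~~ isD (Cb bl t) -> ~~ isD (Cb bl t.+1) -> (kb bl t <= K)%N,
      isD (Cb bl t) -> ~~ isD (Cb bl t.+1) -> (kb bl t + 1 <= K)%N &
      ~~ isD (Cb bl t) -> isD (Cb bl t.+1) -> (kb bl t <= K + 1)%N].
Proof. by move=> t0; have [_ [_ [po2 _]]] := hpo; apply: po2. Qed.

Lemma t_pos l : (l < k)%N -> (0 < t)%N.
Proof. by case: t => //; rewrite take0. Qed.

Lemma bound_D : isD (Cb bl t.+1) -> forall l, (l < k)%N -> (a l <= K.+1)%N.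
Proof.
move=> hD l lk; have t0 := t_pos lk; have [q1 _ _ q4] := po2_adj t0.
have := hL t0; case: ifP => [hDt|/negbT hDt] hl; last first.
  by apply: leq_trans (hl _ lk) _; rewrite -addn1; apply: q4.
have q := q1 hDt hD.
case: hl => [hl|[hl _]|[hl nx _]].
- by apply: leq_trans (hl _ lk) _; apply: leq_trans q _.
- by apply: leq_trans (hl _ lk) _; rewrite ltnS.
apply: leq_trans (hl _ lk) _; rewrite ltnS ltn_neqAle q andbT.
by apply/eqP => kE; apply: nx; split.
Qed.

(** The only danger is an overshoot by two followed by scale one higher. Then (PO5) applies to block
    t, and both of its alternatives contradict what the singles say about degree, determinant and
    xi. *)
Lemma bound_E : ~~ isD (Cb bl t.+1) -> forall l, (l < k)%N -> (a l <= K)%N.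
Proof.
move=> hE l lk; have t0 := t_pos lk; have [_ q2 q3 _] := po2_adj t0.
have := hL t0; case: ifP => [hDt|/negbT hDt] hl; last by apply: leq_trans (hl _ lk) _; apply: q2.
have q := q3 hDt hE; rewrite addn1 in q.
case: hl => [hl|[hl _]|[hl nx hss]].
- by apply: leq_trans (hl _ lk) _; apply: ltnW.
- by apply: leq_trans (hl _ lk) _.
apply: leq_trans (hl _ lk) _; rewrite ltn_neqAle q andbT; apply/eqP => kE.
have [_ [_ [_ [_ [_ [po5 _]]]]]] := hpo.
have [] := po5 t t0 ht hDt hE _; first by rewrite addn1.
move=> _; have := state_t; case: hss => [->|[s [-> _ x0 t2]]].
  move=> [ko _ vo] [[_ od]|[ok _]]; last by rewrite ok in ko.
  by move: od; rewrite /ord_det_odd (negPf vo).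
move=> [ko _] [[ok _]|[_ xn]]; first by rewrite ko in ok.
by have := xn t2; rewrite x0 eqxx.
Qed.

(** When the new vector is to stay single it keeps exponent K, so earlier exponents must not exceed
    K. (PO6) excludes an overshoot after a diagonal block when no single is left, parity excludes it
    when one is; (PO4) treats a preceding non-diagonal block. *)
Lemma bound_D0 : isD (Cb bl t.+1) -> deg (Cb bl t.+1) = 1%N ->
  (ss = [::] \/ exists2 s, ss = [:: s] & odd (a s + K)) ->
  forall l, (l < k)%N -> (a l <= K)%N.
Proof.
move=> hD d1 hss l lk; have t0 := t_pos lk; have [q1 _ _ q4] := po2_adj t0.
have st := state_t.
have [_ [_ [_ [_ [po4 [_ po6]]]]]] := hpo.
have := hL t0; case: ifP => [hDt|/negbT hDt] hl.
  have q := q1 hDt hD.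
  case: hl => [hl|[hl nx]|[hl nx hC]].
  - by apply: leq_trans (hl _ lk) _.
  - apply: leq_trans (hl _ lk) _; rewrite ltn_neqAle q andbT; apply/eqP => kE.
    have [//|s sE par] := nx; case: hss => [s0|[s' sE' par']]; first by rewrite s0 in sE.
    by move: par par'; rewrite sE in sE'; case: sE' => <-; rewrite kE => /negPf ->.
  apply: leq_trans (hl _ lk) _.
  have lt : (kb bl t < K)%N by rewrite ltn_neqAle q andbT; apply/eqP => kE; apply: nx; split.
  rewrite ltn_neqAle lt andbT; apply/eqP => kE.
  case: hC => [s0|[s [sE par _ _]]].
    rewrite s0 in st; case: st => ko x0 _.
    by have := po6 t t0 ht ko hDt hD _; rewrite -kE addn1 => /(_ erefl) xE; rewrite xE eqxx in x0.
  case: hss => [s0|[s' sE' par']]; first by rewrite s0 in sE.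
  by move: par'; rewrite sE in sE'; case: sE' => <-; rewrite -kE addnS /= par.
have q := q4 hDt hD; rewrite addn1 in q.
have [le|gt] := leqP (kb bl t) K; first by apply: leq_trans (hl _ lk) le.
have kE : (K + 1 = kb bl t)%N by apply/eqP; rewrite eqn_leq addn1 gt q.
have kS : off t.+1 = k.+1 by rewrite offS // d1 addn1.
have [] := po4 t.+1 _ kE hD hDt; first by rewrite !ltnS t0.
  by rewrite d1.
have oS : odd (off t.+1) = ~~ odd k by rewrite kS.
move=> [_ hh]; exfalso; rewrite oS in hh; case: hss => [s0|[s sE par]].
  rewrite s0 in st; case: st => ko x0 _; case: hh => [[ok _]|[_ /= xz]].
    by move: ok; rewrite ko.
  by rewrite xz eqxx in x0.
rewrite sE in st; case: st => ko vo; case: hh => [[_ od]|[ok _]]; last by move: ok; rewrite ko.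
move: od; rewrite /ord_det_odd !Bpre_gram kS.
rewrite (det_gram_last HB) => [|m mk]; last by apply: (bt_e_off0 (t := t) mk).
have /wexP[n0 vk] : wex (bt (e k) (e k)) (2 * K%:Z).
  by have := Dblock_norm ht hD (_ : (0 < _)%N); rewrite d1 addn0 => /(_ isT).
(* [v] is additive only on nonzero factors, so the determinant of the previous form must be known
   not to vanish; this comes from its diagonalization. *)
have dn : \det (gram bt e k) != 0.
  rewrite -Bpre_gram; apply/eqP => d0.
  have [Y YE] := tri_Bpre HF tri.
  have hR' := hR; have pk' := pk; rewrite sE in hR' pk'.
  have [c1 c2] := RS_refl_cong v bt f (idx ps [:: s]) a.
  have [h [_ [hs _ ad _ _]]] := common_diag HF HB hR' c1 c2.
  have [X XE] := span_gram HB pk' hs.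
  have e' : (Y *m X)^T *m Bpre bl t *m (Y *m X) = gram bt h k by rewrite trmx_mul -XE -YE !mulmxA.
  have [_ _] := state1_det pk' ad e'.
  by rewrite -e' !det_mulmx d0 mulr0 mul0r eqxx.
rewrite Bpre_gram in vo; rewrite (vM HF) //.
by move: vo vk par; move: (v _) (v (bt _ _)) (a s) (kb _ _) => x y z w; clear; lia.
Qed.

End OneStep.

End Steps.

(** * Adding the next block or blocks *)

Section Induction.

Variables (F : fieldType) (v : F -> int).
Hypothesis HF : unram2 v.
Notation wge := (wge v).
Notation wex := (wex v).
Variable bl : seq (nat * blk F).
Hypothesis hok : all (fun p => blk_ok v p.2) bl.
Hypothesis hpo : pre_optimal v bl.
Notation off t := (degs (take t bl)).
Notation n := (degs bl).
Notation e := (ebas F n).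
Notation bt := (mbt (assemble bl)).
Notation RS := (RS v bt).
Notation Stage := (@Stage F v bl).
Notation Last := (@Last F v bl).
Notation nextD := (nextD bl).
Notation icomb I := (comb e I (fun _ c => wge c 0)).
Let HB := bt_symbil bl.

Lemma upd_le (a : nat -> nat) k c M : (forall l, (l < k)%N -> (a l <= M)%N) -> (c <= M)%N ->
  forall l, (l < k.+1)%N -> (upd a k c l <= M)%N.
Proof.
move=> h cM l; rewrite ltnS leq_eqVlt /upd => /orP[/eqP->|lk]; first by rewrite eqxx.
by rewrite ltn_eqF // h.
Qed.

Definition progress t := exists t' f a ps ss,
  [/\ (t < t')%N, (t' <= size bl)%N, Stage t' f a ps ss & Last t' a ss].

Section OneStep.

Variables (t : nat) (f : nat -> 'cV[F]_n) (a : nat -> nat) (ps : seq (nat * nat)) (ss : seq nat).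
Hypothesis hS : Stage t f a ps ss.
Hypothesis hL : Last t a ss.
Hypothesis ht : (t < size bl)%N.
Notation k := (off t).
Notation K := (kb bl t.+1).

Let pk := st_perm hS.
Let hR := st_RS hS.
Let tri := st_tri hS.
Let kI := k_notin hS.
Let k1I := k1_notin hS.

Lemma step_E : ~~ isD (Cb bl t.+1) -> progress t.
Proof.
move=> hE; have [kS b1 b2 b3] := Eblock HF hok ht hE.
have aK := @bound_E _ _ HF _ hpo _ _ _ _ _ hS hL ht hE.
have kk : k != k.+1 by rewrite neq_ltn ltnSn.
exists t.+1, (upd (upd f k (e k + 0)) k.+1 (e k.+1 + 0)), (upd (upd a k K) k.+1 K), ((k, k.+1) :: ps), ss.
split=> //.
  apply: (ext2 hS) => //; try exact: comb0.
    by apply: (perm_iotaS (I := k :: idx ps ss)); [apply: perm_trans (idx_pair2_perm _ _ _ _) _; apply/permPl; apply: (perm_catCA [:: k] [:: k.+1]) | apply: (perm_iotaS (I := idx ps ss))].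
  rewrite !addr0; apply: (ext_pair2 HB hR kk kI k1I) => //.
  - by move=> l lI; rewrite (f_orth hS) // mulr0 (wge0 v).
  - by move=> l lI; rewrite (f_orth hS) // mulr0 (wge0 v).
move=> _; rewrite (negPf hE) kS => l.
by apply: upd_le => //; apply: upd_le.
Qed.

Hypothesis hD : isD (Cb bl t.+1).

Let bD : forall l, (l < k)%N -> (a l <= K.+1)%N := @bound_D _ _ _ hpo _ _ _ hL ht hD.

Lemma eK x : (x < deg (Cb bl t.+1))%N -> wex (bt (e (k + x)) (e (k + x))) (2 * K%:Z).
Proof. by move=> hx; apply: (Dblock_norm HF hok ht hD hx). Qed.

Lemma eK0 : wex (bt (e k) (e k)) (2 * K%:Z).
Proof. by have := eK (deg_pos hok ht); rewrite addn0. Qed.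

Let iy y : Lam v f a (idx ps ss) K%:Z y -> icomb (iota 0 k) y := Lam_icomb HF tri pk bD.

(** Two vectors of scale K, from one block or two, become a plane of exponents K + 1. No further
    diagonal block has this scale, which makes the condition on a successor in [Last] vacuous. *)
Lemma merge t' y y' ss' : (t < t')%N -> (t' <= size bl)%N -> off t' = k.+2 -> perm_eq ss ss' ->
  (isD (Cb bl t')) -> kb bl t' = K -> ~ nextD t' K ->
  Lam v f a (idx ps ss) K%:Z y -> Lam v f a (idx ps ss) K%:Z y' ->
  RS (upd (upd f k (e k + y)) k.+1 (e k.+1 + y')) (upd (upd a k K.+1) k.+1 K.+1) ((k, k.+1) :: ps) ss' ->
  progress t.
Proof.
move=> tt tsz kS pss hD' kE nx hy hy' hR'.
exists t', (upd (upd f k (e k + y)) k.+1 (e k.+1 + y')), (upd (upd a k K.+1) k.+1 K.+1), ((k, k.+1) :: ps), ss'.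
split=> //.
  apply: (ext2 hS) => //; first exact: iy.
    by apply: (icomb_sub (leqnSn k)); apply: iy.
  apply: (perm_iotaS (I := k :: idx ps ss)); last by apply: (perm_iotaS (I := idx ps ss)).
  apply: perm_trans (idx_pair2_perm _ _ _ _) _.
  apply: (@perm_trans _ (k :: k.+1 :: idx ps ss)).
    by rewrite !perm_cons /idx perm_cat2r perm_sym.
  by apply/permPl; apply: (perm_catCA [:: k] [:: k.+1]).
move=> _; rewrite hD' kS kE; apply: Or32; split=> // l.
by apply: upd_le => //; apply: upd_le.
Qed.

Lemma even_split i j : ss = [:: i; j] ->
  exists i' j', [/\ perm_eq ss [:: i'; j'], ~~ odd (a i' + K) & odd (a j' + K)].
Proof.
move=> sE; have ij : i != j by have := rs_uniq hR; rewrite sE /= inE negb_or => /andP[/andP[]].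
have par : odd (a i + a j) by apply: (rs_par hR); rewrite // sE !inE eqxx ?orbT.
have [oi|oi] := boolP (odd (a i + K)).
  exists j, i; rewrite sE; split=> //; first by apply/permPl; apply: (perm_catC [:: i] [:: j]).
  by move: par oi; move: (a i) (a j) (kb _ _) => x y z; clear; lia.
exists i, j; rewrite sE; split=> //.
by move: par oi; move: (a i) (a j) (kb _ _) => x y z; clear; lia.
Qed.

Lemma stage_swap ss' : perm_eq ss ss' -> RS f a ps ss' /\ perm_eq (idx ps ss') (iota 0 k).
Proof.
move=> pp; split; first exact: RS_perm pp hR.
by apply: perm_trans pk; rewrite /idx perm_cat2r perm_sym.
Qed.

Lemma twin_next t' : (off t' = k.+1)%N -> (t' < size bl)%N -> isD (Cb bl t'.+1) -> kb bl t'.+1 = K ->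
  twin v bt f ps ss K (e k) (e k.+1).
Proof.
move=> kS ht' hD' kE; split.
- exact: f_orth hS _ (leqnSn k).
- by apply: (bt_e_off0 (t := t')); rewrite kS.
by have := Dblock_norm HF hok ht' hD' (deg_pos hok ht'); rewrite addn0 kS kE.
Qed.

(** The cases follow the number of singles. If the new vector would get exponent K + 2 while the
    next diagonal block has scale K too, that block could not follow monotonically; both blocks are
    then processed together as a plane at K + 1. *)
Lemma step_D1 : deg (Cb bl t.+1) = 1%N -> progress t.
Proof.
move=> d1; have kS : off t.+1 = k.+1 by rewrite offS // d1 addn1.
have st := state_t HF hS.
have eo := f_orth hS (leqnn k).
have one y c ps' ss' : icomb (iota 0 k) y -> (forall l, (l < k)%N -> (a l <= c)%N) ->
    perm_eq (idx ps' ss') (k :: idx ps ss) ->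
    RS (upd f k (e k + y)) (upd a k c) ps' ss' -> Last t.+1 (upd a k c) ss' -> progress t.
  move=> hy hc pp hR' hL'; exists t.+1, (upd f k (e k + y)), (upd a k c), ps', ss'.
  by split=> //; apply: (ext1 hS ht).
have single : (ss = [::] \/ exists2 s, ss = [:: s] & odd (a s + K)) -> progress t.
  move=> hss; have aK := @bound_D0 _ _ HF _ hok hpo _ _ _ _ _ hS hL ht hD d1 hss.
  apply: (one 0 K ps (k :: ss)) => //; first exact: comb0.
    rewrite addr0; apply: (new_single HB hR kI eo eK0) => l.
    by case: hss => [->|[s -> hs]] //; rewrite inE => /eqP ->.
  move=> _; rewrite hD kS; apply: Or31 => l; exact: upd_le.
have shift2 : ~ nextD t.+1 K -> forall l, (l < k)%N -> (a l <= K.+2)%N.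
  by move=> _ l lk; apply: leq_trans (bD lk) _.
have nx_dec : nextD t.+1 K \/ ~ nextD t.+1 K by apply: EM.
have nx_merge : nextD t.+1 K -> [/\ (t.+2 <= size bl)%N, off t.+2 = k.+2, isD (Cb bl t.+2),
     kb bl t.+2 = K & ~ nextD t.+2 K].
  move=> [h1 h2 h3].
  have two : (\sum_(j <- [:: t.+1; t.+2]) deg (Cb bl j) <= 2)%N.
    apply: (D_deg2 hpo (K := K)); first by rewrite /= inE neq_ltn ltnSn.
    by move=> j; rewrite !inE => /orP[] /eqP->; rewrite ?h2 ?hD ?h3 ?eqxx ?ltnS ?ht ?h1.
  have d2 : deg (Cb bl t.+2) = 1%N.
    by move: two (deg_pos hok h1); rewrite !big_cons big_nil d1; move: (deg _) => x; clear; lia.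
  split=> //; first by rewrite offS // d2 kS addn1.
  move=> [g1 g2 g3].
  have : (\sum_(j <- [:: t.+1; t.+2; t.+3]) deg (Cb bl j) <= 2)%N.
    apply: (D_deg2 hpo (K := K)); first by rewrite /= !inE; clear; lia.
    by move=> j; rewrite !inE => /or3P[] /eqP->; rewrite ?h2 ?hD ?g2 ?h3 ?g3 ?eqxx ?ltnS ?ht ?h1 ?g1.
  by move: (deg_pos hok g1); rewrite !big_cons big_nil d1 d2; move: (deg _) => x; clear; lia.
have tw : nextD t.+1 K -> twin v bt f ps ss K (e k) (e k.+1).
  by move=> [h1 h2 h3]; apply: (twin_next kS h1 h2 h3).
case ssE : ss st => [|s [|s' [|//]]] st.
- by apply: single; left.
- have [par|par] := boolP (odd (a s + K)); first by apply: single; right; exists s.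
  case: nx_dec => [nx|nx].
    have [h1 h2 h3 h4 h5] := nx_merge nx.
    have [y [y' [hy hy' hR']]] := new_odd_two HF HB hR kI k1I eo eK0 (tw nx) ssE par.
    by apply: (merge (t' := t.+2) (ss' := [:: s])) hR' => //; rewrite ssE.
  have [y hy hR'] := new_odd HF HB hR kI eo eK0 ssE par.
  case: hR' => hR'.
    apply: (one y K.+2 _ _ (iy hy) (shift2 nx) _ hR').
      by rewrite ssE; apply: idx_pair_perm.
    move=> _; rewrite hD kS; apply: Or33; split=> //; last by left.
    by apply: upd_le => //; apply: shift2.
  apply: (one y K.+1 _ _ (iy hy) bD _ hR'); first by rewrite ssE.
  by move=> _; rewrite hD kS; apply: Or32; split=> //; apply: upd_le.
have [i [j [pp pi pj]]] := even_split ssE.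
have [hR1 pk1] := stage_swap pp.
have mI : idx ps ss =i idx ps [:: i; j] by apply: perm_mem; rewrite /idx perm_cat2r.
have kI1 : k \notin idx ps [:: i; j] by rewrite -mI.
have k1I1 : k.+1 \notin idx ps [:: i; j] by rewrite -mI.
have eo1 l : l \in idx ps [:: i; j] -> bt (f l) (e k) = 0 by rewrite -mI; apply: eo.
have iy1 y : Lam v f a (idx ps [:: i; j]) K%:Z y -> Lam v f a (idx ps ss) K%:Z y.
  by move=> hy; apply: (Lam_le HF hy) => // l; rewrite mI.
case: (new_even HF HB hR1 kI1 k1I1 eo1 eK0 erefl pi) => [[y hy hR']|[[y hy hR'] mg]].
  apply: (one y K.+1 _ _ (iy (iy1 _ hy)) bD _ hR').
    by apply: idx_pair_perm; apply: (perm_trans pp); apply/permPl; apply: (perm_catC [:: i] [:: j]).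
  move=> _; rewrite hD kS; apply: Or32; split; first exact: upd_le.
  move=> _; exists i => //; rewrite updN //.
  by apply: contraNneq kI1 => <-; rewrite inE eqxx.
case: nx_dec => [nx|nx].
  have [h1 h2 h3 h4 h5] := nx_merge nx.
  have tw1 : twin v bt f ps [:: i; j] K (e k) (e k.+1).
    by have [w1 w2 w3] := tw nx; split=> // l; rewrite -mI; apply: w1.
  have [z [z' [hz hz' hR2]]] := mg _ tw1.
  by apply: (merge (t' := t.+2) (ss' := [:: i; j])) hR2 => //; apply: iy1.
apply: (one y K.+2 _ _ (iy (iy1 _ hy)) (shift2 nx) _ hR'); first exact: idx_pair_perm.
move=> _; rewrite hD kS; apply: Or33; split=> //; first by apply: upd_le => //; apply: shift2.
(* The form before this block had two singles, hence xi zero; this is what [Last] has to remember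
   for (PO5). *)
right; exists j; split=> //.
- rewrite updN //; by apply: contraNneq kI1 => <-; rewrite !inE eqxx orbT.
- by case: st.
rewrite ltnS; apply: (t_pos (bl := bl) (l := 0%N)).
by rewrite -(size_iota 0 k) -(perm_size pk) ssE.
Qed.

(** (PO3) guarantees a single with the parity of K: its first alternative leaves two singles before
    the block, its second exactly one, of the right parity. *)
Lemma step_D2 : deg (Cb bl t.+1) = 2%N -> progress t.
Proof.
move=> d2; have kS : off t.+1 = k.+2 by rewrite offS // d2 addn2.
have st := state_t HF hS.
have eo := f_orth hS (leqnn k); have eo' := f_orth hS (leqnSn k).
have eK1 : wex (bt (e k.+1) (e k.+1)) (2 * K%:Z).
  by have := @eK 1%N; rewrite d2 addn1 => /(_ isT).
have hn1 : (k.+1 < n)%N by rewrite -kS off_le_n.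
have ee : bt (e k) (e k.+1) = 0.
  have := @ent_blk _ bl t 0 1 ht; rewrite d2 addn0 addn1 => /(_ isT isT).
  rewrite bt_e ?(ltnW hn1) // => ->.
  by case: (Cb bl t.+1) hD => //= u _; rewrite mulr0.
have tw : twin v bt f ps ss K (e k) (e k.+1) by split.
have nx : ~ nextD t.+1 K.
  move=> [h1 h2 h3].
  have : (\sum_(j <- [:: t.+1; t.+2]) deg (Cb bl j) <= 2)%N.
    apply: (D_deg2 hpo (K := K)); first by rewrite /= inE neq_ltn ltnSn.
    by move=> j; rewrite !inE => /orP[] /eqP->; rewrite ?h2 ?hD ?h3 ?eqxx ?ltnS ?ht ?h1.
  by move: (deg_pos hok h1); rewrite !big_cons big_nil d2; move: (deg _) => x; clear; lia.
have [_ [_ [_ [po3 _]]]] := hpo.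
have [|_] := po3 t.+1 _ hD d2; first by rewrite ltnS ht.
have oS : odd (off t.+1) = odd k by rewrite kS /= negbK.
rewrite oS /= => hh.
case ssE : ss st => [|s [|s' [|//]]] st.
- exfalso; case: st => ko x0 _; case: hh => [[_ [xz _]]|[ok _]]; first by rewrite xz eqxx in x0.
  by rewrite ok in ko.
- have par : ~~ odd (a s + K).
    case: st => ko vo; case: hh => [[ok _]|[_ od]]; first by rewrite ko in ok.
    by move: od; rewrite !oddD vo.
  have [y [y' [hy hy' hR']]] := new_odd_two HF HB hR kI k1I eo eK0 tw ssE par.
  by apply: (merge (t' := t.+1) (ss' := [:: s])) hR' => //; rewrite ssE.
have {}hh : xi v (Bpre bl t.+1) = 0.
  by case: st => ko _; case: hh => [[_ []]|[ok _]] //; rewrite ok in ko.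
have [i [j [pp pi pj]]] := even_split ssE.
have [hR1 pk1] := stage_swap pp.
have mI : idx ps ss =i idx ps [:: i; j] by apply: perm_mem; rewrite /idx perm_cat2r.
have kI1 : k \notin idx ps [:: i; j] by rewrite -mI.
have k1I1 : k.+1 \notin idx ps [:: i; j] by rewrite -mI.
have eo1 l : l \in idx ps [:: i; j] -> bt (f l) (e k) = 0 by rewrite -mI; apply: eo.
have iy1 y : Lam v f a (idx ps [:: i; j]) K%:Z y -> Lam v f a (idx ps ss) K%:Z y.
  by move=> hy; apply: (Lam_le HF hy) => // l; rewrite mI.
case: (new_even HF HB hR1 kI1 k1I1 eo1 eK0 erefl pi) => [[y hy hR']|[_ mg]]; last first.
  have tw1 : twin v bt f ps [:: i; j] K (e k) (e k.+1).
    by have [w1 w2 w3] := tw; split=> // l; rewrite -mI; apply: w1.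
  have [z [z' [hz hz' hR2]]] := mg _ tw1.
  by apply: (merge (t' := t.+1) (ss' := [:: i; j])) hR2 => //; apply: iy1.
have icy := iy (iy1 _ hy).
set f1 := upd f k _ in hR'; set a1 := upd a k _ in hR'.
have ik : i != k by apply: contraNneq kI1 => <-; rewrite inE eqxx.
have pp1 : perm_eq (idx ((j, k) :: ps) [:: i]) (iota 0 k.+1).
  apply: (perm_iotaS (I := idx ps ss)) => //; apply: idx_pair_perm; apply: (perm_trans pp).
  by apply/permPl; apply: (perm_catC [:: i] [:: j]).
have k1I2 : k.+1 \notin idx ((j, k) :: ps) [:: i] by rewrite -(idx_lt _ pp1) ltnn.
have tri1 l : (l < k.+1)%N -> icomb (iota 0 l) (f1 l - e l).
  rewrite ltnS leq_eqVlt /f1 => /orP[/eqP->|lk]; first by rewrite updE addrAC subrr add0r.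
  by rewrite updN ?ltn_eqF //; apply: tri.
have b1 : forall l, (l < k.+1)%N -> (a1 l <= K.+1)%N by apply: upd_le.
have eo2 l : l \in idx ((j, k) :: ps) [:: i] -> bt (f1 l) (e k.+1) = 0.
  rewrite -(idx_lt _ pp1) ltnS leq_eqVlt /f1 => /orP[/eqP->|lk]; last first.
    by rewrite updN ?ltn_eqF //; apply: eo'; rewrite -(idx_lt _ pk).
  rewrite updE (btDl HB) ee add0r; apply: (comb_orth HB icy) => m; rewrite mem_iota /= => mk.
  by apply: (bt_e_off0 (t := t)).
have par1 : ~~ odd (a1 i + K) by rewrite /a1 updN.
(* The first vector has been paired with j, so the second one meets the single i alone. *)
have [y' hy' hR2] := new_odd HF HB hR' k1I2 eo2 eK1 erefl par1.
have icy' : icomb (iota 0 k.+1) y' := Lam_icomb HF tri1 pp1 b1 hy'.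
have tri2 f2 l : f2 = upd f1 k.+1 (e k.+1 + y') -> (l < off t.+1)%N -> icomb (iota 0 l) (f2 l - e l).
  move=> ->; rewrite kS ltnS leq_eqVlt => /orP[/eqP->|lk]; first by rewrite updE addrAC subrr add0r.
  by rewrite updN ?ltn_eqF //; apply: tri1.
case: hR2 => hR2.
  (* A second plane would leave no single, and xi of the new form would be nonzero against (PO3). *)
  exfalso; have pp2 : perm_eq (idx [:: (i, k.+1), (j, k) & ps] [::]) (iota 0 (off t.+1)).
    by rewrite kS; apply: (perm_iotaS (I := idx ((j, k) :: ps) [:: i])) => //; apply: idx_pair_perm.
  have [_ x0 _] := @RS_Bpre _ _ HF bl t.+1 _ _ _ [::] (fun l => tri2 _ l erefl) pp2 hR2.
  by rewrite hh eqxx in x0.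
exists t.+1, (upd f1 k.+1 (e k.+1 + y')), (upd a1 k.+1 K.+1), ((j, k) :: ps), [:: k.+1; i]; split=> //.
  apply: (ext2 hS) => //.
  by apply: (perm_iotaS (I := idx ((j, k) :: ps) [:: i])).
by move=> _; rewrite hD kS; apply: Or32; split=> //; apply: upd_le.
Qed.

Lemma step_D : progress t.
Proof.
have : (deg (Cb bl t.+1) <= 2)%N.
  have := @D_deg2 _ _ _ hpo [:: t.+1] K; rewrite big_cons big_nil addn0; apply=> //.
  by move=> j; rewrite inE => /eqP->; rewrite ltnS ht eqxx hD.
move: (deg_pos hok ht); rewrite leq_eqVlt => /orP[/eqP/esym/step_D1//|h1] h2.
by apply: step_D2; apply/eqP; rewrite eqn_leq h1 h2.
Qed.

End OneStep.

Lemma stage0 : Stage 0 (fun=> 0) (fun=> 0%N) [::] [::] /\ Last 0 (fun=> 0%N) [::].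
Proof. by split=> //; split; rewrite ?take0. Qed.

Lemma stage_final : exists f a ps ss, Stage (size bl) f a ps ss.
Proof.
suff main d t f a ps ss : (size bl - t <= d)%N -> (t <= size bl)%N -> Stage t f a ps ss -> Last t a ss ->
    exists f a ps ss, Stage (size bl) f a ps ss.
  by have [h1 h2] := stage0; apply: (main (size bl) 0%N) h1 h2; rewrite ?subn0.
elim: d t f a ps ss => [|d IH] t f a ps ss hd hle hS hL.
  have -> : size bl = t by apply/eqP; rewrite eqn_leq hle -subn_eq0 andbT -leqn0.
  by exists f, a, ps, ss.
move: hle; rewrite leq_eqVlt => /orP[/eqP tE|ht]; first by rewrite -tE; exists f, a, ps, ss.
have [t' [f' [a' [ps' [ss' [h1 h2 h3 h4]]]]]] : progress t.
  by have [hD|hE] := boolP (isD (Cb bl t.+1)); [apply: step_D hS hL ht hD | apply: step_E hS hL ht hE].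
by apply: (IH t') h3 h4 => //; move: hd h1 ht; clear; lia.
Qed.

End Induction.

(** * Run lengths and jumps of a sorted sequence *)

Lemma runs_nseq_cat m k r : (if runs r is p :: _ then p.2 != k else true) ->
  runs (nseq m.+1 k ++ r) = (m.+1, k) :: runs r.
Proof.
move=> h; elim: m => [|m IH] /=.
  by case: (runs r) h => [|[c y] l] //= h; rewrite eq_sym (negPf h).
by move: IH => /= ->; rewrite eqxx.
Qed.

Lemma runs_flatten ns ms : size ns = size ms -> all (fun x => 0 < x)%N ns -> sorted ltn ms ->
  runs (flatten [seq nseq p.1 p.2 | p <- zip ns ms]) = zip ns ms.
Proof.
elim: ns ms => [|[|c] ns IH] [|m ms] // [sz] hpos so.
have IHs : runs (flatten [seq nseq p.1 p.2 | p <- zip ns ms]) = zip ns ms.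
  by apply: IH => //; apply: path_sorted so.
rewrite [zip _ _]/= map_cons [flatten _]/= -/(flatten _) -cat_cons.
rewrite -[_ :: nseq _ _]/(nseq c.+1 m) runs_nseq_cat IHs //.
by case: ns ms so {IH IHs hpos sz} => [|c' ns] [|m' ms] //= /andP[mm _]; rewrite gtn_eqF.
Qed.

Lemma flatten_mem (ns ms : seq nat) x : x \in flatten [seq nseq p.1 p.2 | p <- zip ns ms] -> x \in ms.
Proof.
case/flattenP => _ /mapP[[c m] cm ->]; rewrite mem_nseq /= => /andP[_ /eqP ->].
elim: ns ms cm => [|c' ns IH] [|m' ms] //=; rewrite !inE => /orP[/eqP[_ ->]|/IH ->].
  by rewrite eqxx.
by rewrite orbT.
Qed.

Lemma size_flatten_zip (ns ms : seq nat) : size ns = size ms ->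
  size (flatten [seq nseq p.1 p.2 | p <- zip ns ms]) = sumn ns.
Proof.
elim: ns ms => [|c ns IH] [|m ms] //= [sz]; by rewrite size_cat size_nseq IH.
Qed.

Lemma flatten_boundary (ns ms : seq nat) j i l : size ns = size ms -> sorted ltn ms ->
  let s := flatten [seq nseq p.1 p.2 | p <- zip ns ms] in
  (i < sumn (take j ns))%N -> (sumn (take j ns) <= l)%N -> (l < size s)%N ->
  (nth 0 s i < nth 0 s l)%N.
Proof.
move=> sz so s hi hl hs.
have zE : zip ns ms = zip (take j ns) (take j ms) ++ zip (drop j ns) (drop j ms).
  by rewrite -zip_cat ?cat_take_drop // !size_take sz.
have sE : s = flatten [seq nseq p.1 p.2 | p <- zip (take j ns) (take j ms)] ++
   flatten [seq nseq p.1 p.2 | p <- zip (drop j ns) (drop j ms)].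
  by rewrite /s zE map_cat flatten_cat.
have s1 : size (flatten [seq nseq p.1 p.2 | p <- zip (take j ns) (take j ms)]) = sumn (take j ns).
  by apply: size_flatten_zip; rewrite !size_take sz.
move: hs; rewrite sE size_cat s1 => hs; rewrite !nth_cat s1 hi (ltnNge l) hl /=.
have m1 : nth 0%N (flatten [seq nseq p.1 p.2 | p <- zip (take j ns) (take j ms)]) i \in take j ms.
  by apply: (@flatten_mem (take j ns)); rewrite mem_nth // s1.
have m2 : nth 0%N (flatten [seq nseq p.1 p.2 | p <- zip (drop j ns) (drop j ms)]) (l - sumn (take j ns)) \in drop j ms.
  apply: (@flatten_mem (drop j ns)); rewrite mem_nth //; by rewrite -(ltn_add2l (sumn (take j ns))) subnKC.
move: so; rewrite -{1}(cat_take_drop j ms) (sorted_pairwise ltn_trans) pairwise_cat => /andP[/allrelP h _].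
exact: h m1 m2.
Qed.

(** * Integral base changes and equivalence *)

Section GLoGroup.

Variables (F : fieldType) (v : F -> int).
Hypothesis HF : unram2 v.
Notation wge := (wge v).
Notation wex := (wex v).

Lemma GLoP n (U : 'M[F]_n) : (forall i j, wge (U i j) 0) -> wex (\det U) 0 -> GLo v U.
Proof.
move=> h1 h2; apply/andP; split; last by rewrite unit_wex.
by apply/forallP => i; apply/forallP => j; rewrite integral_wge.
Qed.

Lemma GLo_mul n (U W : 'M[F]_n) : GLo v U -> GLo v W -> GLo v (U *m W).
Proof.
move=> hU hW; have [_ dU iU] := GLo_unit hU; have [_ dW iW] := GLo_unit hW.
apply: GLoP; last by rewrite det_mulmx; apply: (wexE (wexM HF dU dW)).
by move=> i j; rewrite mxE; apply: (wge_sum HF) => k _; apply: (wgeM_le HF (iU _ _) (iW _ _)).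
Qed.

Lemma GLo_inv n (U : 'M[F]_n) : GLo v U -> GLo v (invmx U).
Proof.
move=> hU; have [uU dU iU] := GLo_unit hU; apply: GLoP.
  move=> i j; have := @wge_inv _ _ HF _ U (fun=> 0) uU dU; rewrite /= subrr; apply.
  exact: iU.
by rewrite det_inv; have := wexV HF dU; rewrite oppr0.
Qed.

Lemma inSU_sim n (M M' : 'M[F]_n) : sim v M M' -> inSU v M = inSU v M'.
Proof.
move=> [U [hU ->]]; have [uU _ _] := GLo_unit hU.
apply/funext => a; apply/propext; split=> -[W [hW h]].
  exists (invmx U *m W); split; first by apply: GLo_mul => //; apply: GLo_inv.
  suff -> : (invmx U *m W)^T *m (U^T *m M *m U) *m (invmx U *m W) = W^T *m M *m W by [].
  rewrite trmx_mul trmx_inv !mulmxA -[_ *m U *m invmx U]mulmxA mulmxV // mulmx1.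
  by rewrite -[W^T *m invmx _ *m _]mulmxA mulVmx ?unitmx_tr // mulmx1.
exists (U *m W); split; first exact: GLo_mul.
by rewrite trmx_mul !mulmxA in h *.
Qed.

Lemma GK_sim n (M M' : 'M[F]_n) : sim v M M' -> GK v M = GK v M'.
Proof. by move=> h; rewrite /GK (inSU_sim h). Qed.

End GLoGroup.

Lemma mxeE (F : fieldType) m (M : 'M[F]_m) (i j : 'I_m) : mxe M i j = M i j.
Proof. by rewrite /mxe !valK. Qed.

Lemma mxe_out (F : fieldType) m (M : 'M[F]_m) i j : ~~ ((i < m)%N && (j < m)%N) -> mxe M i j = 0.
Proof.
rewrite /mxe negb_and => /orP[h|h]; first by rewrite insubF // (negPf h).
by rewrite [insub j]insubF ?(negPf h) //; case: (insub i).
Qed.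

(** * Optimal forms and their leading blocks *)

Section Final.

Variables (F : fieldType) (v : F -> int).
Hypothesis HF : unram2 v.
Notation wge := (wge v).
Variable bl : seq (nat * blk F).
Notation off t := (degs (take t bl)).
Notation n := (degs bl).
Notation e := (ebas F n).
Notation B := (assemble bl).
Notation bt := (mbt B).
Notation RS := (RS v bt).
Notation icomb I := (comb e I (fun _ c => wge c 0)).
Let HB := bt_symbil bl.

Variables (f : nat -> 'cV[F]_n) (a : nat -> nat) (ps : seq (nat * nat)) (ss : seq nat).
Hypothesis hS : Stage v (size bl) f a ps ss.

Let offn : off (size bl) = n. Proof. by rewrite take_size. Qed.

Definition Utri : 'M[F]_n := \matrix_(i, j) f j i 0.
Definition Aopt : 'M[F]_n := Utri^T *m B *m Utri.
Definition aseq := mkseq a n.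

Lemma icomb_entry l x : icomb (iota 0 l) x -> forall i : 'I_n,
  ((l <= i)%N -> x i 0 = 0) /\ wge (x i 0) 0.
Proof.
move=> hx i; elim: x / hx => [|x m c _ [IH1 IH2] mI hc]; first by rewrite mxE (wge0 v).
rewrite !mxE; split.
  move=> li; rewrite IH1 // add0r (_ : (i == m :> nat) = false) ?mulr0 //.
  by move: mI; rewrite mem_iota /= => ml; rewrite gtn_eqF // (leq_trans ml).
apply: wgeD => //; apply: (wgeM_le HF hc (l := 0)) => //.
by case: (_ == _); rewrite ?(wge1 HF) ?(wge0 v).
Qed.

Lemma f_entry (i j : 'I_n) : ((j < i)%N -> f j i 0 = 0) /\ (f j j 0 = 1) /\ wge (f j i 0) 0.
Proof.
have jn : (j < off (size bl))%N by rewrite offn.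
have tr := st_tri hS jn.
have E (l : 'I_n) : f j l 0 = (f j - e j) l 0 + (l == j :> nat)%:R by rewrite !mxE subrK.
split; [|split].
- move=> ji; rewrite E; have [z _] := icomb_entry tr i.
  by rewrite z ?(ltnW ji) // add0r gtn_eqF.
- by rewrite E eqxx; have [z _] := icomb_entry tr j; rewrite z // add0r.
rewrite E; apply: wgeD => //; first by have [] := icomb_entry tr i.
by case: (_ == _); rewrite ?(wge1 HF) ?(wge0 v).
Qed.

Lemma Utri_GLo : GLo v Utri.
Proof.
apply: GLoP.
  by move=> i j; rewrite mxE; have [_ [_]] := f_entry i j.
rewrite -det_tr det_trig; last first.
  by apply/is_trig_mxP => i j ij; rewrite !mxE; have [->] := f_entry j i.
rewrite big1 ?(wex1 HF) // => i _; rewrite !mxE; by have [_ [->]] := f_entry i i.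
Qed.

Lemma col_Utri (j : 'I_n) : col j Utri = f j.
Proof. by apply/colP => i; rewrite !mxE. Qed.

Lemma AoptE (i j : 'I_n) : Aopt i j = bt (f i) (f j).
Proof. by rewrite -mbt_col !col_Utri. Qed.

Lemma Aopt_sym : Aopt^T = Aopt.
Proof. by rewrite /Aopt !trmx_mul trmxK assemble_sym mulmxA. Qed.

Lemma bounded_f : bounded v bt f a (iota 0 n).
Proof.
have := RS_bounded HF HB (st_RS hS); have m := perm_mem (st_perm hS).
rewrite offn in m => -[h1 h2]; split.
  by move=> i; rewrite -m; apply: h1.
by move=> i j; rewrite -!m; apply: h2.
Qed.

Lemma a_mono i j : (i <= j)%N -> (j < n)%N -> (a i <= a j)%N.
Proof. by move=> ij jn; apply: (st_mono hS ij); rewrite offn. Qed.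

Lemma Aopt_inS : inS v Aopt aseq.
Proof.
have [h1 h2] := bounded_f; split.
- by rewrite size_mkseq.
- apply/(sortedP 0%N) => i; rewrite size_mkseq => hi.
  by rewrite !nth_mkseq // ?a_mono // ltnW.
- by move=> i; rewrite AoptE nth_mkseq // vge_wge; apply: h1; rewrite mem_iota /=.
move=> i j ij; rewrite AoptE !nth_mkseq // PoszD.
have [->|ne] := eqVneq i j.
  by apply: (wge_dbl HF (h1 j _)); rewrite ?mem_iota //=; move: (a j) => p; clear; lia.
by apply: h2; rewrite ?mem_iota /=.
Qed.

Lemma boundary c : (0 < c <= n)%N -> ((c < n)%N -> (a c.-1 < a c)%N) ->
  exists t ps' ss', [/\ (t <= size bl)%N, off t = c, perm_eq (idx ps' ss') (iota 0 c) & RS f a ps' ss'].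
Proof.
move=> /andP[c0 cn] h; move: cn; rewrite leq_eqVlt => /orP[/eqP cE|cn].
  exists (size bl), ps, ss; rewrite offn cE; split=> //; last exact: st_RS hS.
  by have := st_perm hS; rewrite offn.
case: c c0 h cn => // c _ h cn; apply: (st_hist hS); [by rewrite offn | exact: h].
Qed.

Lemma Aopt_nonsing : nonsing v Aopt aseq.
Proof.
apply: (nonsing_RS HF HB AoptE bounded_f) => m.
(* By monotonicity [k] counts the exponents up to m; it is 0, n or a jump, so a recorded matching of
   the first [k] indices exists. *)
pose k := find (fun i => (m < a i)%N) (iota 0 n).
have kn : (k <= n)%N by have := find_size (fun i => (m < a i)%N) (iota 0 n); rewrite size_iota.
have lo i : (i < k)%N -> (a i <= m)%N.
  move=> ik; have := before_find 0%N ik; rewrite nth_iota ?add0n; first by move/negbT; rewrite -leqNgt.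
  exact: leq_trans ik kn.
have hi : (k < n)%N -> (m < a k)%N.
  move=> kn'; have hh : has (fun i => (m < a i)%N) (iota 0 n) by rewrite has_find size_iota.
  by have := nth_find 0%N hh; rewrite nth_iota.
have kE i : (i < n)%N -> (i < k)%N = (a i <= m)%N.
  move=> hin; have [ik|ki] := ltnP i k; first by rewrite lo.
  apply/esym/negbTE; rewrite -ltnNge; apply: leq_trans (hi (leq_ltn_trans ki hin)) _.
  exact: a_mono.
have [k0|k0] := posnP k.
  by exists 0%N, [::], [::]; split=> // i /kE; rewrite k0.
have [|//|t [ps' [ss' [h1 h2 h3 h4]]]] := @boundary k; first by rewrite k0 kn.
  move=> kn'; apply: leq_ltn_trans (hi kn'); apply: lo; by rewrite prednK.
by exists k, ps', ss'.
Qed.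

Lemma sim_Aopt : sim v B Aopt. Proof. by exists Utri; split=> //; apply: Utri_GLo. Qed.

Lemma GK_B : GK v B = aseq.
Proof.
rewrite (GK_sim HF sim_Aopt); apply: (GK_eq HF); [exact: Aopt_sym | exact: Aopt_inS | exact: Aopt_nonsing].
Qed.

(** An arbitrary optimal form, such as the one picked in [EGK], differs from [Aopt] by a matrix that
    respects the filtration. Below a jump the two leading blocks therefore have the same graded form
    after a change of basis over [F], and the graded form determines zeta. *)
Lemma zeta_boundary (M : 'M[F]_n) c t ps' ss' : sim v B M -> optimal v M ->
  (c <= n)%N -> (forall i l, (i < c)%N -> (c <= l)%N -> (l < n)%N -> (a i < a l)%N) ->
  c = off t -> perm_eq (idx ps' ss') (iota 0 c) -> RS f a ps' ss' ->
  zeta v (ulsub c M) = zeta v (Bpre bl t).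
Proof.
move=> hsim hopt cn lt cE pk hR.
have hM : inS v M aseq by move: hopt; rewrite /optimal -(GK_sim HF hsim) GK_B.
case: hsim => U [hU ME].
have [uU _ _] := GLo_unit hU; have [u0 _ _] := GLo_unit Utri_GLo.
pose W := invmx Utri *m U.
have hW : GLo v W by apply: (GLo_mul HF) => //; apply: (GLo_inv HF Utri_GLo).
have MW : M = W^T *m Aopt *m W.
  rewrite ME /W /Aopt trmx_mul trmx_inv !mulmxA -[_ *m Utri *m invmx Utri]mulmxA mulmxV // mulmx1.
  by rewrite -[U^T *m invmx _ *m _]mulmxA mulVmx ?unitmx_tr // mulmx1.
have hMW : inS v (W^T *m Aopt *m W) aseq by rewrite -MW.
have [sz so _ _] := Aopt_inS.
have lexx' : lexle aseq aseq by case/orP: (lexle_total aseq aseq).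
have [_ hZ] := GK_unique HF Aopt_sym Aopt_nonsing hW hMW sz so lexx'.
have [uW _ _] := GLo_unit hW; have [_ _ iZ] := GLo_unit (GLo_inv HF hW).
have MS : M^T = M by rewrite ME !trmx_mul trmxK assemble_sym mulmxA.
set Z := invmx W in hZ iZ.
have UZ : Utri = U *m Z.
  suff -> : Z = invmx U *m Utri by rewrite mulmxA mulmxV // mul1mx.
  have WV : W *m (invmx U *m Utri) = 1%:M by rewrite /W -mulmxA mulKVmx // mulVmx.
  by rewrite -[RHS](mulKmx uW) WV mulmx1.
pose f' (i : nat) : 'cV[F]_n := if insub i is Some i' then col i' U else 0.
have f'E (i : 'I_n) : f' i = col i U by rewrite /f' valK.
have btf' (i j : 'I_n) : bt (f' i) (f' j) = M i j by rewrite !f'E mbt_col -ME.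
have bf' : bounded v bt f' a (iota 0 n).
  have [_ _ hd _] := hM; split.
    move=> i; rewrite mem_iota /= => hi; have := hd (Ordinal hi).
    by rewrite nth_mkseq // vge_wge -btf'.
  move=> i j; rewrite !mem_iota /= => hi hj ij.
  by have := inS_off (Ordinal hi) (Ordinal hj) MS hM; rewrite !nth_mkseq // -btf'.
(* [f j] is expanded in the basis [f'] belonging to [M]. Cutting the sum at [c] gives vectors in the
   span of the first [c] members of [f']; the discarded part has integral coefficients and exponents
   above [a j], so it lies one level deeper. *)
pose fpart (I : seq nat) j := \sum_(i <- I) mxe Z i j *: f' i.
have fE j : (j < n)%N -> f j = fpart (iota 0 n) j.
  move=> hj; have -> : f j = col (Ordinal hj) Utri by rewrite col_Utri.
  have -> : fpart (iota 0 n) j = \sum_(i < n) mxe Z i j *: f' i.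
    by rewrite -(big_mkord xpredT (fun i => mxe Z i j *: f' i)) /index_iota subn0.
  apply/colP => x; rewrite UZ !mxE summxE; apply: eq_bigr => i _.
  by rewrite !mxE f'E mxE -[j]/(nat_of_ord (Ordinal hj)) mxeE mulrC.
have split_f j : (j < n)%N -> fpart (iota 0 c) j - f j = - fpart (iota c (n - c)) j.
  move=> hj; have ioE : iota 0 n = iota 0 c ++ iota c (n - c) by rewrite -iotaD subnKC.
  by rewrite fE // /fpart ioE big_cat /= opprD addrA subrr sub0r.
have zb i j : (i < n)%N -> (j < n)%N -> wge (mxe Z i j) ((a j)%:Z - (a i)%:Z) /\ wge (mxe Z i j) 0.
  move=> hi hj; have := hZ (Ordinal hi) (Ordinal hj); have := iZ (Ordinal hi) (Ordinal hj).
  by rewrite -!mxeE !nth_mkseq.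
have lamsum (I : seq nat) j (T : int) : {subset I <= iota 0 n} ->
    (forall i, i \in I -> wge (mxe Z i j) (T - (a i)%:Z)) -> Lam v f' a (iota 0 n) T (fpart I j).
  move=> sI hI; rewrite /fpart big_seq; apply: (big_ind (Lam v f' a (iota 0 n) T)).
  - exact: comb0.
  - by move=> x y; apply: LamD.
  - by move=> i iI; apply: Lam1; [apply: sI | apply: hI].
have jc j : j \in idx ps' ss' -> (j < c)%N by rewrite (perm_mem pk) mem_iota.
have [c1 c2] : (forall i, i \in idx ps' ss' ->
     wge (bt (fpart (iota 0 c) i) (fpart (iota 0 c) i) - bt (f i) (f i)) (2 * (a i)%:Z + 2)) /\
  (forall i j, i \in idx ps' ss' -> j \in idx ps' ss' -> i != j ->
     wge (2 * bt (fpart (iota 0 c) i) (fpart (iota 0 c) j) - 2 * bt (f i) (f j)) ((a i)%:Z + (a j)%:Z + 1)).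
  apply: (Lam_cong_in HF HB bf') => j /jc hj; have jn := leq_trans hj cn.
    rewrite fE //; apply: lamsum => // i; rewrite mem_iota /= => hi.
    by have [] := zb i j hi jn.
  rewrite split_f // -scaleN1r; apply: (LamZ HF (t := (a j)%:Z + 1) (r := 0)); last by clear; lia.
    apply: lamsum.
      by move=> i; rewrite !mem_iota subnKC // => /andP[_].
    move=> i; rewrite mem_iota subnKC // => /andP[ci hi].
    have [_ z0] := zb i j hi jn; apply: wge_le z0 _.
    by have := lt _ _ hj ci hi; move: (a i) (a j) => p q; clear; lia.
  by rewrite (wgeN HF); apply: (wge1 HF).
have [Y1 Y1E] : exists Y1 : 'M[F]_c, Y1^T *m gram bt f' c *m Y1 = gram bt (fpart (iota 0 c)) c.
  apply: (gram_transform HB) => l lc; rewrite /fpart big_seq.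
  apply: (big_ind (comb f' (iota 0 c) (fun _ _ => true))).
  - exact: comb0.
  - by move=> x y; apply: combD.
  - by move=> i iI; apply: comb1.
have ME' : ulsub c M = gram bt f' c.
  apply/matrixP => i j; rewrite !mxE.
  have hi := leq_trans (ltn_ord i) cn; have hj := leq_trans (ltn_ord j) cn.
  by rewrite -[bt _ _]/(bt (f' (Ordinal hi)) (f' (Ordinal hj))) btf' -mxeE.
rewrite -ME' in Y1E.
have tri l : (l < off t)%N -> icomb (iota 0 l) (f l - e l).
  move=> hl; apply: (st_tri hS); rewrite offn; apply: leq_trans hl (off_le_n bl t).
have [Y YE] := tri_Bpre HF tri.
subst c; apply/esym; have := zeta_cong HF HB pk hR c1 c2 YE Y1E; exact.
Qed.

End Final.

Lemma ulsub_Bpre (F : fieldType) (bl : seq (nat * blk F)) t x y :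
  mxe (ulsub (degs (take t bl)) (assemble bl)) x y = mxe (Bpre bl t) x y.
Proof.
have [/andP[hx hy]|h] := boolP ((x < degs (take t bl))%N && (y < degs (take t bl))%N); last first.
  by rewrite !mxe_out.
have hx' := leq_trans hx (off_le_n bl t); have hy' := leq_trans hy (off_le_n bl t).
rewrite (mxeE _ (Ordinal hx) (Ordinal hy)) (mxeE (Bpre bl t) (Ordinal hx) (Ordinal hy)) !mxE /=.
by rewrite (mxeE _ (Ordinal hx') (Ordinal hy')) mxE ent_take.
Qed.

Theorem theorem4p2 (F : fieldType) (v : F -> int) (HF : unram2 v)
    (bl : seq (nat * blk F)) (ns ms : seq nat) :
  all (fun p => blk_ok v p.2) bl ->
  in_Hn v (assemble bl) ->
  pre_optimal v bl ->
  size ns = size ms -> all (fun x => 0 < x)%N ns -> sorted ltn ms ->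
  GK v (assemble bl) = flatten [seq nseq p.1 p.2 | p <- zip ns ms] ->
  exists l : nat -> nat,
    (forall j : nat, (1 <= j <= size ns)%N ->
       [/\ (1 <= l j <= size bl)%N,
           sumn (take j ns) = degs (take (l j) bl) &
           forall a b : nat,
             mxe (ulsub (sumn (take j ns)) (assemble bl)) a b =
             mxe (Bpre bl (l j)) a b]) /\
    EGK v (assemble bl) =
      (ns, ms, [seq zeta v (Bpre bl (l j)) | j <- iota 1 (size ns)]).
Proof.
move=> hok _ hpo sz pos so hGK.
have [f [a [ps [ss hS]]]] := stage_final HF hok hpo.
set n := degs bl in f hS *; pose B := assemble bl.
have aE : mkseq a n = flatten [seq nseq p.1 p.2 | p <- zip ns ms] by rewrite -hGK (GK_B HF hS).
have sn : sumn ns = n by rewrite -(size_flatten_zip sz) -aE size_mkseq.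
pose c j := sumn (take j ns).
have cn j : (c j <= n)%N.
  by rewrite -sn -[in leqRHS](cat_take_drop j ns) sumn_cat leq_addr.
have lt j i m : (i < c j)%N -> (c j <= m)%N -> (m < n)%N -> (a i < a m)%N.
  move=> ic cm mn; have := @flatten_boundary ns ms j i m sz so; rewrite /= -aE size_mkseq.
  by rewrite !nth_mkseq //; [apply | apply: leq_trans ic (cn j)].
have c0 j : (1 <= j <= size ns)%N -> (0 < c j)%N.
  rewrite /c; case: j ns pos {sz hGK aE sn cn lt c} => [|j] [|x s] //= /andP[x0 _] _; exact: ltn_addr.
(* The range condition stands inside the existential, so that [choice] yields a total function;
   outside the range the value 0 is arbitrary. *)
have key j : exists t, (1 <= j <= size ns)%N ->
    [/\ (1 <= t <= size bl)%N, c j = degs (take t bl) &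
        forall M, sim v B M -> optimal v M -> zeta v (ulsub (c j) M) = zeta v (Bpre bl t)].
  have [hj|_] := boolP (1 <= j <= size ns)%N; last by exists 0%N.
  have cj := c0 _ hj.
  have [||t [ps' [ss' [tb tc pk hR]]]] := boundary hS (c := c j); first by rewrite cj cn.
    by move=> h; apply: (lt j) => //; rewrite prednK.
  exists t => _; split=> //.
  - by rewrite tb andbT lt0n; apply/eqP => t0; move: tc cj; rewrite t0 take0 => <-.
  - move=> M hM oM; apply: (zeta_boundary HF hS hM oM (cn j) (lt j) _ pk hR); exact: esym tc.
have [l hl] := choice key; exists l; split.
  by move=> j hj; have [h1 h2 _] := hl j hj; split=> // x y; rewrite -/(c j) h2 ulsub_Bpre.
rewrite /EGK; set M := classical_sets.xget _ _.
have [hM oM] : sim v B M /\ optimal v M.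
  rewrite /M; apply: (@classical_sets.xgetPex _ B (fun M => sim v B M /\ optimal v M)).
  exists (Aopt f); split; first exact: (sim_Aopt HF hS).
  rewrite /optimal -(GK_sim HF (sim_Aopt HF hS)) (GK_B HF hS); exact: (Aopt_inS HF hS).
rewrite -(GK_sim HF hM) hGK runs_flatten // -/(unzip1 _) -/(unzip2 _) unzip1_zip ?unzip2_zip ?sz //.
congr (_, _); rewrite -sz; apply/eq_in_map => j; rewrite mem_iota add1n ltnS => hj.
by have [_ _ ->] := hl j hj.
Qed.
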